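(* Let $d\ge1$ and $T>0$. Let $\eta^N(t)$ be the process generated by $L_N=N^2L_K+KL_G$ (under conditions (1)–(6) and (BS) of the context) with initial distribution $\mu^N$, and let $\mu_t^N$ be the law of $\eta^N(t)$. Let $K=K(N)\ge1$ be increasing, $\kappa\in[0,1)$, and let $u_{t,x}=u_{t,x}(N)$, $t\in[0,T]$, $x\in\mathbb T_N^d$, be deterministic values with $u_-\le u_{t,x}\le u_+$ for some $0<u_-<u_+<1$ and $$|u_{t,y}-u_{t,x}|\le C\frac{K^{1/\sigma}}{N[t(T-t)]^\kappa}$$ for all $t\in[0,T]$, all $x,y$ with $|x-y|=1$ and all $N$ large enough. Let $\nu_t^N$ be the Bernoulli product measure with means $\{u_{t,x}\}_x$. Let $h$ be an $N$-independent local function with support in a finite box and set $f_{t,x}(\eta)=\tau_xh(\eta)-\tilde h(u_{t,x})-\tilde h'(u_{t,x})(\eta_x-u_{t,x})$, $\tilde h(\beta)=E^{\nu_\beta}[h]$. Let $a_{t,x}=a_{t,x}(N)\in\mathbb R$ be deterministic with $\sup_{x}|a_{t,x}|\le C\frac{K^\theta}{[t(T-t)]^\kappa}$ for all $t\in(0,T)$, for some $\theta\ge0$. Then there exist $C,\epsilon_0,\epsilon_1>0$ such that for all $N$ large enough, if $K=O(N^{\epsilon_0})$ as $N\to\infty$, then $$\mathbb E^{\mu^N}\Big|\int_0^T\sum_{x\in\mathbb T_N^d}a_{t,x}f_{t,x}(\eta^N(t))\,dt\Big|\le C\Big(K^\theta\int_0^TH(\mu_t^N|\nu_t^N)\fr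ac{dt}{[t(T-t)]^\kappa}+N^{d-\epsilon_1}\Big).$$
   Context: Setting. $\mathbb T_N^d=(\mathbb Z/N\mathbb Z)^d$, $\mathcal X_N=\{0,1\}^{\mathbb T_N^d}$, $\mathcal X=\{0,1\}^{\mathbb Z^d}$. $\eta^{x,y}$: values at $x,y$ exchanged; $\eta^x$: $\eta_x$ flipped; $(\tau_x\eta)_z=\eta_{z+x}$, $\tau_xg(\eta)=g(\tau_x\eta)$; $e_i$ unit vectors. Local function: depends on finitely many coordinates. $\nu_\rho$: Bernoulli product measure with mean $\rho$. Exchange rates $c_{x,y}=c_{y,x}$ ($|x-y|=1$): (1) $c_{x,y}>0$; (2) $c_{x,y}(\eta)=c_{0,y-x}(\tau_x\eta)$; (3) $c_{0,y-x}$ local; (4) $c_{x,y}(\eta^{x,y})=c_{x,y}(\eta)$; (5) there are local $h_i$ with $c_{0,e_i}(\eta)(\eta_0-\eta_{e_i})=h_i(\eta)-h_i(\tau_{e_i}\eta)$; (6) $P_i(\rho)=E^{\nu_\rho}[h_i]$ independent of $i$, denoted $P$. Flip rate: nonnegative local $c$, $c_x=\tau_xc$, $c=c^+(1-\eta_0)+c^-\eta_0$, $c^\pm$ independent of $\eta_0$; $f(\rho)=E^{\nu_\rho}[(1-2\eta_0)c]$. (BS): $f$ has exactly three zeros $0<\alpha_1<\alpha_*<\alpha_2<1$ with $f'(\alpha_1)<0,f'(\alpha_* )>0,f'(\alpha_2)<0$ and $\int_{\alpha_1}^{\alpha_2}fP'd\rho=0$. $L_Kg=\frac12\sum_{|x-y|=1}c_{x,y}(\eta)\{g(\eta^{x,y})-g(\eta)\}$,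 $L_Gg=\sum_xc_x(\eta)\{g(\eta^x)-g(\eta)\}$. $\mathbb E^{\mu^N}$: expectation for the process started from $\mu^N$. $H(\mu|\nu)=\int\frac{d\mu}{d\nu}\log\frac{d\mu}{d\nu}d\nu$. $\sigma\in(0,1)$ is a fixed constant depending only on $d,P,f$ (the Hölder exponent from the Nash estimate for the discretized reaction–diffusion equation $\partial_tu=\Delta^NP(u)+Kf(u)$). *)

(* Defs.v *)
From HB Require Import structures.
From mathcomp Require Import all_boot all_order all_algebra.
From mathcomp Require Import all_classical all_reals all_analysis.
Set Implicit Arguments. Unset Strict Implicit. Unset Printing Implicit Defensive.
Import Order.TTheory GRing.Theory Num.Theory.
Import numFieldNormedType.Exports.
Local Open Scope classical_set_scope.
Local Open Scope ring_scope.

Definition zsite (d : nat) := {ffun 'I_d -> int}.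
Definition zconf (d : nat) := zsite d -> bool.
Definition zunit (d : nat) (i : 'I_d) : zsite d := [ffun j => (j == i)%:Z].
Definition zshift d (x : zsite d) (xi : zconf d) : zconf d := fun z => xi (z + x).
Definition zset d (xi : zconf d) (z : zsite d) (b : bool) : zconf d :=
  fun w => if w == z then b else xi w.
Definition zswap d (xi : zconf d) (z w : zsite d) : zconf d :=
  fun v => if v == z then xi w else if v == w then xi z else xi v.

Definition depends_on (R : realType) d (Lam : seq (zsite d)) (g : zconf d -> R) :=
  forall xi zeta : zconf d, (forall z, z \in Lam -> xi z = zeta z) -> g xi = g zeta.

(* E^{nu_rho}[g] for g depending only on coordinates in Lam: integrate
   the coordinates of Lam one by one against Bernoulli(rho). *)
Fixpoint EnuL (R : realType) d (rho : R) (Lam : seq (zsite d)) (g : zconf d -> R) : R :=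
  match Lam with
  | [::] => g (fun _ => false)
  | z :: Lam' => rho * EnuL rho Lam' (fun xi => g (zset xi z true))
                 + (1 - rho) * EnuL rho Lam' (fun xi => g (zset xi z false))
  end.

(* The discrete torus T_N^d = (Z/NZ)^d  (for N >= 2, 'Z_N = Z/NZ)      *)
Definition site (d N : nat) := {ffun 'I_d -> 'Z_N}.
Definition conf (d N : nat) := {ffun site d N -> bool}.
Definition tunit d N (i : 'I_d) : site d N := [ffun j => (j == i)%:R].
Definition ext d N (eta : conf d N) : zconf d :=
  fun z => eta [ffun i => ((z i)%:~R : 'Z_N)].
Definition tshift d N (x : site d N) (eta : conf d N) : conf d N :=
  [ffun y => eta (x + y)].
Definition tswap d N (eta : conf d N) (x y : site d N) : conf d N :=
  [ffun z => if z == x then eta y else if z == y then eta x else eta z].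
Definition tflip d N (eta : conf d N) (x : site d N) : conf d N :=
  [ffun z => if z == x then ~~ eta z else eta z].
Definition tloc (R : realType) d N (g : zconf d -> R) (x : site d N) (eta : conf d N) : R :=
  g (ext (tshift x eta)).

(* c i = c_{0,e_i}                                                     *)
Definition exchange_rates_ok (R : realType) d
  (c : 'I_d -> zconf d -> R) (Lc : 'I_d -> seq (zsite d))
  (hg : 'I_d -> zconf d -> R) (Lg : 'I_d -> seq (zsite d)) : Prop :=
  [/\ (forall i xi, 0 < c i xi),
      (forall i, depends_on (Lc i) (c i)),
      (forall i xi, c i (zswap xi 0 (zunit i)) = c i xi),
      (forall i, depends_on (Lg i) (hg i)) /\
      (forall i xi, c i xi * ((xi 0)%:R - (xi (zunit i))%:R)
                    = hg i xi - hg i (zshift (zunit i) xi))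
    & (forall i j (rho : R), 0 <= rho <= 1 ->
         EnuL rho (Lg i) (hg i) = EnuL rho (Lg j) (hg j))].

Definition flip_rate_ok (R : realType) d (cf : zconf d -> R) (Lf : seq (zsite d)) :=
  (forall xi, 0 <= cf xi) /\ depends_on Lf cf.

Definition freact (R : realType) d (cf : zconf d -> R) (Lf : seq (zsite d)) (rho : R) : R :=
  EnuL rho (0 :: Lf) (fun xi => (1 - 2 * (xi 0)%:R) * cf xi).

Definition Pcurr (R : realType) d (hg : 'I_d -> zconf d -> R)
  (Lg : 'I_d -> seq (zsite d)) (i : 'I_d) (rho : R) : R := EnuL rho (Lg i) (hg i).

Definition bistable (R : realType) (f P : R -> R) : Prop :=
  exists a1 as_ a2 : R,
    [/\ 0 < a1 /\ a1 < as_ /\ as_ < a2 /\ a2 < 1,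
        (forall rho, 0 <= rho <= 1 -> (f rho = 0 <-> [\/ rho = a1, rho = as_ | rho = a2])),
        derive1 f a1 < 0 /\ 0 < derive1 f as_ /\ derive1 f a2 < 0
      & (\int[@lebesgue_measure R]_(rho in `[a1, a2]) (f rho * derive1 P rho)%:E = 0)%E].

Definition LN (R : realType) d N (K : R) (c : 'I_d -> zconf d -> R) (cf : zconf d -> R)
  (g : conf d N -> R) (eta : conf d N) : R :=
  (N%:R) ^+ 2 * (\sum_(x : site d N) \sum_(i < d)
      tloc (c i) x eta * (g (tswap eta x (x + tunit N i)) - g eta))
  + K * \sum_(x : site d N) tloc cf x eta * (g (tflip eta x) - g eta).

(* p is the transition function exp(t L): unique solution of the backward
   Kolmogorov equation d/dt p_t(eta,zeta) = L (p_t(., zeta)) (eta), p_0 = id *)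
Definition is_transition (R : realType) d N (L : (conf d N -> R) -> conf d N -> R)
  (p : R -> conf d N -> conf d N -> R) : Prop :=
  (forall eta zeta, p 0 eta zeta = (eta == zeta)%:R) /\
  (forall (t : R) eta zeta, is_derive t (1 : R) (fun s => p s eta zeta) (L (fun e => p t e zeta) eta)).

Definition is_pmf (R : realType) d N (mu : conf d N -> R) :=
  (forall eta, 0 <= mu eta) /\ \sum_eta mu eta = 1.

Definition lawt (R : realType) d N (mu : conf d N -> R) (p : R -> conf d N -> conf d N -> R)
  (t : R) (zeta : conf d N) : R := \sum_eta mu eta * p t eta zeta.

Fixpoint chain (R : realType) d N (p : R -> conf d N -> conf d N -> R)
  (s : R) (y : conf d N) (l : seq (R * conf d N)) : R :=
  match l with
  | [::] => 1
  | tx :: l' => p (tx.1 - s) y tx.2 * chain p tx.1 tx.2 l'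
  end.

(* finite dimensional distributions, times 0 <= t1 <= ... <= tk *)
Definition fdd (R : realType) d N (mu : conf d N -> R) (p : R -> conf d N -> conf d N -> R)
  (l : seq (R * conf d N)) : R := \sum_eta mu eta * chain p 0 eta l.

Definition is_markov_process (R : realType) d N (dO : measure_display)
  (Om : measurableType dO) (P : probability Om R) (X : R -> Om -> conf d N)
  (mu : conf d N -> R) (p : R -> conf d N -> conf d N -> R) : Prop :=
  [/\ (forall t zeta, measurable [set om | X t om = zeta]),
      (forall om t, 0 <= t -> exists2 del : R, 0 < del &
          forall s, t <= s < t + del -> X s om = X t om)
    & (forall l : seq (R * conf d N), sorted <=%R (0 :: map fst l) ->
         P [set om | all (fun tx => X tx.1 om == tx.2) l] = (fdd mu p l)%:E)].

Definition nuprod (R : realType) d N (v : site d N -> R) (eta : conf d N) : R :=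
  \prod_x (if eta x then v x else 1 - v x).

(* relative entropy H(mu|nu), with 0 log 0 = 0 *)
Definition rel_entropy (R : realType) d N (mu nu : conf d N -> R) : R :=
  \sum_eta mu eta * ln (mu eta / nu eta).

Definition fcorr (R : realType) d N (h : zconf d -> R) (Lh : seq (zsite d))
  (v : R) (x : site d N) (eta : conf d N) : R :=
  tloc h x eta - EnuL v Lh h
  - derive1 (fun b => EnuL b Lh h) v * ((eta x)%:R - v).

(* Main.v *)
(* Expand h into monomials in the occupation variables and let Y be the average of
   eta over a segment of length l = N^(1/4) placed near x.  Then f = V + R, where V
   compares the monomials with powers of Y and R is the Taylor remainder of tilde h
   at u, so |R| <= C (Y - u)^2.  The entropy inequality with respect to nu, applied to
   disjoint segments, controls the expectation of R by the relative entropy.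
   V vanishes up to 1/l after exchanges of particles, so at a law m its expectation is
   bounded by the total variation between m and its exchanged copies, which the entropy
   production of the dynamics controls.  Entropy production is integrated against
   the semigroup started from half a point mass plus half the uniform law: this bounds
   int_s^T |E[V_t | X_s = eta]| dt for every configuration eta, hence the second moment of
   int V dt.  The times within N^(-1/32) of 0 and T, where the weights are singular, are
   estimated trivially. *)

Require Import Defs.
From HB Require Import structures.
From mathcomp Require Import all_boot all_order all_algebra all_fingroup.
From mathcomp Require Import all_classical all_reals all_analysis.
From mathcomp Require Import ring lra zify.
Import Order.TTheory GRing.Theory Num.Theory.
Import numFieldNormedType.Exports.
Import measurable_realfun.
Set Implicit Arguments. Unset Strict Implicit. Unset Printing Implicit Defensive.
Local Open Scope classical_set_scope.
Local Open Scope ring_scope.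

(** * Exchanges of coordinates *)

(** The absolute value stands outside the time integral and the initial law is arbitrary, so neither
    a bound on the mean of V nor stationarity suffices. For s <= t the mean of V_s V_t is the mean
    of V_s E[V_t | X_s]; as V_s is bounded, it is enough to control E[V_t | X_s = eta], integrated
    in t, uniformly in eta. Entropy is taken with respect to the uniform law, for which the
    exchanges are reversible. It ranges over an interval of length at most the number n of sites,
    whatever the starting law, and the flips contribute at most a multiple of K n per unit time. At
    exchange speed N^2 the exchange distances, summed over all bonds and integrated in time, are
    then of order (1 + K) n / N. Exchanges over distance l cost about l / N per site, against the 1
    / l lost when a monomial is replaced by a power of Y; with l = N^(1/4) both are small, and so is
    the oscillation of u along a segment. A point mass is mixed with the uniform law because the
    entropy is differentiated from time 0 on, which needs a strictly positive law. *)

Section Exchange.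
Variables (R : realType) (T : finType).
Local Notation cf := {ffun T -> bool}.
Implicit Types (m : cf -> R) (eta : cf) (s : {perm T}).

Definition pconf s eta : cf := [ffun z => eta (s z)].

Lemma pconfM s1 s2 eta : pconf (s1 * s2)%g eta = pconf s1 (pconf s2 eta).
Proof. by apply/ffunP => z; rewrite !ffunE permM. Qed.

Lemma pconf1 eta : pconf 1%g eta = eta.
Proof. by apply/ffunP => z; rewrite ffunE perm1. Qed.

Lemma pconfK s : cancel (pconf s) (pconf s^-1%g).
Proof. by move=> eta; rewrite -pconfM mulVg pconf1. Qed.

Lemma pconf_bij s : bijective (pconf s).
Proof.
exists (pconf s^-1%g); first exact: pconfK.
by move=> eta; rewrite -pconfM mulgV pconf1.
Qed.

Lemma sum_pconf s (F : cf -> R) : \sum_eta F (pconf s eta) = \sum_eta F eta.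
Proof.
by rewrite [RHS](reindex (pconf s)) //; apply: onW_bij; exact: pconf_bij.
Qed.

(** Twice the total variation distance between [m] and its image under the permutation. *)
Definition pdist m s : R := \sum_eta `|m eta - m (pconf s eta)|.
Definition xdist m x y : R := pdist m (tperm x y).

Lemma pdist_ge0 m s : 0 <= pdist m s.
Proof. by apply: sumr_ge0 => eta _; exact: normr_ge0. Qed.

Lemma pdistM m s1 s2 : pdist m (s1 * s2)%g <= pdist m s1 + pdist m s2.
Proof.
rewrite /pdist -(sum_pconf s2 (fun eta => `|m eta - m (pconf s1 eta)|)).
rewrite -big_split /=; apply: ler_sum => eta _; rewrite pconfM addrC.
by rewrite (le_trans _ (ler_normD _ _)) // subrKA.
Qed.

Lemma pdist1 m : pdist m 1%g = 0.
Proof. by rewrite /pdist big1 // => eta _; rewrite pconf1 subrr normr0. Qed.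

Lemma xdist_ge0 m x y : 0 <= xdist m x y. Proof. exact: pdist_ge0. Qed.

Lemma xdistC m x y : xdist m x y = xdist m y x.
Proof. by rewrite /xdist tpermC. Qed.

Lemma xdistxx m x : xdist m x x = 0.
Proof. by rewrite /xdist tperm1 pdist1. Qed.

(* [(x z) = (x y)(y z)(x y)] *)
Lemma xdist_triangle m x y z : xdist m x z <= 2 * xdist m x y + xdist m y z.
Proof.
have [->|xz] := eqVneq x z.
  by rewrite xdistxx addr_ge0 ?mulr_ge0 ?xdist_ge0.
have [->|yz] := eqVneq y z.
  by rewrite xdistxx addr0 ler_peMl ?xdist_ge0 // ler1n.
have -> : xdist m x z = pdist m (tperm y z ^ tperm x y)%g.
  by rewrite tpermJ tpermR tpermD.
rewrite conjgE tpermV (le_trans (pdistM _ _ _)) //.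
rewrite mulr_natl mulr2n -addrA lerD2l addrC; exact: pdistM.
Qed.

Definition occ x eta : R := (eta x)%:R.

Lemma occ01 x eta : 0 <= occ x eta <= 1.
Proof. by rewrite /occ; case: (eta x); rewrite ler01 lexx. Qed.

Lemma occ_pconf x s eta : occ x (pconf s eta) = occ (s x) eta.
Proof. by rewrite /occ ffunE. Qed.

(* The exchange flips the sign of [occ x eta - occ y eta], so twice the sum is a difference
   of exchanged terms. *)
Lemma exchange_bound m x y (Q : cf -> R) (eps : R) :
  (forall eta, 0 <= m eta) -> \sum_eta m eta = 1 ->
  (forall eta, `|Q eta| <= 1) ->
  (forall eta, `|Q (pconf (tperm x y) eta) - Q eta| <= eps) ->
  `|\sum_eta m eta * ((occ x eta - occ y eta) * Q eta)| <= xdist m x y + eps.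
Proof.
move=> m0 m1 Q1 Qe; set s := tperm x y in Qe *.
set S := \sum_eta _.
have E : S *+ 2 = \sum_eta (occ x eta - occ y eta) *
           (m eta * Q eta - m (pconf s eta) * Q (pconf s eta)).
  rewrite mulr2n {2}/S -(sum_pconf s) -big_split /=; apply: eq_bigr => eta _.
  by rewrite !occ_pconf tpermL tpermR; ring.
have : `|S *+ 2| <= xdist m x y + eps.
  rewrite E (le_trans (ler_norm_sum _ _ _)) //.
  have -> : xdist m x y + eps = \sum_eta (`|m eta - m (pconf s eta)| + m (pconf s eta) * eps).
    by rewrite big_split /= -mulr_suml sum_pconf m1 mul1r.
  apply: ler_sum => eta _; rewrite normrM.
  rewrite (@le_trans _ _ `|m eta * Q eta - m (pconf s eta) * Q (pconf s eta)|) //.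
    rewrite ler_piMl //; have := occ01 x eta; have := occ01 y eta; rewrite ler_norml; lra.
  have -> : m eta * Q eta - m (pconf s eta) * Q (pconf s eta) =
    (m eta - m (pconf s eta)) * Q eta - m (pconf s eta) * (Q (pconf s eta) - Q eta) by ring.
  rewrite (le_trans (ler_normB _ _)) // !normrM lerD //; first by rewrite ler_piMr.
  by rewrite (ger0_norm (m0 _)) ler_wpM2l.
rewrite normrMn mulr2n; have := normr_ge0 S; lra.
Qed.

Variables (l : nat) (w : 'I_l -> T).
Hypothesis l0 : (0 < l)%N.

Definition bavg eta : R := (\sum_r occ (w r) eta) / l%:R.

Lemma bavg01 eta : 0 <= bavg eta <= 1.
Proof.
have l0' : 0 < l%:R :> R by rewrite ltr0n.
rewrite /bavg divr_ge0 ?ler0n ?sumr_ge0 //=.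
rewrite ler_pdivrMr // mul1r -[X in _ <= X%:R]card_ord -sumr_const.
by apply: ler_sum => r _; case/andP: (occ01 (w r) eta).
Qed.

Lemma bavg_exchange eta x r : injective w -> (forall r, x != w r) ->
  `|bavg (pconf (tperm x (w r)) eta) - bavg eta| <= l%:R^-1.
Proof.
move=> winj xw; rewrite /bavg -mulrBl normrM [`|_^-1|]ger0_norm ?invr_ge0 ?ler0n //.
rewrite ler_piMl ?invr_ge0 ?ler0n // -sumrB (bigD1 r) //= big1 => [|j jr].
  rewrite addr0 occ_pconf tpermR; have := occ01 x eta; have := occ01 (w r) eta.
  by rewrite ler_norml; lra.
by rewrite occ_pconf tpermD ?subrr // ?xw // (inj_eq winj) eq_sym.
Qed.

Lemma bavg_exp_exchange eta x r i : injective w -> (forall r, x != w r) ->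
  `|bavg (pconf (tperm x (w r)) eta) ^+ i - bavg eta ^+ i| <= i%:R / l%:R.
Proof.
move=> winj xw; set a := bavg _; set b := bavg _.
have ab : `|a - b| <= l%:R^-1 by exact: bavg_exchange.
have /andP[a0 a1] : 0 <= a <= 1 := bavg01 _.
have /andP[b0 b1] : 0 <= b <= 1 := bavg01 _.
clearbody a b.
elim: i => [|i IH]; first by rewrite !expr0 subrr normr0 mul0r.
have -> : a ^+ i.+1 - b ^+ i.+1 = (a - b) * a ^+ i + b * (a ^+ i - b ^+ i).
  by rewrite !exprS; ring.
rewrite (le_trans (ler_normD _ _)) // !normrM -natr1 mulrDl mul1r addrC lerD //.
  by apply: le_trans IH; rewrite ler_piMl // ger0_norm.
by apply: le_trans ab; rewrite ler_piMr // normrX exprn_ile1 // ger0_norm.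
Qed.

(** The factors [occ z] are replaced one at a time by the block average: averaging
    [occ z - occ (w r)] over [r] trades one factor for one more power of [bavg]. The exponent [i]
    makes the induction go through. The exchange of [z] with [w r] leaves the remaining factors
    alone, since their sites differ from [z] and avoid the block, and moves the power of [bavg] by
    at most [i / l]. *)
Lemma monomial_bound m (zs : seq T) i :
  injective w -> uniq zs -> (forall z r, z \in zs -> z != w r) ->
  (forall eta, 0 <= m eta) -> \sum_eta m eta = 1 ->
  `|\sum_eta m eta * ((\prod_(z <- zs) occ z eta) * bavg eta ^+ i
                      - bavg eta ^+ (i + size zs))|
    <= \sum_(z <- zs) (\sum_r xdist m z (w r)) / l%:R
       + (size zs * (i + size zs))%:R / l%:R.
Proof.
move=> winj + + m0 m1.
elim: zs i => [|z zs IH] i /=.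
  move=> _ _; rewrite big1 ?normr0 ?big_nil ?add0r ?mul0r // => eta _.
  by rewrite big_nil mul1r addn0 subrr mulr0.
case/andP => zzs uzs zw.
have zw' r : z != w r by apply: zw; rewrite inE eqxx.
set Q := fun eta => (\prod_(z <- zs) occ z eta) * bavg eta ^+ i.
have l0' : 0 < l%:R :> R by rewrite ltr0n.
have E : \sum_eta m eta * (\prod_(z <- z :: zs) occ z eta * bavg eta ^+ i
         - bavg eta ^+ (i + (size zs).+1)) =
   (\sum_r \sum_eta m eta * ((occ z eta - occ (w r) eta) * Q eta)) / l%:R
   + \sum_eta m eta * ((\prod_(z <- zs) occ z eta) * bavg eta ^+ i.+1
                      - bavg eta ^+ (i.+1 + size zs)).
  rewrite exchange_big mulr_suml -big_split /=; apply: eq_bigr => eta _.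
  rewrite -mulr_sumr -mulr_suml sumrB sumr_const card_ord -(mulr_natr (occ z eta)).
  have -> : (\sum_i0 occ (w i0) eta) = bavg eta * l%:R.
    by rewrite /bavg divfK ?gt_eqF.
  rewrite -addSnnS big_cons exprS /Q; field; by rewrite gt_eqF.
rewrite E (le_trans (ler_normD _ _)) // big_cons.
have {}zw y r : y \in zs -> y != w r by move=> yzs; apply: zw; rewrite inE yzs orbT.
have H2 := IH i.+1 uzs zw.
rewrite addSnnS in H2.
rewrite mulSn natrD [X in _ + X / _]addrC mulrDl.
have H1 : `|(\sum_r \sum_eta m eta * ((occ z eta - occ (w r) eta) * Q eta)) / l%:R|
   <= (\sum_r xdist m z (w r)) / l%:R + (i + (size zs).+1)%:R / l%:R.
  rewrite normrM [`|_^-1|]ger0_norm ?invr_ge0 ?ler0n // -mulrDl.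
  rewrite ler_pM2r ?invr_gt0 // (le_trans (ler_norm_sum _ _ _)) //.
  have -> : (i + (size zs).+1)%:R = \sum_(r < l) ((i + (size zs).+1)%:R / l%:R) :> R.
    by rewrite sumr_const card_ord -[RHS]mulr_natr divfK ?gt_eqF.
  rewrite -big_split /=; apply: ler_sum => r _.
  (* The cost [i / l] of this replacement is relaxed to one that stays the same along the induction,
     so that the total is a plain product. *)
  apply: (@le_trans _ _ (xdist m z (w r) + i%:R / l%:R)); last first.
    by rewrite lerD2l ler_pM2r ?invr_gt0 // ler_nat leq_addr.
  apply: exchange_bound => // eta; rewrite /Q.
    rewrite normrM mulr_ile1 ?normr_ge0 //.
      by rewrite normr_prod; apply: prodr_ile1 => y _; rewrite normr_ge0 /= ger0_norm;
       case/andP: (occ01 y eta).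
    by rewrite normrX exprn_ile1 // ger0_norm; case/andP: (bavg01 eta).
  have -> : \prod_(z0 <- zs) occ z0 (pconf (tperm z (w r)) eta) = \prod_(z0 <- zs) occ z0 eta.
    apply: eq_big_seq => y yzs; rewrite occ_pconf tpermD //.
      by apply: contraNneq zzs => ->.
    by rewrite eq_sym zw.
  rewrite -mulrBr normrM (le_trans _ (bavg_exp_exchange eta r i winj zw')) //.
  rewrite ler_piMl // normr_prod.
  by apply: prodr_ile1 => y _; rewrite normr_ge0 /= ger0_norm; case/andP: (occ01 y eta).
rewrite [in X in _ + X]addSnnS; move: H1 H2; lra.
Qed.

End Exchange.

(** The Taylor remainder r_k of the k-th power satisfies r_(k+1) = y r_k + k u^(k-1) (y - u)^2, and
    k^2 + k <= (k + 1)^2. The case k = 0, where the predecessor is truncated, is harmless because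
    the linear term has coefficient 0. *)
Lemma power_expansion (R : realType) (k : nat) (y u : R) :
  0 <= y <= 1 -> 0 <= u <= 1 ->
  `|y ^+ k - u ^+ k - k%:R * u ^+ k.-1 * (y - u)| <= k%:R ^+ 2 * (y - u) ^+ 2.
Proof.
move=> /andP[y0 y1] /andP[u0 u1].
case: k => [|k]; first by rewrite !expr0 !mul0r !subrr normr0 expr0n mul0r.
elim: k => [|k IH].
  by rewrite /= !expr1 expr0 !mul1r subrr normr0 expr1n mul1r sqr_ge0.
have -> : y ^+ k.+2 - u ^+ k.+2 - k.+2%:R * u ^+ k.+2.-1 * (y - u) =
  y * (y ^+ k.+1 - u ^+ k.+1 - k.+1%:R * u ^+ k.+1.-1 * (y - u))
  + k.+1%:R * u ^+ k * (y - u) ^+ 2.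
  by rewrite /= !exprS -[in LHS]natr1; ring.
rewrite (le_trans (ler_normD _ _)) //.
have H1 : `|y * (y ^+ k.+1 - u ^+ k.+1 - k.+1%:R * u ^+ k.+1.-1 * (y - u))|
  <= k.+1%:R ^+ 2 * (y - u) ^+ 2.
  by rewrite normrM (le_trans _ IH) // ler_piMl // ger0_norm.
have H2 : `|k.+1%:R * u ^+ k * (y - u) ^+ 2| <= k.+1%:R * (y - u) ^+ 2.
  rewrite normrM [X in _ * X]ger0_norm ?sqr_ge0 // ler_wpM2r ?sqr_ge0 // normrM.
  by rewrite normr_nat ler_piMr // normrX exprn_ile1 // ger0_norm.
have H3 : 0 <= (y - u) ^+ 2 by exact: sqr_ge0.
rewrite (le_trans (lerD H1 H2)) // -mulrDl ler_wpM2r //.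
rewrite -[in X in _ <= X]natr1; have : 0 <= k.+1%:R :> R by []. nra.
Qed.

(** * Entropy inequality and product measures *)

(** From 1 - x <= exp(-x) follows exp(x) <= 1 / (1 - x), and (1 + x + 2 x^2) (1 - x) = 1 + x^2 (1 -
    2 x). *)
Lemma expR_sub1 (R : realType) (x : R) : x <= 2^-1 -> expR x <= 1 + x + 2 * x ^+ 2.
Proof.
move=> xh; have x1 : 0 < 1 - x by lra.
have H : 1 - x <= expR (- x) by exact: expR_ge1Dx.
have e0 := expR_gt0 x.
have : expR x * (1 - x) <= 1.
  by rewrite (le_trans (ler_wpM2l (ltW e0) H)) // -expRD subrr expR0.
rewrite -ler_pdivlMr // => /le_trans; apply.
rewrite ler_pdivrMr //; have := sqr_ge0 x; nra.
Qed.

(** The Gibbs variational inequality, obtained termwise from 1 + z <= exp(z) at z = F - ln(m / nu) -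
    c. Where [m] vanishes the convention 0 ln 0 = 0 is automatic. *)
Lemma entropy_inequality (R : realType) (S : finType) (m nu F : S -> R) (c : R) :
  (forall i, 0 <= m i) -> \sum_i m i = 1 -> (forall i, 0 < nu i) ->
  \sum_i nu i * expR (F i) <= expR c ->
  \sum_i m i * F i <= \sum_i m i * ln (m i / nu i) + c.
Proof.
move=> m0 m1 nu0 Hc; rewrite -subr_le0.
have -> : \sum_i m i * F i - (\sum_i m i * ln (m i / nu i) + c) =
   \sum_i (m i * (F i - ln (m i / nu i) - c)).
  rewrite -[c in LHS]mul1r -m1 mulr_suml opprD addrA -!sumrB.
  by apply: eq_bigr => i _; ring.
apply: (@le_trans _ _ (\sum_i (nu i * expR (F i) * expR (- c) - m i))).
  apply: ler_sum => i _; have [mi0|mi] := eqVneq (m i) 0.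
    rewrite mi0 mul0r subr0 !mulr_ge0 ?expR_ge0 //; exact: ltW.
  have mp : 0 < m i by rewrite lt_neqAle eq_sym mi m0.
  have := expR_ge1Dx (F i - ln (m i / nu i) - c).
  rewrite !expRD expRN lnK ?posrE ?divr_gt0 // invf_div.
  move=> /(ler_wpM2l (m0 i)); rewrite mulrDr mulr1 -lerBrDl => /le_trans; apply.
  by rewrite le_eqVlt; apply/orP; left; apply/eqP; field; rewrite gt_eqF.
rewrite sumrB m1 -mulr_suml subr_le0.
by rewrite (le_trans (ler_wpM2r (expR_ge0 _) Hc)) // -expRD subrr expR0.
Qed.

(* The centred variable has mean 0, so the exponent grows by a relative 16 al only; with
   al = 1/(64 l) the growth stays bounded along l steps. *)
Lemma exp_square_step (R : realType) (L v S al : R) :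
  0 <= v <= 1 -> 1 <= L -> 0 <= al -> al * (32 * L) <= 1 -> `|S| <= L ->
  v * expR (al * (S + (1 - v)) ^+ 2) + (1 - v) * expR (al * (S + (0 - v)) ^+ 2)
  <= expR (2 * al + (al + 16 * al ^+ 2) * S ^+ 2).
Proof.
move=> /andP[v0 v1] L1 al0 alL; rewrite ler_norml => /andP[S1 S2].
have alS : al * S <= 32^-1 by nra.
have alS' : - 32^-1 <= al * S by nra.
have al32 : al <= 32^-1 by nra.
have H xi : -1 <= xi -> xi <= 1 ->
   expR (al * (S + xi) ^+ 2) <= expR (al * S ^+ 2) *
     (1 + al * (2 * S * xi + xi ^+ 2) + al ^+ 2 * (16 * S ^+ 2 + 4)).
  move=> x1 x2; have -> : al * (S + xi) ^+ 2 = al * S ^+ 2 + al * (2 * S * xi + xi ^+ 2) by ring.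
  rewrite expRD ler_wpM2l ?expR_ge0 // (le_trans (expR_sub1 _)) //; first nra.
  rewrite lerD2l; have x3 : xi ^+ 2 <= 1 by nra.
  have x3' : 0 <= xi ^+ 2 by exact: sqr_ge0.
  rewrite exprMn mulrCA; apply: ler_wpM2l; first exact: sqr_ge0.
  have : 0 <= (2 * S * xi - xi ^+ 2) ^+ 2 by exact: sqr_ge0.
  have : (S * xi) ^+ 2 <= S ^+ 2 by rewrite exprMn ler_piMr ?sqr_ge0.
  have : (xi ^+ 2) ^+ 2 <= 1 by rewrite exprn_ile1.
  nra.
have /H {}H1 : -1 <= 1 - v by lra.
have /H {}H2 : -1 <= 0 - v by lra.
have {}H1 := H1 ltac:(lra). have {}H2 := H2 ltac:(lra).
have v1' : 0 <= 1 - v by lra.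
have := lerD (ler_wpM2l v0 H1) (ler_wpM2l v1' H2) => /le_trans; apply.
have -> : 2 * al + (al + 16 * al ^+ 2) * S ^+ 2 =
  al * S ^+ 2 + (2 * al + 16 * al ^+ 2 * S ^+ 2) by ring.
rewrite expRD; set E := expR (al * S ^+ 2); have E0 : 0 <= E by exact: expR_ge0.
clearbody E.
apply: (@le_trans _ _ (E * (1 + (2 * al + 16 * al ^+ 2 * S ^+ 2)))); last first.
  by rewrite ler_wpM2l // expR_ge1Dx.
have -> : v * (E * (1 + al * (2 * S * (1 - v) + (1 - v) ^+ 2) + al ^+ 2 * (16 * S ^+ 2 + 4))) +
  (1 - v) * (E * (1 + al * (2 * S * (0 - v) + (0 - v) ^+ 2) + al ^+ 2 * (16 * S ^+ 2 + 4)))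
  = E * (1 + al * (v * (1 - v)) + al ^+ 2 * (16 * S ^+ 2 + 4)) by ring.
apply: ler_wpM2l => //; have : v * (1 - v) <= 1 by nra.
nra.
Qed.

Section ProductMeasure.
Variables (R : realType) (d N : nat) (v : site d N -> R).
Hypothesis v01 : forall x, 0 < v x < 1.
Local Notation cf := (conf d N).
Implicit Types (eta : cf) (F : cf -> R).

Definition set_occ eta y b : cf := [ffun z => if z == y then b else eta z].

Definition site_mean y F eta : R := v y * F (set_occ eta y true) + (1 - v y) * F (set_occ eta y false).

Fixpoint sites_mean (s : seq (site d N)) F : cf -> R :=
  if s is y :: s' then site_mean y (sites_mean s' F) else F.

Lemma nuprod_gt0 eta : 0 < nuprod v eta.
Proof.
apply: prodr_gt0 => x _; have /andP[? ?] := v01 x.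
by case: ifP => // _; rewrite subr_gt0.
Qed.

(** [site_mean y F] is the conditional expectation of [F] given the coordinates off [y]. The sum is
    arranged in pairs made of a configuration occupied at [y] and its flip there; their weights are
    v y and 1 - v y times a common factor. *)
Lemma nuprod_site_mean y F : \sum_eta nuprod v eta * site_mean y F eta = \sum_eta nuprod v eta * F eta.
Proof.
have fK : involutive (fun eta : cf => tflip eta y).
  move=> eta; apply/ffunP => z; rewrite !ffunE.
  by case: (z == y) => //; rewrite negbK.
have E (f : cf -> R) : \sum_eta f eta = \sum_(eta : cf | eta y) (f eta + f (tflip eta y)).
  rewrite big_split /= (bigID (fun eta : cf => eta y)) /=; congr (_ + _).
  rewrite (reindex_inj (inv_inj fK)) /=; apply: eq_bigl => eta.
  by rewrite ffunE eqxx negbK.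
rewrite E [RHS]E; apply: eq_bigr => eta ey.
pose r := \prod_(x | x != y) (if eta x then v x else 1 - v x).
have -> : nuprod v eta = v y * r by rewrite /nuprod (bigD1 y) //= ey.
have -> : nuprod v (tflip eta y) = (1 - v y) * r.
  rewrite /nuprod (bigD1 y) //= ffunE eqxx ey /=; congr (_ * _).
  by apply: eq_bigr => x xy; rewrite ffunE (negbTE xy).
rewrite /site_mean.
have u1 : set_occ eta y true = eta.
  by apply/ffunP => z; rewrite ffunE; case: eqP => // ->.
have u2 : set_occ eta y false = tflip eta y.
  by apply/ffunP => z; rewrite !ffunE; case: eqP => // ->; rewrite ey.
have u3 b : set_occ (tflip eta y) y b = set_occ eta y b.
  by apply/ffunP => z; rewrite !ffunE; case: eqP.
by rewrite !u3 u1 u2; ring.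
Qed.

Lemma nuprod_sites_mean s F : \sum_eta nuprod v eta * sites_mean s F eta = \sum_eta nuprod v eta * F eta.
Proof. by elim: s => //= y s IH; rewrite nuprod_site_mean. Qed.

Lemma nuprod_sum1 : \sum_eta nuprod v eta = 1.
Proof.
rewrite /nuprod.
rewrite -(bigA_distr_bigA (fun x (b : bool) => if b then v x else 1 - v x)) /=.
by rewrite big1 // => x _; rewrite big_bool /= addrCA subrr addr0.
Qed.

(** A Gaussian-type bound for a sum of centred Bernoulli variables, integrated one variable at a
    time. [S0] holds the variables still to be integrated and [g] the factors that do not see [s].
    After j integrations the coefficient of the square is (1 + j / l) / (64 l), which never exceeds
    1 / (32 l) because j <= l; each step also adds at most 1 / (16 l) to the exponent. *)
Lemma sites_mean_exp_bound (l : nat) (s : seq (site d N)) (g S0 : cf -> R) eta :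
  (0 < l)%N -> uniq s -> (forall eta, 0 <= g eta) ->
  (forall eta y b, y \in s -> g (set_occ eta y b) = g eta) ->
  (forall eta y b, y \in s -> S0 (set_occ eta y b) = S0 eta) ->
  (forall eta, `|S0 eta| + (size s)%:R <= l%:R) ->
  sites_mean s (fun eta => g eta * expR ((64 * l%:R)^-1 *
          (S0 eta + \sum_(y <- s) (occ R y eta - v y)) ^+ 2)) eta
  <= g eta * expR ((size s)%:R / (16 * l%:R)
                   + (64 * l%:R)^-1 * (1 + (size s)%:R / l%:R) * S0 eta ^+ 2).
Proof.
move=> l0; have L1 : 1 <= l%:R :> R by rewrite ler1n.
have L0 : 0 < l%:R :> R by rewrite ltr0n.
elim: s g S0 eta => [|y s IH] g S0 eta /= us g0 gi Si Sb.
  by rewrite big_nil !mul0r !addr0 mulr1 add0r.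
case/andP: us => ys us.
have /andP[vy0 vy1] := v01 y.
pose S1 eta := S0 eta + (occ R y eta - v y).
have IHs eta' := IH g S1 eta' us g0.
have {}IHs eta' : sites_mean s (fun eta => g eta * expR ((64 * l%:R)^-1 *
   (S0 eta + \sum_(y <- y :: s) (occ R y eta - v y)) ^+ 2)) eta' <=
   g eta' * expR ((size s)%:R / (16 * l%:R)
                   + (64 * l%:R)^-1 * (1 + (size s)%:R / l%:R) * S1 eta' ^+ 2).
  under [X in sites_mean s X]boolp.funext do rewrite big_cons addrA.
  apply: IHs.
  - by move=> e z b zs; apply: gi; rewrite inE zs orbT.
  - move=> e z b zs; rewrite /S1 Si ?inE ?zs ?orbT // /occ ffunE ifN_eq //.
    by apply: contraNneq ys => ->.
  - move=> e; have := Sb e; rewrite -natr1 => H.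
    rewrite (le_trans _ H) // addrA [leRHS]addrAC lerD2r.
    rewrite (le_trans (ler_normD _ _)) // lerD2l.
    by have := occ01 R y e; rewrite ler_norml; lra.
have g1 b : g (set_occ eta y b) = g eta by apply: gi; rewrite inE eqxx.
have Sy b : S1 (set_occ eta y b) = S0 eta + (b%:R - v y).
  by rewrite /S1 Si ?inE ?eqxx // /occ ffunE eqxx.
rewrite /site_mean; set n : R := (size s)%:R.
have vy1' : 0 <= 1 - v y by lra.
have := lerD (ler_wpM2l (ltW vy0) (IHs (set_occ eta y true)))
             (ler_wpM2l vy1' (IHs (set_occ eta y false))).
move=> /le_trans; apply; rewrite !g1 !Sy.
set be := n / (16 * l%:R); set al := (64 * l%:R)^-1 * (1 + n / l%:R).
have Sb' : `|S0 eta| + (n + 1) <= l%:R by have := Sb eta; rewrite -natr1.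
have n0 : 0 <= n by rewrite /n ler0n.
have [x xE] : {x : R | x = l%:R^-1} by exists l%:R^-1.
have xl : x * l%:R = 1 by rewrite xE mulVf ?gt_eqF.
have x0 : 0 < x by rewrite xE invr_gt0.
have nx : n * x + x <= 1 by have := normr_ge0 (S0 eta); nra.
have nx0 : 0 <= n * x by rewrite mulr_ge0 // ltW.
have alE : al = 64^-1 * x * (1 + n * x) by rewrite /al xE invfM.
have al0 : 0 <= al by rewrite alE; nra.
have al1 : al <= 32^-1 * x by rewrite alE; nra.
(* The growth allowed by [exp_square_step] fits into the increment 1 / (64 l^2) of the coefficient
   when [size s] grows by one. *)
have al2 : 16 * al ^+ 2 <= 64^-1 * x ^+ 2 by rewrite !expr2; nra.
have al3 : al * (32 * l%:R) <= 1 by rewrite (le_trans (ler_wpM2r _ al1)) //; nra.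
have S0l : `|S0 eta| <= l%:R by lra.
have v01y : 0 <= v y <= 1 by apply/andP; split; exact: ltW.
have H := exp_square_step v01y L1 al0 al3 S0l.
rewrite mulr1n mulr0n !expRD.
have -> (a1 a2 a3 a4 : R) : v y * (a1 * (a2 * a3)) + (1 - v y) * (a1 * (a2 * a4))
  = a1 * a2 * (v y * a3 + (1 - v y) * a4) by ring.
apply: (le_trans (ler_wpM2l _ H)); first by rewrite mulr_ge0 ?expR_ge0.
rewrite -!mulrA ler_wpM2l // -!expRD ler_expR addrA lerD //.
  rewrite -natr1 -/n /be !invfM -xE; nra.
rewrite [leRHS]mulrA ler_wpM2r ?sqr_ge0 // -natr1 -/n alE invfM -xE; rewrite alE in al2; nra.
Qed.

End ProductMeasure.

(** * Static block estimate *)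

Section Blocks.
Variables (R : realType) (d N : nat) (v : site d N -> R) (e : site d N) (l : nat).
Hypothesis v01 : forall x, 0 < v x < 1.
Hypothesis l0 : (0 < l)%N.
Hypothesis einj : forall j k, (j < l)%N -> (k < l)%N -> e *+ j = e *+ k -> j = k.
Local Notation cf := (conf d N).

Definition seg (x : site d N) : seq (site d N) := [seq x + e *+ k | k <- iota 0 l].

Lemma seg_uniq x : uniq (seg x).
Proof.
rewrite map_inj_in_uniq ?iota_uniq // => j k.
rewrite !mem_iota /= !add0n => jl kl /addrI; exact: einj.
Qed.

Definition bsum (x : site d N) (eta : cf) : R := \sum_(y <- seg x) (occ R y eta - v y).

Lemma bsumE x eta : bsum x eta = \sum_(k < l) (occ R (x + e *+ k) eta - v (x + e *+ k)).
Proof. by rewrite /bsum big_map -[l]subn0 -/(index_iota 0 l) big_mkord subn0. Qed.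

(** Disjoint segments are independent under the product law: integrating out the first one leaves
    the other factors untouched. Each segment contributes [l / (16 l) = 1 / 16] to the exponent. *)
Lemma blocks_exp (xs : seq (site d N)) :
  pairwise (fun x y => ~~ has (mem (seg x)) (seg y)) xs ->
  \sum_eta nuprod v eta * \prod_(x <- xs) expR ((64 * l%:R)^-1 * bsum x eta ^+ 2)
  <= expR ((size xs)%:R / 16).
Proof.
elim: xs => [|x xs IH] /=.
  move=> _; rewrite mul0r expR0 le_eqVlt; apply/orP; left; apply/eqP.
  by under eq_bigr do rewrite big_nil mulr1; exact: nuprod_sum1.
case/andP => dis /IH {}IH.
pose g eta := \prod_(x <- xs) expR ((64 * l%:R)^-1 * bsum x eta ^+ 2).
rewrite -(nuprod_sites_mean v (seg x)).
apply: (@le_trans _ _ (\sum_eta nuprod v eta * (g eta * expR (1 / 16)))).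
  apply: ler_sum => eta _; rewrite ler_wpM2l ?(ltW (nuprod_gt0 v01 _)) //.
  under [X in sites_mean _ _ X]boolp.funext do rewrite big_cons mulrC -[bsum x _]add0r.
  have g0 eta' : 0 <= g eta' by apply: prodr_ge0 => z _; exact: expR_ge0.
  have gi eta' y b : y \in seg x -> g (set_occ eta' y b) = g eta'.
    move=> yx; apply: eq_big_seq => z zxs; congr (expR (_ * _ ^+ 2)).
    apply: eq_big_seq => w wz; rewrite /occ ffunE ifN //.
    apply/eqP => wy; move/allP/(_ _ zxs)/hasPn : dis => /(_ _ wz).
    by rewrite wy /= yx.
  have S0b (eta' : cf) : `|0 : R| + (size (seg x))%:R <= l%:R.
    by rewrite normr0 add0r size_map size_iota.
  have := @sites_mean_exp_bound _ _ _ v v01 l (seg x) g (fun=> 0) eta l0 (seg_uniq x) g0 gi (fun _ _ _ _ => erefl) S0b.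
  move=> /le_trans; apply; rewrite size_map size_iota expr0n mulr0 addr0.
  have l0' : l%:R != 0 :> R by rewrite pnatr_eq0 -lt0n.
  by rewrite ler_wpM2l // ler_expR invfM mulrCA divff // mulr1 mul1r.
under eq_bigr do rewrite mulrA.
rewrite -mulr_suml -[(size xs).+1%:R]natr1 mulrDl expRD.
by rewrite ler_wpM2r ?expR_ge0.
Qed.

Lemma entropy_blocks (m : cf -> R) (xs : seq (site d N)) :
  (forall eta, 0 <= m eta) -> \sum_eta m eta = 1 ->
  pairwise (fun x y => ~~ has (mem (seg x)) (seg y)) xs ->
  \sum_(x <- xs) \sum_eta m eta * ((64 * l%:R)^-1 * bsum x eta ^+ 2)
  <= rel_entropy m (nuprod v) + (size xs)%:R / 16.
Proof.
move=> m0 m1 /blocks_exp H; rewrite exchange_big /=.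
under eq_bigr do rewrite -mulr_sumr.
apply: entropy_inequality => // [eta|]; first exact: nuprod_gt0.
by under eq_bigr do rewrite expR_sum.
Qed.

(** Nonnegativity is the case of the empty family of segments. *)
Lemma entropy_ge0 (m : cf -> R) :
  (forall eta, 0 <= m eta) -> \sum_eta m eta = 1 -> 0 <= rel_entropy m (nuprod v).
Proof.
move=> m0 m1; have := @entropy_blocks m [::] m0 m1 isT.
by rewrite big_nil /= mul0r addr0.
Qed.

Lemma seg_shift x z y : (x + z \in seg (y + z)) = (x \in seg y).
Proof.
apply/mapP/mapP => -[k kl E]; exists k => //.
  by apply: (addIr z); rewrite E addrAC.
by rewrite E addrAC.
Qed.

(* A maximal family of disjoint segments has at least a fraction 1/(2l) of all sites, and
   its translates cover every segment equally often. *)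
Lemma disjoint_blocks : exists xs : seq (site d N),
  (forall z, pairwise (fun x y => ~~ has (mem (seg x)) (seg y)) [seq x + z | x <- xs])
  /\ (#|site d N| <= size xs * (2 * l))%N.
Proof.
pose Q (G : {set site d N}) :=
  [forall x in G, [forall y in G, (x != y) ==> ~~ has (mem (seg x)) (seg y)]].
have Q0 : Q finset.set0 by apply/forall_inP => x; rewrite finset.in_set0.
have [G /maxsetP [QG Gmax] _] := maxset_exists Q0.
exists (enum G); split.
  move=> z; rewrite pairwise_map.
  have : uniq (enum G) by exact: enum_uniq.
  rewrite uniq_pairwise => H.
  have {H} := H; apply: (sub_in_pairwise (P := mem G)); last by apply/allP => x; rewrite mem_enum.
  move=> x y xG yG /= xy; apply/hasPn => w /mapP [k kl ->] /=.
  rewrite addrAC seg_shift.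
  move/forall_inP/(_ _ xG)/forall_inP/(_ _ yG)/implyP/(_ xy)/hasPn : QG => /(_ (y + e *+ k)).
  by apply; apply/mapP; exists k.
(* By maximality, adding any [x] outside [G] destroys disjointness, so the segment of [x] meets the
   segment of some [y] in [G]. *)
have cov x : exists2 y, y \in G & exists j k, [/\ (j < l)%N, (k < l)%N & x + e *+ j = y + e *+ k].
  have [xG|xG] := boolP (x \in G); first by exists x => //; exists 0%N, 0%N.
  have : ~~ Q (x |: G).
    apply/negP => QxG; have E := Gmax _ QxG (finset.subsetU1 _ _).
    by rewrite -E finset.setU11 in xG.
  have bad y z : y != z -> has (mem (seg y)) (seg z) -> exists j k, [/\ (j < l)%N, (k < l)%N & y + e *+ j = z + e *+ k].
    move=> _ /hasP [w /mapP [k + wk] /mapP [j + wj]].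
    by rewrite !mem_iota => kl jl; exists j, k; rewrite -wj -wk.
  rewrite /Q => /forall_inPn [y yxG] /forall_inPn [z zxG].
  rewrite negb_imply negbK => /andP [yz /(bad _ _ yz) [j [k [jl kl E]]]].
  move: yxG zxG; rewrite !inE => /orP [/eqP yx|yG] /orP [/eqP zx|zG].
  - by rewrite yx zx eqxx in yz.
  - by subst y; exists z => //; exists j, k.
  - by subst z; exists y => //; exists k, j.
  - move: QG => /forall_inP/(_ _ yG)/forall_inP/(_ _ zG)/implyP/(_ yz)/hasPn H.
    have := H (z + e *+ k); rewrite /= -E => {}H.
    have : y + e *+ j \notin seg y.
      by apply: H; rewrite E; apply/mapP; exists k => //; rewrite mem_iota.
    by case/mapP; exists j => //; rewrite mem_iota.
(* By [cov], x = y + (k - j) e with k - j strictly between -l and l; adding l turns the offset into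
   an index below 2 l. *)
pose f (p : site d N * 'I_(2 * l)) := p.1 + e *+ p.2 - e *+ l.
have : finset.setT \subset f @: finset.setX G finset.setT.
  apply/fintype.subsetP => x _; have [y yG [j [k [jl kl E]]]] := cov x.
  have lt : (k + (l - j) < 2 * l)%N by lia.
  apply/imsetP; exists (y, Ordinal lt); first by rewrite !inE yG.
  rewrite /f /= mulrnDr addrA -E mulrnBr; last exact: ltnW.
  by rewrite -[x + _ + _]addrA [e *+ j + _]addrC subrK addrK.
move/subset_leq_card; rewrite finset.cardsT => /leq_trans; apply.
rewrite (leq_trans (leq_imset_card _ _)) // finset.cardsX finset.cardsT card_ord.
by rewrite -cardE.
Qed.

(** [entropy_blocks] sees only one disjoint family, so it is averaged over all translates of that
    family. With s segments this costs a factor n / s <= 2 l on the entropy, whence 128 = 64 * 2,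
    while the error per segment gives 4 = 64 / 16. *)
Lemma static_estimate (m : cf -> R) :
  (forall eta, 0 <= m eta) -> \sum_eta m eta = 1 ->
  \sum_x \sum_eta m eta * (bsum x eta / l%:R) ^+ 2
  <= 128 * rel_entropy m (nuprod v) + 4 * #|site d N|%:R / l%:R.
Proof.
move=> m0 m1; have [xs [dis card]] := disjoint_blocks.
have L0 : 0 < l%:R :> R by rewrite ltr0n.
set H := rel_entropy _ _; set n : R := #|_|%:R.
have n0 : 0 < n by rewrite ltr0n; apply/card_gt0P; exists 0.
have szE : 0 < (size xs)%:R :> R.
  rewrite ltr0n lt0n; apply: contraTneq card => ->.
  by rewrite mul0n -ltnNge -(ltr0n R).
have {}card : n <= (size xs)%:R * (2 * l%:R) by rewrite -!natrM ler_nat.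
have H0 : 0 <= H by exact: entropy_ge0.
pose D := \sum_x \sum_eta m eta * bsum x eta ^+ 2.
have D0 : 0 <= D.
  by apply: sumr_ge0 => x _; apply: sumr_ge0 => eta _; rewrite mulr_ge0 ?sqr_ge0.
(* Summed over the translations [z], each member of the family runs through every site exactly
   once. *)
have main : (size xs)%:R * ((64 * l%:R)^-1 * D) <= n * (H + (size xs)%:R / 16).
  have -> : n * (H + (size xs)%:R / 16) = \sum_(z : site d N) (H + (size xs)%:R / 16).
    by rewrite sumr_const -[RHS]mulr_natl; reflexivity.
  have -> : (size xs)%:R * ((64 * l%:R)^-1 * D) =
     \sum_(z : site d N) \sum_(x <- [seq x + z | x <- xs])
         \sum_eta m eta * ((64 * l%:R)^-1 * bsum x eta ^+ 2).
    under eq_bigr do rewrite big_map.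
    rewrite exchange_big /= -sum1_size natr_sum mulr_suml.
    apply: eq_bigr => x _; rewrite mul1r [RHS](reindex_inj (addrI (- x))) /=.
    rewrite mulr_sumr; apply: eq_bigr => z _; rewrite mulr_sumr.
    by apply: eq_bigr => eta _; rewrite addrA subrr add0r mulrCA.
  apply: ler_sum => z _; rewrite (le_trans (entropy_blocks m0 m1 (dis z))) //.
  by rewrite size_map.
have -> : \sum_x \sum_eta m eta * (bsum x eta / l%:R) ^+ 2 = D / l%:R ^+ 2.
  rewrite mulr_suml; apply: eq_bigr => x _; rewrite mulr_suml; apply: eq_bigr => eta _.
  by rewrite expr_div_n mulrA.
set s : R := (size xs)%:R in szE card main *; set L : R := l%:R in L0 card main *.
clearbody s L D n H.
rewrite ler_pdivrMr ?exprn_gt0 //.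
have {main} : s * D <= 64 * L * (n * (H + s / 16)).
  rewrite -ler_pdivrMl ?mulr_gt0 //; apply: le_trans main; by rewrite mulrCA.
move=> main; rewrite -(ler_pM2l szE) (le_trans main) //.
have -> : s * ((128 * H + 4 * n / L) * L ^+ 2) = 64 * L * (s * (2 * L) * H + n * (s / 16)).
  by field; rewrite gt_eqF.
by rewrite ler_wpM2l ?mulr_ge0 ?(ltW L0) // mulrDr lerD2r ler_wpM2r.
Qed.

End Blocks.

(** * Local functions and entropy production *)

Section LocalFunctions.
Variables (R : realType) (d : nat).

Lemma zset_id (xi : zconf d) z w : zset xi z (xi z) w = xi w.
Proof. by rewrite /zset; case: eqP => // ->. Qed.

Lemma depends_on_zset (g : zconf d -> R) z L b :
  depends_on (z :: L) g -> depends_on L (fun xi => g (zset xi z b)).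
Proof.
move=> gL xi ze H; apply: gL => w; rewrite inE /zset; case: eqP => //= _; exact: H.
Qed.

(** Induction on the support: fixing one coordinate leaves two local functions on the rest. Finitely
    many values give an upper bound and, for positive rates, a positive lower bound. *)
Lemma local_finite_range (L : seq (zsite d)) (g : zconf d -> R) :
  depends_on L g -> exists s : seq R, forall xi, g xi \in s.
Proof.
elim: L g => [|z L IH] g gL.
  by exists [:: g (fun=> false)] => xi; rewrite inE; apply/eqP/gL.
have [s0 H0] := IH _ (depends_on_zset false gL).
have [s1 H1] := IH _ (depends_on_zset true gL).
exists (s0 ++ s1) => xi; rewrite mem_cat.
rewrite (gL xi (zset xi z (xi z))) => [|w _]; last by rewrite zset_id.
by case: (xi z); rewrite ?H0 ?H1 ?orbT.
Qed.

Lemma local_bounded (L : seq (zsite d)) (g : zconf d -> R) :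
  depends_on L g -> exists2 B, 0 < B & forall xi, `|g xi| <= B.
Proof.
move=> /local_finite_range [s Hs].
suff [B B0 H] : exists2 B : R, 0 < B & forall x, x \in s -> `|x| <= B by exists B => // xi; exact: H.
elim: s {Hs} => [|x s [B B0 IH]]; first by exists 1.
exists (B + `|x|); first by rewrite ltr_pwDl.
move=> y; rewrite inE => /orP [/eqP ->|/IH H]; first by rewrite lerDr ltW.
by rewrite (le_trans H) // lerDl.
Qed.

Lemma local_gt0 (L : seq (zsite d)) (g : zconf d -> R) :
  depends_on L g -> (forall xi, 0 < g xi) -> exists2 B, 0 < B & forall xi, B <= g xi.
Proof.
move=> /local_finite_range [s Hs] g0.
suff [B B0 H] : exists2 B : R, 0 < B & forall x, x \in s -> 0 < x -> B <= x by exists B => // xi; exact: H.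
elim: s {Hs} => [|x s [B B0 IH]]; first by exists 1.
have [x0|x0] := ltP 0 x.
  exists (Num.min B x); first by rewrite lt_min B0.
  move=> y; rewrite inE => /orP [/eqP ->|/IH H] y0; first by rewrite ge_min lexx orbT.
  by rewrite ge_min H.
exists B => // y; rewrite inE => /orP [/eqP ->|/IH H] //.
by move=> /(le_lt_trans x0); rewrite ltxx.
Qed.

End LocalFunctions.

(** * Exchange distances on the torus and entropy production *)

Definition tproj d N (z : zsite d) : site d N := [ffun i => (z i)%:~R].
Arguments tproj {d} N z.

Section Torus.
Variables (R : realType) (d N : nat).
Local Notation cf := (conf d N).
Implicit Types (m : cf -> R) (eta : cf) (x y v w : site d N).

Lemma tswapE eta x y : tswap eta x y = pconf (tperm x y) eta.
Proof.
apply/ffunP => z; rewrite !ffunE.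
by case: tpermP => [->|->|/eqP/negbTE -> /eqP/negbTE ->//]; rewrite eqxx //; case: eqP => [->|].
Qed.

Definition xsum m v : R := \sum_x xdist m x (x + v).
Definition xtot m : R := \sum_(i < d) xsum m (tunit N i).

Lemma xsum_ge0 m v : 0 <= xsum m v.
Proof. by apply: sumr_ge0 => x _; exact: xdist_ge0. Qed.

Lemma xsum_shift m (z w : site d N) : \sum_(x : site d N) xdist m (x + z) (x + w) = xsum m (w - z).
Proof.
rewrite /xsum [RHS](reindex_inj (addIr z)) /=; apply: eq_bigr => x _.
by rewrite addrACA subrr addr0.
Qed.

Lemma xsumN m v : xsum m (- v) = xsum m v.
Proof.
rewrite /xsum (reindex_inj (addIr v)) /=; apply: eq_bigr => x _.
by rewrite addrK xdistC.
Qed.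

Lemma xsumD m v w : xsum m (v + w) <= 2 * xsum m v + xsum m w.
Proof.
have -> : xsum m w = \sum_(x : site d N) xdist m (x + v) (x + (v + w)).
  by rewrite xsum_shift addrAC subrr add0r.
rewrite /xsum mulr_sumr -big_split /=; apply: ler_sum => x _.
exact: xdist_triangle.
Qed.

Lemma xsum0 m : xsum m 0 = 0.
Proof. by rewrite /xsum big1 // => x _; rewrite addr0 xdistxx. Qed.

(** The cost is linear in [n] because the factor 2 of [xsumD] falls on its first summand, where the
    single step is put; in the other order the bound would double at each step. *)
Lemma xsumMn m v n : xsum m (v *+ n) <= 2 * n%:R * xsum m v.
Proof.
elim: n => [|n IH]; first by rewrite mulr0n xsum0 mulr0 mul0r.
rewrite mulrS (le_trans (xsumD _ _ _)) // -natr1; move: IH; lra.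
Qed.

Lemma xsumMz m v (z : int) : xsum m (v *~ z) <= 2 * `|z|%N%:R * xsum m v.
Proof.
case: z => n; first by rewrite -pmulrn; exact: xsumMn.
by rewrite NegzE mulrNz xsumN -pmulrn abszN; exact: xsumMn.
Qed.

Definition znorm (z : zsite d) : nat := (\sum_i `|z i|)%N.

Lemma ffunMzE (v : site d N) (z : int) j : (v *~ z) j = v j *~ z.
Proof. by case: z => n; rewrite ?NegzE -?pmulrn ?mulrNz ?ffunE ?ffunMnE. Qed.

Lemma tprojE (z : zsite d) : tproj N z = \sum_i tunit N i *~ (z i).
Proof.
apply/ffunP => j; rewrite ffunE sum_ffunE (bigD1 j) //= big1 => [|i ij].
  by rewrite addr0 ffunMzE ffunE eqxx.
by rewrite ffunMzE ffunE eq_sym (negbTE ij) mul0rz.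
Qed.

Lemma xsum_sum m (I : Type) (r : seq I) (F : I -> site d N) :
  xsum m (\sum_(i <- r) F i) <= \sum_(i <- r) 2 * xsum m (F i).
Proof.
elim: r => [|i r IH]; first by rewrite !big_nil xsum0.
by rewrite !big_cons (le_trans (xsumD _ _ _)) // lerD2l.
Qed.

Lemma xsum_tproj m (z : zsite d) : xsum m (tproj N z) <= 4 * (znorm z)%:R * xtot m.
Proof.
rewrite tprojE (le_trans (xsum_sum _ _ _)) // /xtot /znorm natr_sum [4 * _]mulr_sumr.
rewrite mulr_suml; apply: ler_sum => i _.
apply: (@le_trans _ _ (4 * `|z i|%N%:R * xsum m (tunit N i))).
  by have := xsumMz m (tunit N i) (z i); lra.
rewrite ler_wpM2l ?mulr_ge0 //.
by rewrite (bigD1 i) //= lerDl; apply: sumr_ge0 => j _; exact: xsum_ge0.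
Qed.

(** For a >= b, ln(a / b) >= 1 - b / a makes the logarithmic form at least (a - b)^2 / a, and
    completing the square gives the trade-off in [lam]. The last term is linear in [a + b], so that
    it sums to 1 / lam under a probability law. *)
Lemma log_exchange (lam a b : R) : 0 < lam -> 0 < a -> 0 < b ->
  `|a - b| <= lam / 2 * ((a - b) * (ln a - ln b)) + (a + b) / (2 * lam).
Proof.
wlog ba : a b / b <= a.
  move=> H lam0 a0 b0; have [/H|/ltW /H] := leP b a; first exact.
  move=> /(_ lam0 b0 a0); rewrite distrC [b + a]addrC.
  by rewrite -[(b - a) * _]mulrNN !opprB.
move=> lam0 a0 b0; rewrite ger0_norm ?subr_ge0 //.
have H : 1 - b / a <= ln a - ln b.
  have := expR_ge1Dx (ln b - ln a); rewrite expRD expRN !lnK ?posrE //.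
  lra.
have H2 : (a - b) * (1 - b / a) <= (a - b) * (ln a - ln b).
  by rewrite ler_wpM2l // subr_ge0.
apply: (@le_trans _ _ (lam / 2 * ((a - b) * (1 - b / a)) + (a + b) / (2 * lam))).
  have E : lam / 2 * ((a - b) * (1 - b / a)) + (a + b) / (2 * lam) - (a - b)
    = ((lam * (a - b) - a) ^+ 2 + a * b) / (2 * lam * a).
    by field; rewrite !gt_eqF.
  rewrite -subr_ge0 E divr_ge0 ?addr_ge0 ?sqr_ge0 ?mulr_ge0 ?ltW //.
by rewrite lerD2r ler_wpM2l // divr_ge0 // ltW.
Qed.

(* The minimal exchange rate plus [log_exchange] with parameter N bounds the Dirichlet form
   of ln m from below; the flips contribute at most K Cf per site. *)
Lemma entropy_production (K cmin Cf : R) (c : 'I_d -> zconf d -> R) (cg : zconf d -> R) m :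
  (0 < N)%N -> 0 <= K -> 0 < cmin ->
  (forall i x eta, tloc (c i) x (tswap eta x (x + tunit N i)) = tloc (c i) x eta) ->
  (forall i xi, cmin <= c i xi) -> (forall xi, 0 <= cg xi <= Cf) ->
  (forall eta, 0 < m eta) -> \sum_eta m eta = 1 ->
  N%:R * cmin * xtot m <= - (\sum_eta m eta * LN K c cg (fun e => ln (m e)) eta)
     + (K * Cf + cmin * d%:R) * #|site d N|%:R.
Proof.
move=> N0 K0 cm0 cinv cmin_le cgb m0 m1.
have N0' : 0 < N%:R :> R by rewrite ltr0n.
pose D := \sum_(x : site d N) \sum_(i < d) \sum_eta
   (m eta - m (tswap eta x (x + tunit N i))) * (ln (m eta) - ln (m (tswap eta x (x + tunit N i)))).
have D1 : xtot m <= N%:R / 2 * D + d%:R * #|site d N|%:R / N%:R.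
  rewrite /xtot /xsum exchange_big /=.
  have -> : d%:R * #|site d N|%:R / N%:R = \sum_(x : site d N) \sum_(i < d) N%:R^-1 :> R.
    rewrite sumr_const sumr_const card_ord -mulrnA -[RHS]mulr_natl natrM; reflexivity.
  rewrite /D mulr_sumr -big_split /=; apply: ler_sum => x _.
  rewrite mulr_sumr -big_split /=; apply: ler_sum => i _.
  rewrite /xdist /pdist.
  have -> : N%:R^-1 = \sum_eta (m eta + m (pconf (tperm x (x + tunit N i)) eta)) / (2 * N%:R).
    rewrite -mulr_suml big_split /= sum_pconf m1; field; by rewrite gt_eqF.
  rewrite mulr_sumr -big_split /=; apply: ler_sum => eta _.
  by rewrite tswapE; apply: log_exchange.
(* Since the rate does not change under its own exchange, averaging each sum with its exchanged copy
   turns it into minus one half of a sum of terms (p - q) (ln p - ln q) >= 0; only then can the rate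
   be replaced by its lower bound. *)
have D2 : cmin / 2 * D <= - (\sum_eta m eta * \sum_(x : site d N) \sum_(i < d)
      tloc (c i) x eta * (ln (m (tswap eta x (x + tunit N i))) - ln (m eta))).
  have -> : \sum_eta m eta * \sum_(x : site d N) \sum_(i < d)
      tloc (c i) x eta * (ln (m (tswap eta x (x + tunit N i))) - ln (m eta)) =
    \sum_(x : site d N) \sum_(i < d) \sum_eta m eta *
      (tloc (c i) x eta * (ln (m (tswap eta x (x + tunit N i))) - ln (m eta))).
    under [LHS]eq_bigr do rewrite mulr_sumr.
    rewrite exchange_big /=; apply: eq_bigr => x _.
    by under [LHS]eq_bigr do rewrite mulr_sumr; rewrite exchange_big.
  rewrite -sumrN mulr_sumr; apply: ler_sum => x _.
  rewrite -sumrN mulr_sumr; apply: ler_sum => i _.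
  set b := tperm x (x + tunit N i).
  have S : \sum_eta m eta * (tloc (c i) x eta * (ln (m (tswap eta x (x + tunit N i))) - ln (m eta)))
     = - (2^-1 * \sum_eta tloc (c i) x eta * ((m eta - m (pconf b eta)) *
          (ln (m eta) - ln (m (pconf b eta))))).
    have E1 := sum_pconf b (fun eta => m eta * (tloc (c i) x eta * (ln (m (tswap eta x (x + tunit N i))) - ln (m eta)))).
    set S0 := \sum_(_ | _) _; set S1 := \sum_(_ | _) _.
    have : S0 + S0 = - S1; last by lra.
    rewrite {1}/S0 -E1 /S0 /S1 -big_split -sumrN /=; apply: eq_bigr => eta _.
    have -> : tloc (c i) x (pconf b eta) = tloc (c i) x eta by rewrite -tswapE cinv.
    rewrite !tswapE -/b -pconfM tperm2 pconf1; ring.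
  rewrite S opprK -mulrA [leLHS]mulrCA ler_wpM2l ?invr_ge0 // mulr_sumr.
  apply: ler_sum => eta _; rewrite tswapE -/b ler_wpM2r ?cmin_le //.
  have : 0 < m (pconf b eta) by []. have : 0 < m eta by [].
  move: (m eta) (m (pconf b eta)) => p q p0 q0.
  have [pq|pq] := leP p q.
    by rewrite mulr_le0 // subr_le0 // ler_ln ?posrE.
  by rewrite mulr_ge0 // subr_ge0 ?ler_ln ?posrE // ltW.
(* Flips are not reversible for the uniform law, so they are only bounded from above: p ln(q / p) <=
   q - p <= q, and the flipped masses sum to 1. *)
have D3 : \sum_eta m eta * (\sum_(x : site d N) tloc cg x eta * (ln (m (tflip eta x)) - ln (m eta)))
   <= Cf * #|site d N|%:R.
  have -> : Cf * #|site d N|%:R = \sum_(x : site d N) Cf.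
    by rewrite sumr_const -[RHS]mulr_natr; reflexivity.
  under eq_bigr do rewrite mulr_sumr.
  rewrite exchange_big /=; apply: ler_sum => x _.
  have fK : involutive (fun eta : cf => tflip eta x).
    move=> eta; apply/ffunP => z; rewrite !ffunE.
    by case: (z == x) => //; rewrite negbK.
  have Cf0 : 0 <= Cf by have /andP[+ _] := cgb (fun=> false); have /andP[_] := cgb (fun=> false); move=> /[swap]; exact: le_trans.
  apply: (@le_trans _ _ (\sum_eta Cf * m (tflip eta x))); last first.
    rewrite -mulr_sumr; have -> : \sum_eta m (tflip eta x) = 1; last by rewrite mulr1.
    by rewrite -m1 [RHS](reindex_inj (inv_inj fK)).
  apply: ler_sum => eta _.
  have H : m eta * (ln (m (tflip eta x)) - ln (m eta)) <= m (tflip eta x).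
    have := expR_ge1Dx (ln (m (tflip eta x)) - ln (m eta)).
    rewrite expRD expRN !lnK ?posrE // => /(ler_wpM2l (ltW (m0 eta))).
    rewrite [_ / _]mulrC mulrA divff ?gt_eqF // mul1r mulrDr mulr1.
    have := m0 eta; lra.
  have /andP[t0 tC] := cgb (ext (tshift x eta)).
  rewrite mulrCA /tloc (le_trans (ler_wpM2l t0 H)) // ler_wpM2r // ltW //.
have -> : \sum_eta m eta * LN K c cg (fun e => ln (m e)) eta =
  N%:R ^+ 2 * (\sum_eta m eta * \sum_(x : site d N) \sum_(i < d)
      tloc (c i) x eta * (ln (m (tswap eta x (x + tunit N i))) - ln (m eta)))
  + K * \sum_eta m eta * (\sum_(x : site d N) tloc cg x eta * (ln (m (tflip eta x)) - ln (m eta))).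
  rewrite 2!mulr_sumr -big_split /=; apply: eq_bigr => eta _.
  by rewrite /LN mulrDr !(mulrCA (m eta)).
have {}D3 := ler_wpM2l K0 D3.
have {}D2 := ler_wpM2l (sqr_ge0 N%:R) D2.
have {}D1 := ler_wpM2l (mulr_ge0 (ltW N0') (ltW cm0)) D1.
move: D1 D2 D3; set A := \sum_(_ | _) _; set B := \sum_(_ | _) _ => D1 D2 D3.
apply: (le_trans D1).
have -> : N%:R * cmin * (N%:R / 2 * D + d%:R * #|site d N|%:R / N%:R)
 = N%:R ^+ 2 * (cmin / 2 * D) + cmin * d%:R * #|site d N|%:R.
  by field; rewrite gt_eqF.
move: D2 D3; lra.
Qed.

End Torus.

(** * Finite-state semigroups *)

(** The one-sided form is needed because the minimum over [0, T] may be attained at the right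
    endpoint. *)
Lemma left_min_derive (R : realType) (f : R -> R) (a t df : R) :
  is_derive t (1 : R) f df -> a < t -> (forall s, a <= s <= t -> f t <= f s) -> df <= 0.
Proof.
move=> [fd <-] at_ fmin.
rewrite leNgt; apply/negP => df0.
have /cvgr_gt := fd; move=> /(_ 0 df0).
move=> /nbhs_ballP [e /= e0 He].
pose h := - Num.min (e / 2) (t - a).
have h0 : h < 0 by rewrite oppr_lt0 lt_min divr_gt0 //= subr_gt0.
have := He h; rewrite /ball /= sub0r normrN (lt_eqF h0) => H.
have {}H : 0 < h^-1 *: (f (h%:A + t) - f t).
  apply: H => //; rewrite ltr0_norm // opprK gt_min ltr_pdivrMr // ltr_pMr //.
  by rewrite ltr1n.
have hm : - h <= t - a by rewrite opprK ge_min lexx orbT.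
have : f t <= f (h%:A + t).
  by apply: fmin; rewrite -[h%:A]/(h * 1) mulr1; lra.
rewrite -subr_ge0 => H2; move: H.
by rewrite -[_ *: _]/(_ * _) ltNge mulr_le0_ge0 // invr_le0 ltW.
Qed.

Lemma is_derive_sum_seq (R : realType) (I : Type) (r : seq I) (f : I -> R -> R)
  (df : I -> R) (t : R) :
  (forall i, is_derive t (1 : R) (f i) (df i)) ->
  is_derive t (1 : R) (fun s => \sum_(i <- r) f i s) (\sum_(i <- r) df i).
Proof.
move=> H; elim: r => [|i r IH].
  under [X in is_derive _ _ X]boolp.funext do rewrite big_nil.
  rewrite big_nil; exact: is_derive_cst.
under [X in is_derive _ _ X]boolp.funext do rewrite big_cons.
by rewrite big_cons; exact: (is_deriveD (H i) IH).
Qed.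

Lemma is_derive_continuous (R : realType) (f : R -> R) (df : R -> R) :
  (forall t, is_derive t (1 : R) f (df t)) -> continuous f.
Proof.
move=> H t; apply: differentiable_continuous; apply/derivable1_diffP.
by have [] := H t.
Qed.

Lemma derive_ge0_le (R : realType) (f df : R -> R) (a b : R) :
  (forall t, is_derive t (1 : R) f (df t)) -> a <= b ->
  (forall t, a <= t <= b -> 0 <= df t) -> f a <= f b.
Proof.
move=> H ab df0; rewrite -subr_ge0.
have cf : {within `[a, b], continuous f}%classic.
  exact: continuous_subspaceT (is_derive_continuous H).
have [c cab ->] := @MVT_segment _ f df a b ab (fun x _ => H x) cf.
by rewrite mulr_ge0 ?subr_ge0 // df0 //; move: cab; rewrite in_itv.
Qed.

Section Semigroup.
Variables (R : realType) (S I : finType) (mv : I -> S -> S) (r : I -> S -> R).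
Variable (L : (S -> R) -> S -> R).
Hypothesis r0 : forall i eta, 0 <= r i eta.
Hypothesis LE : forall g eta, L g eta = \sum_i r i eta * (g (mv i eta) - g eta).

Definition backward (v : R -> S -> R) :=
  forall t eta, is_derive t (1 : R) (fun s => v s eta) (L (v t) eta).

(** At a negative minimum of exp(-t) v over states and times in [0, T] the time is positive, Lv >= 0
    and -v > 0. The derivative exp(-t) (Lv - v) would be positive there, against [left_min_derive];
    the exponential factor is what makes this strict. *)
Lemma min_principle v : backward v -> (forall eta, 0 <= v 0 eta) ->
  forall t eta, 0 <= t -> 0 <= v t eta.
Proof.
move=> vd v0 T eta1 T0.
pose w eta t := expR (- t) * v t eta.
have wd eta t : is_derive t (1 : R) (w eta) (expR (- t) * (L (v t) eta - v t eta)).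
  have vd' := vd t eta.
  apply: is_derive_eq.
  rewrite -[_ *: _]/(_ * _) -[X in _ + X]/(_ * _); ring.
have cw eta : {within `[0, T], continuous (w eta)}%classic.
  exact: continuous_subspaceT (is_derive_continuous (wd eta)).
have minw eta := cid2 (EVT_min T0 (cw eta)).
pose c eta := projT1 (cid2 (EVT_min T0 (cw eta))).
have cT eta : 0 <= c eta <= T.
  by rewrite /c; case: cid2 => /= x; rewrite in_itv.
have cmin eta t : 0 <= t <= T -> w eta (c eta) <= w eta t.
  by rewrite /c; case: cid2 => /= x _ H tT; apply: H; rewrite in_itv.
have [eta0 _ m0] : exists2 eta0, true & forall eta, w eta0 (c eta0) <= w eta (c eta).
  by exists (Order.arg_min eta1 predT (fun e => w e (c e))) => // eta; case: arg_minP => // i _; exact.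
have mall eta t : 0 <= t <= T -> w eta0 (c eta0) <= w eta t.
  by move=> tT; rewrite (le_trans (m0 eta)) // cmin.
have [/andP[c0 cTl]] := cT eta0.
suff w0 : 0 <= w eta0 (c eta0).
  by have := le_trans w0 (mall eta1 T _); rewrite T0 lexx pmulr_rge0 ?expR_gt0 //; exact.
rewrite leNgt; apply/negP => wneg.
have cpos : 0 < c eta0.
  rewrite lt_neqAle c0 andbT; apply/negP => /eqP c00.
  by move: wneg; rewrite -c00 ltNge mulr_ge0 ?expR_ge0.
have := @left_min_derive R (w eta0) 0 (c eta0) _ (wd eta0 (c eta0)) cpos _.
have H s : 0 <= s <= c eta0 -> w eta0 (c eta0) <= w eta0 s.
  by move=> /andP[s0 sc]; apply: mall; rewrite s0 (le_trans sc).
move=> /(_ H); apply/negP; rewrite -ltNge mulr_gt0 ?expR_gt0 // subr_gt0.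
have vneg : v (c eta0) eta0 < 0.
  by move: wneg; rewrite /w pmulr_rlt0 // expR_gt0.
rewrite (lt_le_trans vneg) // LE; apply: sumr_ge0 => i _.
rewrite mulr_ge0 // subr_ge0.
have := mall (mv i eta0) (c eta0) (cT eta0).
by rewrite /w ler_pM2l // expR_gt0.
Qed.

Lemma backward_unique v : backward v -> (forall eta, v 0 eta = 0) ->
  forall t eta, 0 <= t -> v t eta = 0.
Proof.
move=> vd v0 t eta t0; apply/eqP; rewrite eq_le; apply/andP; split.
  rewrite -oppr_ge0; apply: (@min_principle (fun t eta => - v t eta)) => //.
    move=> s e; have := vd s e => vd'; apply: is_derive_eq.
    by rewrite !LE -sumrN; apply: eq_bigr => i _; ring.
  by move=> e; rewrite v0 oppr0.
by apply: min_principle => // e; rewrite v0.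
Qed.

Variable p : R -> S -> S -> R.
Hypothesis p0 : forall eta zeta, p 0 eta zeta = (eta == zeta)%:R.
Hypothesis pd : forall zeta, backward (fun t eta => p t eta zeta).

Lemma trans_ge0 t eta zeta : 0 <= t -> 0 <= p t eta zeta.
Proof. by move=> t0; apply: (min_principle (pd zeta)) => // e; rewrite p0. Qed.

Lemma trans_sum1 t eta : 0 <= t -> \sum_zeta p t eta zeta = 1.
Proof.
move=> t0; apply/eqP; rewrite -subr_eq0; apply/eqP.
apply: (@backward_unique (fun t eta => \sum_zeta p t eta zeta - 1)) => //.
  move=> s e; have H := is_derive_sum_seq (index_enum S) (fun zeta => pd zeta s e).
  apply: is_derive_eq; rewrite LE subr0.
  under eq_bigr do rewrite LE.
  rewrite exchange_big /=; apply: eq_bigr => i _.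
  by rewrite -mulr_sumr sumrB; ring.
by move=> e; rewrite (bigD1 e) //= big1 ?p0 ?eqxx ?addr0 ?subrr // => z ze; rewrite p0 eq_sym (negbTE ze).
Qed.

(** The generator commutes with its semigroup: both sides solve the backward equation with the same
    initial value. This yields the forward equation from the backward one, which is all that is
    assumed about [p]. *)
Lemma trans_commute t eta zeta : 0 <= t ->
  L (fun e => p t e zeta) eta = \sum_xi p t eta xi * L (fun e => (e == zeta)%:R) xi.
Proof.
move=> t0; apply/eqP; rewrite -subr_eq0; apply/eqP.
apply: (@backward_unique (fun t eta => L (fun e => p t e zeta) eta -
  \sum_xi p t eta xi * L (fun e => (e == zeta)%:R) xi)) => //.
  move=> s e.
  have H1 : is_derive s (1 : R) (fun s => L (fun e => p s e zeta) e)
      (L (L (fun e => p s e zeta)) e).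
    under [X in is_derive _ _ X]boolp.funext do rewrite LE.
    rewrite LE; apply: is_derive_sum_seq => i.
    have d1 := pd zeta s (mv i e); have d2 := pd zeta s e.
    by apply: is_derive_eq.
  have H2 : is_derive s (1 : R) (fun s => \sum_xi p s e xi * L (fun e => (e == zeta)%:R) xi)
     (\sum_xi L (fun e => p s e xi) e * L (fun e => (e == zeta)%:R) xi).
    apply: is_derive_sum_seq => xi; have d2 := pd xi s e.
    apply: is_derive_eq.
    rewrite -[X in _ + X]/(_ * _) -[X in X + _]/(_ * _); ring.
  apply: is_derive_eq; rewrite [RHS]LE [in LHS]LE.
  have -> : \sum_xi L (fun e => p s e xi) e * L (fun e => (e == zeta)%:R) xi =
    \sum_i r i e * (\sum_xi p s (mv i e) xi * L (fun e => (e == zeta)%:R) xi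
                    - \sum_xi p s e xi * L (fun e => (e == zeta)%:R) xi).
    under eq_bigr do rewrite LE mulr_suml.
    rewrite exchange_big /=; apply: eq_bigr => i _.
    by rewrite -sumrB mulr_sumr; apply: eq_bigr => xi _; ring.
  by rewrite -sumrB; apply: eq_bigr => i _; ring.
move=> e; have -> : (fun e => p 0 e zeta) = (fun e => (e == zeta)%:R).
  by apply/boolp.funext => e'; rewrite p0.
rewrite (bigD1 e) //= big1 ?p0 ?eqxx ?mul1r ?addr0 ?subrr // => z ze.
by rewrite p0 eq_sym (negbTE ze) mul0r.
Qed.

Variable m0 : S -> R.
Hypothesis m00 : forall eta, 0 <= m0 eta.
Hypothesis m01 : \sum_eta m0 eta = 1.
Definition law t zeta := \sum_eta m0 eta * p t eta zeta.
Local Notation m := law.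

Lemma law_ge0 t zeta : 0 <= t -> 0 <= m t zeta.
Proof. by move=> t0; apply: sumr_ge0 => eta _; rewrite mulr_ge0 ?trans_ge0. Qed.

Lemma law_sum1 t : 0 <= t -> \sum_zeta m t zeta = 1.
Proof.
move=> t0; rewrite exchange_big -[RHS]m01 /=; apply: eq_bigr => eta _.
by rewrite -mulr_sumr trans_sum1 // mulr1.
Qed.

Lemma law0 zeta : m 0 zeta = m0 zeta.
Proof.
rewrite /law (bigD1 zeta) //= p0 eqxx mulr1 big1 ?addr0 // => e ez.
by rewrite p0 (negbTE ez) mulr0.
Qed.

Definition dlaw t zeta := \sum_eta m0 eta * L (fun e => p t e zeta) eta.
Local Notation dm := dlaw.

Lemma law_derive t zeta : is_derive t (1 : R) (fun s => m s zeta) (dm t zeta).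
Proof.
apply: is_derive_sum_seq => eta; have d := pd zeta t eta.
apply: is_derive_eq.
by rewrite -[_ *: _]/(_ * _).
Qed.

Lemma law_continuous zeta : continuous (fun t => m t zeta).
Proof. exact: (is_derive_continuous (fun t => law_derive t zeta)). Qed.

Lemma law_forward t zeta : 0 <= t ->
  dm t zeta = \sum_xi m t xi * L (fun e => (e == zeta)%:R) xi.
Proof.
move=> t0; rewrite /dlaw; under eq_bigr do rewrite trans_commute // mulr_sumr.
rewrite exchange_big /=; apply: eq_bigr => xi _; rewrite mulr_suml.
by apply: eq_bigr => eta _; rewrite mulrA.
Qed.

Lemma law_forward_sum t g : 0 <= t ->
  \sum_zeta dm t zeta * g zeta = \sum_xi m t xi * L g xi.
Proof.
move=> t0; under eq_bigr do rewrite law_forward // mulr_suml.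
rewrite exchange_big /=; apply: eq_bigr => xi _.
under eq_bigr do rewrite -mulrA.
rewrite -mulr_sumr; congr (_ * _); rewrite LE.
under eq_bigr do rewrite LE mulr_suml.
rewrite exchange_big /=; apply: eq_bigr => i _.
under eq_bigr do rewrite -mulrA.
rewrite -mulr_sumr; congr (_ * _).
under eq_bigr do rewrite mulrBl.
rewrite sumrB; congr (_ - _).
  rewrite (bigD1 (mv i xi)) //= eqxx mul1r big1 ?addr0 // => e ez.
  by rewrite eq_sym (negbTE ez) mul0r.
rewrite (bigD1 xi) //= eqxx mul1r big1 ?addr0 // => e ez.
by rewrite eq_sym (negbTE ez) mul0r.
Qed.

Hypothesis m0pos : forall eta, 0 < m0 eta.

(* exp(C t) m_t is nondecreasing when C dominates the total exit rate. *)
Lemma law_gt0 t zeta : 0 <= t -> 0 < m t zeta.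
Proof.
move=> t0; pose C := \sum_i r i zeta.
have H s : is_derive s (1 : R) (fun s => expR (C * s) * m s zeta)
    (expR (C * s) * (C * m s zeta + dm s zeta)).
  have d := law_derive s zeta; apply: is_derive_eq.
  rewrite -[_ *: _]/(_ * _) -[X in _ + X]/(_ * _) -[_%:A]/(_ * _); ring.
have : 0 < expR (C * t) * m t zeta.
  apply: (@lt_le_trans _ _ (expR (C * 0) * m 0 zeta)).
    by rewrite mulr0 expR0 mul1r law0.
  apply: (derive_ge0_le H t0) => s /andP[s0 _].
  rewrite mulr_ge0 ?expR_ge0 // law_forward // (bigD1 zeta) //=.
  rewrite addrA addr_ge0 //.
    rewrite mulrC -mulrDr mulr_ge0 ?law_ge0 // LE /C -big_split /=.
    apply: sumr_ge0 => i _; rewrite eqxx mulrBr mulr1 addrC subrK.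
    by rewrite mulr_ge0.
  apply: sumr_ge0 => e ez; rewrite mulr_ge0 ?law_ge0 // LE.
  by apply: sumr_ge0 => i _; rewrite (negbTE ez) subr0 mulr_ge0.
by rewrite pmulr_rgt0 // expR_gt0.
Qed.

Lemma entropy_derive (t : R) : 0 <= t ->
  is_derive t (1 : R) (fun s => \sum_zeta m s zeta * ln (m s zeta))
    (\sum_xi m t xi * L (fun e => ln (m t e)) xi).
Proof.
move=> t0; have -> : \sum_xi m t xi * L (fun e => ln (m t e)) xi =
    \sum_zeta dm t zeta * (ln (m t zeta) + 1).
  (* The 1 in the derivative ln x + 1 of x ln x disappears because [L] annihilates constants. *)
  rewrite law_forward_sum //; apply: eq_bigr => xi _; congr (_ * _).
  by rewrite !LE; apply: eq_bigr => i _; ring.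
apply: is_derive_sum_seq => zeta.
have d := law_derive t zeta; have mp := law_gt0 zeta t0.
have d1 := is_derive1_ln mp.
have d2 := @is_derive1_comp R (@ln R) (fun s => m s zeta) t _ _ d1 d.
have d3 := is_deriveM d d2; apply: is_derive_eq.
rewrite /= -[_ *: _]/(_ * _) -[X in _ + X]/(_ * _).
by field; rewrite gt_eqF.
Qed.

End Semigroup.

(** * Monomial expansion of local functions *)

Section Expansion.
Variables (R : realType) (d : nat).
Implicit Types (L : seq (zsite d)) (g : zconf d -> R) (z w : zsite d).

Lemma zset_zset (xi : zconf d) z b c : zset (zset xi z c) z b = zset xi z b.
Proof. by apply/boolp.funext => v; rewrite /zset; case: eqP. Qed.

Lemma zset_comm (xi : zconf d) z w b c : z != w ->
  zset (zset xi z b) w c = zset (zset xi w c) z b.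
Proof.
move=> zw; apply/boolp.funext => v; rewrite /zset; case: (v =P w) => // ->.
by rewrite eq_sym (negbTE zw).
Qed.

(** A support list may repeat a site; setting the same coordinate twice has the effect of setting it
    once. This keeps the monomials of [EnuL_expand] free of repetitions. *)
Lemma EnuL_mem rho z L g : z \in L -> EnuL rho (z :: L) g = EnuL rho L g.
Proof.
elim: L g => //= w L IH g; rewrite inE => zwL.
have [<-|zw] := eqVneq z w.
  have E b c : (fun xi => g (zset (zset xi z c) z b)) = (fun xi => g (zset xi z b)).
    by apply/boolp.funext => xi; rewrite zset_zset.
  by rewrite !E; ring.
have zL : z \in L by move: zwL; rewrite (negbTE zw).
have E b c : (fun xi => g (zset (zset xi w c) z b)) = (fun xi => g (zset (zset xi z b) w c)).
  by apply/boolp.funext => xi; rewrite zset_comm // eq_sym.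
rewrite !E -(IH (fun xi => g (zset xi w true)) zL) -(IH (fun xi => g (zset xi w false)) zL) /=.
ring.
Qed.

Definition poly_at (cs : seq (R * seq (zsite d))) (xi : zconf d) : R :=
  \sum_(q <- cs) q.1 * \prod_(z <- q.2) (xi z)%:R.

(** Induction through g = g_0 + xi_z (g_1 - g_0), where g_b fixes the coordinate at z to b. As no
    site occurs twice in a monomial, its Bernoulli mean is the power of rho given by its number of
    sites. *)
Lemma EnuL_expand L g : depends_on L g ->
  exists cs : seq (R * seq (zsite d)),
    [/\ forall q, q \in cs -> uniq q.2 /\ {subset q.2 <= L},
        forall xi, g xi = poly_at cs xi &
        forall rho, EnuL rho L g = \sum_(q <- cs) q.1 * rho ^+ size q.2].
Proof.
elim: L g => [|z L IH] g gL.
  exists [:: (g (fun=> false), [::])]; split=> [q|xi|rho].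
  - by rewrite inE => /eqP ->.
  - by rewrite /poly_at big_seq1 big_nil mulr1; apply: gL.
  - by rewrite big_seq1 expr0 mulr1.
have [zL|zL] := boolP (z \in L).
  have gL' : depends_on L g.
    by move=> xi xj H; apply: gL => w; rewrite inE => /orP [/eqP ->|]; exact: H.
  have [cs [H1 H2 H3]] := IH g gL'; exists cs; split=> // [q /H1 [uq sq]|rho].
    by split=> // w /sq wL; rewrite inE wL orbT.
  by rewrite EnuL_mem.
have [cs0 [A1 A2 A3]] := IH _ (depends_on_zset false gL).
have [cs1 [B1 B2 B3]] := IH _ (depends_on_zset true gL).
pose up (c : R) (q : R * seq (zsite d)) := (c * q.1, z :: q.2).
exists (cs0 ++ [seq up 1 q | q <- cs1] ++ [seq up (-1) q | q <- cs0]); split.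
- move=> q; rewrite !mem_cat => /or3P [/A1 [uq sq]|/mapP [q' /B1 [uq sq] ->]|/mapP [q' /A1 [uq sq] ->]] /=.
  + by split=> // w /sq wL; rewrite inE wL orbT.
  + split; first by rewrite uq andbT; apply: contra zL => /sq.
    by move=> w; rewrite !inE => /orP [->//|/sq ->]; rewrite orbT.
  + split; first by rewrite uq andbT; apply: contra zL => /sq.
    by move=> w; rewrite !inE => /orP [->//|/sq ->]; rewrite orbT.
- move=> xi; have -> : g xi = (xi z)%:R * g (zset xi z true) + (1 - (xi z)%:R) * g (zset xi z false).
    have -> : g xi = g (zset xi z (xi z)).
      by congr g; apply/boolp.funext => w; rewrite zset_id.
    by case: (xi z) => /=; ring.
  rewrite A2 B2 /poly_at !big_cat !big_map /=.
  under [X in _ = _ + (X + _)]eq_bigr do rewrite big_cons mul1r mulrCA.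
  under [X in _ = _ + (_ + X)]eq_bigr do rewrite big_cons mulrCA mulN1r mulNr.
  by rewrite -!mulr_sumr sumrN; ring.
- move=> rho /=; rewrite A3 B3 !big_cat !big_map /=.
  under [X in _ = _ + (X + _)]eq_bigr do rewrite exprS mul1r mulrCA.
  under [X in _ = _ + (_ + X)]eq_bigr do rewrite exprS mulrCA mulN1r mulNr.
  by rewrite -!mulr_sumr sumrN; ring.
Qed.

End Expansion.

(** * Lattice points projected to the torus *)

Lemma Zp_int_eq0 N (a : int) : (1 < N)%N -> (a%:~R : 'Z_N) = 0 -> (`|a| < N)%N -> a = 0.
Proof.
move=> N1 a0 aN.
have H (n : nat) : (n%:R : 'Z_N) = 0 -> (n < N)%N -> n = 0%N.
  by move=> /(congr1 val); rewrite /= val_Zp_nat // => + nN; rewrite modn_small.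
case: a a0 aN => n.
  by rewrite -pmulrn absz_nat => /H nN /nN ->.
rewrite NegzE mulrNz -pmulrn => /eqP; rewrite oppr_eq0 => /eqP /H.
by rewrite abszN absz_nat => nN /nN.
Qed.

Lemma tproj_inj_small d N (z w : zsite d) :
  (1 < N)%N -> (forall i, `|z i - w i| < N)%N -> tproj N z = tproj N w -> z = w.
Proof.
move=> N1 small /ffunP E; apply/ffunP => i; have := E i; rewrite !ffunE.
move/eqP; rewrite -subr_eq0 -intrB => /eqP /(Zp_int_eq0 N1) /(_ (small i)).
by move/eqP; rewrite subr_eq0 => /eqP.
Qed.

Lemma tprojB d N (z w : zsite d) : tproj N (z - w) = tproj N z - tproj N w.
Proof. by apply/ffunP => i; rewrite !ffunE intrB. Qed.

Lemma tproj0 d N : tproj N (0 : zsite d) = 0.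
Proof. by apply/ffunP => i; rewrite !ffunE. Qed.

Lemma tproj_unit d N (i : 'I_d) : tproj N (zunit i) = tunit N i.
Proof. by apply/ffunP => j; rewrite !ffunE -pmulrn. Qed.

Lemma extE d N (x : site d N) (eta : conf d N) z : ext (tshift x eta) z = eta (x + tproj N z).
Proof. by rewrite /ext ffunE. Qed.

Lemma coordinate_bound d (L : seq (zsite d)) : exists B : nat, forall z, z \in L -> forall i, (`|z i| <= B)%N.
Proof.
exists (\sum_(z <- L) \sum_i `|z i|)%N => z zL i.
rewrite (big_rem z) //= (bigD1 i) //=; lia.
Qed.

(** The symmetry of the rates is stated on the infinite lattice, whereas an exchange on the torus,
    lifted periodically, exchanges all translates of the bond. The two agree on the support as soon
    as [N] exceeds the distance from any support site to 0 and to the unit vector, hence the bound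
    [B + 3]. *)
Lemma exchange_invariant (R : realType) d (c : 'I_d -> zconf d -> R) (Lc : 'I_d -> seq (zsite d)) :
  (forall i, depends_on (Lc i) (c i)) ->
  (forall i xi, c i (zswap xi 0 (zunit i)) = c i xi) ->
  exists N0 : nat, forall N, (N0 <= N)%N -> forall i (x : site d N) eta,
    tloc (c i) x (tswap eta x (x + tunit N i)) = tloc (c i) x eta.
Proof.
move=> cL cs; have H i := coordinate_bound (Lc i).
have {H} [B HB] : exists B : nat, forall i z, z \in Lc i -> forall j, (`|z j| <= B)%N.
  exists (\max_i projT1 (boolp.cid (H i)))%N => i z zL j.
  apply: leq_trans (leq_bigmax i); case: boolp.cid => /= b; exact.
exists (B + 3)%N => N NB i x eta; have N1 : (1 < N)%N by lia.
rewrite /tloc -[RHS]cs; apply: cL => z zL.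
have zB := HB i z zL.
rewrite extE /zswap !extE ffunE tproj0 addr0 tproj_unit.
have -> : (x + tproj N z == x) = (z == 0).
  rewrite -{2}[x]addr0 (inj_eq (addrI x)) -(tproj0 d N).
  apply/eqP/eqP => [|->//]; apply: tproj_inj_small => // j.
  by rewrite !ffunE; move: (zB j); move: (z j : int) => a aB; lia.
have -> : (x + tproj N z == x + tunit N i) = (z == zunit i).
  rewrite (inj_eq (addrI x)) -tproj_unit.
  apply/eqP/eqP => [|->//]; apply: tproj_inj_small => // j.
  by rewrite !ffunE; move: (zB j); move: (z j : int) => a aB; case: (j == i); lia.
by [].
Qed.

(** * Block decomposition of the correction *)

Section Fields.
Variables (R : realType) (d : nat) (i0 : 'I_d) (B : nat) (cs : seq (R * seq (zsite d))).
Hypothesis csu : forall q, q \in cs -> uniq q.2.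
Hypothesis csB : forall q, q \in cs -> forall z, z \in q.2 -> forall i, (`|z i| <= B)%N.

Definition axis_point (n : nat) : zsite d := [ffun i => if i == i0 then n%:Z else 0].

(* The segment starts at distance B + 1, beyond the support of all monomials. *)
Definition block_site N l (x : site d N) (r : 'I_l) : site d N := x + tproj N (axis_point (B.+1 + r)).

Definition block_mean N l (x : site d N) (eta : conf d N) : R := bavg R (@block_site N l x) eta.

(** With Y the block mean, the linear term is split as eta_x - u = (eta_x - Y) + (Y - u). The first
    part belongs here, where exchanges make it small; the second completes the Taylor remainder in
    [block_rest]. *)
Definition block_fluct N l (x : site d N) (u : R) (eta : conf d N) : R :=
  \sum_(q <- cs) q.1 *
    ((\prod_(z <- q.2) occ R (x + tproj N z) eta - block_mean l x eta ^+ size q.2)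
     - (size q.2)%:R * u ^+ (size q.2).-1 * (occ R x eta - block_mean l x eta)).

Definition block_rest N l (x : site d N) (u : R) (eta : conf d N) : R :=
  \sum_(q <- cs) q.1 *
    (block_mean l x eta ^+ size q.2 - u ^+ size q.2
     - (size q.2)%:R * u ^+ (size q.2).-1 * (block_mean l x eta - u)).

Lemma derive1_poly (v : R) :
  derive1 (fun b : R => \sum_(q <- cs) q.1 * b ^+ size q.2) v =
  \sum_(q <- cs) q.1 * ((size q.2)%:R * v ^+ (size q.2).-1).
Proof.
rewrite derive1E.
have H : is_derive v (1 : R) (fun b : R => \sum_(q <- cs) q.1 * b ^+ size q.2)
    (\sum_(q <- cs) q.1 * ((size q.2)%:R * v ^+ (size q.2).-1)).
  apply: is_derive_sum_seq => q.
  have := is_derive_poly (q.1 *: 'X^(size q.2)) v.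
  rewrite derivZ derivXn hornerZ hornerMn hornerXn mulr_natl.
  by congr (is_derive _ _ _ _); apply/boolp.funext => b; rewrite hornerZ hornerXn.
exact: derive_val.
Qed.

Lemma fcorr_split (h : zconf d -> R) Lh N l (x : site d N) (u : R) (eta : conf d N) :
  (forall xi, h xi = poly_at cs xi) ->
  (forall rho, EnuL rho Lh h = \sum_(q <- cs) q.1 * rho ^+ size q.2) ->
  fcorr h Lh u x eta = block_fluct l x u eta + block_rest l x u eta.
Proof.
move=> hE EE; rewrite /fcorr EE.
have -> : (fun b => EnuL b Lh h) = (fun b => \sum_(q <- cs) q.1 * b ^+ size q.2).
  exact/boolp.funext.
rewrite derive1_poly /tloc hE /poly_at mulr_suml -!sumrB /block_fluct /block_rest -big_split /=.
apply: eq_bigr => q _.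
under eq_bigr do rewrite extE.
by rewrite /occ; ring.
Qed.

Lemma block_mean01 N l (x : site d N) eta : (0 < l)%N -> 0 <= block_mean l x eta <= 1.
Proof. by move=> l0; exact: bavg01. Qed.

Lemma block_rest_bound : exists2 C, 0 < C & forall N l (x : site d N) (u : R) eta,
  (0 < l)%N -> 0 <= u <= 1 -> `|block_rest l x u eta| <= C * (block_mean l x eta - u) ^+ 2.
Proof.
exists (1 + \sum_(q <- cs) `|q.1| * (size q.2)%:R ^+ 2).
  by rewrite ltr_pwDl // sumr_ge0 // => q _; rewrite mulr_ge0.
move=> N l x u eta l0 u01; rewrite mulrDl.
have s0 := sqr_ge0 (block_mean l x eta - u).
rewrite (le_trans (ler_norm_sum _ _ _)) //.
apply: (@le_trans _ _ ((\sum_(q <- cs) `|q.1| * (size q.2)%:R ^+ 2) * (block_mean l x eta - u) ^+ 2)).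
  rewrite mulr_suml; apply: ler_sum => q _; rewrite normrM -[leRHS]mulrA ler_wpM2l //.
  by apply: power_expansion => //; exact: block_mean01.
by rewrite lerDr mul1r.
Qed.

Lemma occ_prod01 (T : finType) (eta : {ffun T -> bool}) (zs : seq T) :
  0 <= \prod_(z <- zs) occ R z eta <= 1.
Proof.
elim: zs => [|z zs /andP[a0 a1]]; first by rewrite big_nil ler01 lexx.
rewrite big_cons; have /andP[b0 b1] := occ01 R z eta.
by rewrite mulr_ge0 //= mulr_ile1.
Qed.

Lemma block_fluct_bound : exists2 C, 0 < C & forall N l (x : site d N) (u : R) eta,
  (0 < l)%N -> 0 <= u <= 1 -> `|block_fluct l x u eta| <= C.
Proof.
exists (1 + \sum_(q <- cs) `|q.1| * (1 + (size q.2)%:R)).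
  by rewrite ltr_pwDl // sumr_ge0 // => q _; rewrite mulr_ge0 // addr_ge0.
move=> N l x u eta l0 /andP[u0 u1].
rewrite (le_trans (ler_norm_sum _ _ _)) //.
apply: (@le_trans _ _ (\sum_(q <- cs) `|q.1| * (1 + (size q.2)%:R))); last by rewrite lerDr.
apply: ler_sum => q _; rewrite normrM ler_wpM2l //.
have /andP[y0 y1] := block_mean01 x eta l0.
rewrite (le_trans (ler_normB _ _)) // lerD //.
  have := occ_prod01 eta [seq x + tproj N z | z <- q.2]; rewrite big_map.
  have : 0 <= block_mean l x eta ^+ size q.2 <= 1 by rewrite exprn_ge0 //= exprn_ile1.
  by rewrite ler_norml; lra.
rewrite -mulrA normrM normr_nat ler_piMr // normrM mulr_ile1 ?normr_ge0 //.
  by rewrite normrX exprn_ile1 // ger0_norm.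
by have := occ01 R x eta; rewrite ler_norml; lra.
Qed.

(** Chosen so that a site of the support box and a site of the block are at l1 distance at most
    [block_reach * l]: at most B + l along the axis, plus B in each of the d directions. *)
Definition block_reach : nat := (B.+1 + d * B + 1)%N.
Local Notation M := block_reach.

Lemma znorm_block_site l (z : zsite d) (r : 'I_l) :
  (forall i, `|z i| <= B)%N -> (znorm (axis_point (B.+1 + r) - z)%R <= M * l)%N.
Proof.
move=> zB; have rl := ltn_ord r.
rewrite /znorm.
apply: (@leq_trans (\sum_i ((i == i0) * (B.+1 + r) + B))%N).
  apply: leq_sum => i _; rewrite !ffunE; move: (zB i); move: (z i : int) => a aB.
  by case: (i == i0); lia.
rewrite big_split /= sum_nat_const card_ord (bigD1 i0) //= eqxx mul1n big1 ?addn0.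
  by rewrite /block_reach; nia.
by move=> i /negbTE ->.
Qed.

Variables (N l : nat).
Hypotheses (l0 : (0 < l)%N) (lN : (B.+1 + l + B < N)%N).

Lemma block_site_inj (x : site d N) : injective (@block_site N l x).
Proof.
move=> r s /addrI E; apply: val_inj => /=.
have rl := ltn_ord r; have sl := ltn_ord s.
have : axis_point (B.+1 + r) = axis_point (B.+1 + s).
  apply: (@tproj_inj_small d N) E; first lia.
  by move=> i; rewrite !ffunE; case: (i == i0); lia.
by move/ffunP/(_ i0); rewrite !ffunE eqxx; lia.
Qed.

Lemma block_site_neq (x : site d N) (z : zsite d) (r : 'I_l) :
  (forall i, `|z i| <= B)%N -> x + tproj N z != block_site x r.
Proof.
move=> zB; apply/eqP => /addrI E; have rl := ltn_ord r.
have : z = axis_point (B.+1 + r).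
  apply: (@tproj_inj_small d N) E; first lia.
  move=> i; rewrite !ffunE; move: (zB i); move: (z i : int) => a aB.
  by case: (i == i0); lia.
move/ffunP/(_ i0); rewrite !ffunE eqxx; move: (zB i0); move: (z i0 : int) => a; lia.
Qed.

Local Notation cf := (conf d N).
Variable m : cf -> R.
Hypotheses (m0 : forall eta, 0 <= m eta) (m1 : \sum_eta m eta = 1).

(** Summing [monomial_bound] over [x] turns each exchange distance into [xsum] at a fixed
    displacement, of length at most M l. Averaging over the l block sites keeps a single factor l in
    front of [xtot]. *)
Lemma monomial_sum (zs : seq (zsite d)) :
  uniq zs -> (forall z, z \in zs -> forall i, (`|z i| <= B)%N) ->
  \sum_(x : site d N) `|\sum_eta m eta * (\prod_(z <- zs) occ R (x + tproj N z) eta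
                                          - block_mean l x eta ^+ size zs)|
  <= (4 * M%:R * (size zs)%:R + (size zs)%:R ^+ 2) *
     (l%:R * xtot m + #|site d N|%:R / l%:R).
Proof.
move=> uz zB; have L0 : 0 < l%:R :> R by rewrite ltr0n.
have X0 : 0 <= xtot m by apply: sumr_ge0 => i _; exact: xsum_ge0.
apply: (@le_trans _ _ (\sum_(x : site d N) (\sum_(z <- zs) (\sum_(r < l)
    xdist m (x + tproj N z) (block_site x r)) / l%:R + (size zs)%:R ^+ 2 / l%:R))).
  apply: ler_sum => x _.
  pose ys := [seq x + tproj N z | z <- zs].
  have uy : uniq ys.
    rewrite map_inj_in_uniq ?uz // => z w zz wz /addrI; apply: tproj_inj_small; first lia.
    move=> i; move: (zB z zz i) (zB w wz i); move: (z i : int) (w i : int) => a b; lia.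
  have H (y : site d N) (r : 'I_l) : y \in ys -> y != block_site x r.
    by case/mapP => z zz ->; apply: block_site_neq; exact: zB.
  have -> : \sum_eta m eta * (\prod_(z <- zs) occ R (x + tproj N z) eta
                                          - block_mean l x eta ^+ size zs) =
     \sum_eta m eta * (\prod_(y <- ys) occ R y eta * bavg R (@block_site N l x) eta ^+ 0
                                          - bavg R (@block_site N l x) eta ^+ (0 + size ys)).
    by apply: eq_bigr => eta _; rewrite big_map size_map expr0 mulr1.
  apply: le_trans (monomial_bound l0 0 (@block_site_inj x) uy H m0 m1) _.
  by rewrite size_map add0n big_map natrM.
rewrite big_split /= sumr_const exchange_big /=.
have H1 (z : zsite d) : z \in zs -> \sum_(x : site d N) (\sum_(r < l) xdist m (x + tproj N z) (block_site x r)) / l%:R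
   <= 4 * M%:R * l%:R * xtot m.
  move=> zz; rewrite -mulr_suml exchange_big /= ler_pdivrMr //.
  have -> : 4 * M%:R * l%:R * xtot m * l%:R = \sum_(r < l) 4 * M%:R * l%:R * xtot m.
    by rewrite sumr_const card_ord mulr_natr.
  apply: ler_sum => r _; rewrite xsum_shift -tprojB.
  rewrite (le_trans (xsum_tproj _ _)) // ler_wpM2r // -mulrA ler_wpM2l //.
  by rewrite -natrM ler_nat znorm_block_site //; exact: zB.
apply: (@le_trans _ _ (\sum_(z <- zs) 4 * M%:R * l%:R * xtot m +
   ((size zs)%:R ^+ 2 / l%:R) *+ #|site d N|)).
  rewrite lerD2r big_seq [leRHS]big_seq; apply: ler_sum => z zz; exact: H1.
rewrite big_const_seq count_predT iter_addr_0 -[_ * xtot m *+ _]mulr_natr -[(_ / _) *+ _]mulr_natr.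
set k : R := (size zs)%:R; set T : R := #|_|%:R; set X := xtot m in X0 *.
have k0 : 0 <= k by rewrite /k ler0n.
have T0 : 0 <= T by rewrite /T ler0n.
have TL : 0 <= T / l%:R by rewrite divr_ge0 // ltW.
have M0 : 0 <= M%:R :> R by rewrite ler0n.
rewrite -subr_ge0.
have -> : (4 * M%:R * k + k ^+ 2) * (l%:R * X + T / l%:R) -
   (4 * M%:R * l%:R * X * k + k ^+ 2 / l%:R * T) =
   4 * M%:R * k * (T / l%:R) + k ^+ 2 * (l%:R * X) by ring.
by rewrite addr_ge0 // ?mulr_ge0 ?sqr_ge0 ?(ltW L0).
Qed.

Lemma dynamic_bound (a u : site d N -> R) (A : R) :
  (forall x, `|a x| <= A) -> (forall x, 0 <= u x <= 1) ->
  `|\sum_eta m eta * \sum_x a x * block_fluct l x (u x) eta| <=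
  A * (\sum_(q <- cs) `|q.1| * ((4 * M%:R * (size q.2)%:R + (size q.2)%:R ^+ 2) +
        (size q.2)%:R * (4 * M%:R + 1))) *
      (l%:R * xtot m + #|site d N|%:R / l%:R).
Proof.
move=> aA u01.
have A0 : 0 <= A by rewrite (le_trans _ (aA 0)).
set X := _ * xtot m + _.
pose T1 q x := `|\sum_eta m eta * (\prod_(z <- q) occ R (x + tproj N z) eta
                                          - block_mean l x eta ^+ size q)|.
pose T2 x := `|\sum_eta m eta * (occ R x eta - block_mean l x eta)|.
apply: (@le_trans _ _ (A * \sum_(q <- cs) `|q.1| * (\sum_x T1 q.2 x + (size q.2)%:R * \sum_x T2 x))).
  have -> : \sum_eta m eta * \sum_x a x * block_fluct l x (u x) eta =
    \sum_x a x * \sum_(q <- cs) q.1 *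
      (\sum_eta m eta * (\prod_(z <- q.2) occ R (x + tproj N z) eta
                                          - block_mean l x eta ^+ size q.2)
       - (size q.2)%:R * u x ^+ (size q.2).-1 *
          \sum_eta m eta * (occ R x eta - block_mean l x eta)).
    under [LHS]eq_bigr do rewrite mulr_sumr.
    rewrite exchange_big /=; apply: eq_bigr => x _.
    under [LHS]eq_bigr do rewrite mulrCA.
    rewrite -mulr_sumr; congr (_ * _); rewrite /block_fluct.
    under [LHS]eq_bigr do rewrite mulr_sumr.
    rewrite exchange_big /=; apply: eq_bigr => q _.
    under [LHS]eq_bigr do rewrite mulrCA.
    rewrite -mulr_sumr; congr (_ * _).
    by rewrite mulr_sumr -sumrB; apply: eq_bigr => eta _; ring.
  rewrite (le_trans (ler_norm_sum _ _ _)) //.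
  have -> : A * \sum_(q <- cs) `|q.1| * (\sum_x T1 q.2 x + (size q.2)%:R * \sum_x T2 x)
    = \sum_x A * \sum_(q <- cs) `|q.1| * (T1 q.2 x + (size q.2)%:R * T2 x).
    rewrite -mulr_sumr; congr (_ * _); rewrite exchange_big /=; apply: eq_bigr => q _.
    by rewrite -mulr_sumr big_split /= -mulr_sumr.
  apply: ler_sum => x _; rewrite normrM; apply: ler_pM => //.
  rewrite (le_trans (ler_norm_sum _ _ _)) //; apply: ler_sum => q _.
  rewrite normrM ler_wpM2l // (le_trans (ler_normB _ _)) // lerD2l.
  rewrite normrM ler_wpM2r ?normr_ge0 // normrM normr_nat ler_piMr //.
  by have /andP[ux0 ux1] := u01 x; rewrite normrX exprn_ile1 // ger0_norm.
rewrite -[leRHS]mulrA ler_wpM2l // mulr_suml.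
rewrite big_seq [leRHS]big_seq; apply: ler_sum => q qcs.
rewrite -[leRHS]mulrA ler_wpM2l // [leRHS]mulrDl lerD //.
  by apply: monomial_sum; [exact: csu|exact: csB].
rewrite -[leRHS]mulrA ler_wpM2l //.
(* The linear term eta_x - Y is itself the monomial with the single site 0. *)
have := @monomial_sum [:: 0] isT.
have H0 z : z \in [:: 0 : zsite d] -> forall i, (`|z i| <= B)%N.
  by rewrite inE => /eqP -> i; rewrite ffunE.
move=> /(_ H0) /=; rewrite expr1n mulr1.
rewrite (eq_bigr T2) // => x _; rewrite /T2; congr `|_|; apply: eq_bigr => eta _.
by rewrite big_seq1 tproj0 addr0 expr1.
Qed.

Lemma tproj_axis_point n : tproj N (axis_point n) = tunit N i0 *+ n.
Proof.
apply/ffunP => j; rewrite !ffunE ffunMnE ffunE.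
by case: (j == i0); rewrite ?mul0rn // -pmulrn mulr1n.
Qed.

Lemma gradient_steps (u : site d N -> R) (g : R) x n :
  (forall x, `|u (x + tunit N i0) - u x| <= g) ->
  `|u (x + tunit N i0 *+ n) - u x| <= n%:R * g.
Proof.
move=> ug; elim: n => [|n IH]; first by rewrite mulr0n addr0 subrr normr0 mul0r.
have -> : u (x + tunit N i0 *+ n.+1) - u x =
  (u (x + tunit N i0 *+ n + tunit N i0) - u (x + tunit N i0 *+ n)) + (u (x + tunit N i0 *+ n) - u x).
  by rewrite mulrSr addrA; ring.
rewrite (le_trans (ler_normD _ _)) // -natr1 mulrDl mul1r addrC lerD //.
Qed.

(** The block mean is compared with the average [ub] of [u] over the block. The difference is a
    centred block sum, to which [static_estimate] applies, and [ub - u x] is at most the gradient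
    times the distance to the far end of the block. *)
Lemma static_bound (u : site d N -> R) (g : R) :
  (forall x, 0 < u x < 1) -> (forall x, `|u (x + tunit N i0) - u x| <= g) ->
  \sum_x \sum_eta m eta * (block_mean l x eta - u x) ^+ 2 <=
  2 * (128 * rel_entropy m (nuprod u) + 4 * #|site d N|%:R / l%:R)
  + 2 * (#|site d N|%:R * ((B.+1 + l)%:R * g) ^+ 2).
Proof.
move=> u01 ug; have L0 : 0 < l%:R :> R by rewrite ltr0n.
have g0 : 0 <= g by rewrite (le_trans _ (ug 0)).
have einj j k : (j < l)%N -> (k < l)%N -> tunit N i0 *+ j = tunit N i0 *+ k -> j = k.
  move=> jl kl; rewrite -!tproj_axis_point => E.
  have : axis_point j = axis_point k.
    apply: (@tproj_inj_small d N) E; first lia.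
    by move=> i; rewrite !ffunE; case: (i == i0); lia.
  by move/ffunP/(_ i0); rewrite !ffunE eqxx; lia.
(* The block of [x] starts B + 1 steps away, so it is the segment based at [x1 x]. *)
pose x1 (x : site d N) : site d N := x + tunit N i0 *+ B.+1.
pose ub x := (\sum_(k < l) u (x1 x + tunit N i0 *+ k)) / l%:R.
have YE x eta : block_mean l x eta - ub x = bsum u (tunit N i0) l (x1 x) eta / l%:R.
  rewrite /block_mean /bavg /ub bsumE -mulrBl; congr (_ / _); rewrite -sumrB.
  by apply: eq_bigr => k _; rewrite /block_site tproj_axis_point mulrnDr addrA.
have ubE x : (ub x - u x) ^+ 2 <= ((B.+1 + l)%:R * g) ^+ 2.
  rewrite -[leLHS]real_normK ?num_real // ler_sqr ?nnegrE ?mulr_ge0 //.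
  have -> : ub x - u x = (\sum_(k < l) (u (x1 x + tunit N i0 *+ k) - u x)) / l%:R.
    rewrite sumrB sumr_const card_ord mulrBl -[u x *+ l]mulr_natr mulfK ?gt_eqF //.
  rewrite normrM [`|_^-1|]ger0_norm ?invr_ge0 ?ler0n // ler_pdivrMr //.
  rewrite (le_trans (ler_norm_sum _ _ _)) //.
  have -> : (B.+1 + l)%:R * g * l%:R = \sum_(k < l) (B.+1 + l)%:R * g.
    by rewrite sumr_const card_ord mulr_natr.
  apply: ler_sum => k _; rewrite /x1 -addrA -mulrnDr.
  rewrite (le_trans (gradient_steps _ _ ug)) // ler_wpM2r // ler_nat leq_add2l.
  exact: ltnW.
apply: (@le_trans _ _ (\sum_x \sum_eta m eta * (2 * (bsum u (tunit N i0) l (x1 x) eta / l%:R) ^+ 2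
    + 2 * ((B.+1 + l)%:R * g) ^+ 2))).
  apply: ler_sum => x _; apply: ler_sum => eta _; rewrite ler_wpM2l // -YE.
  apply: le_trans (_ : 2 * (block_mean l x eta - ub x) ^+ 2 + 2 * (ub x - u x) ^+ 2 <= _).
    have : 0 <= ((block_mean l x eta - ub x) - (ub x - u x)) ^+ 2 by exact: sqr_ge0.
    nra.
  by rewrite lerD2l ler_wpM2l.
have -> : \sum_x \sum_eta m eta * (2 * (bsum u (tunit N i0) l (x1 x) eta / l%:R) ^+ 2
    + 2 * ((B.+1 + l)%:R * g) ^+ 2) =
  2 * (\sum_x \sum_eta m eta * (bsum u (tunit N i0) l x eta / l%:R) ^+ 2) +
  2 * (#|site d N|%:R * ((B.+1 + l)%:R * g) ^+ 2).
  rewrite [X in _ = 2 * X + _](reindex_inj (addIr (tunit N i0 *+ B.+1))) /=.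
  have -> : 2 * (#|site d N|%:R * ((B.+1 + l)%:R * g) ^+ 2) =
     \sum_(x : site d N) \sum_eta m eta * (2 * ((B.+1 + l)%:R * g) ^+ 2).
    rewrite -mulr_suml m1 mul1r sumr_const -[RHS]mulr_natl mulrCA; reflexivity.
  rewrite mulr_sumr -big_split /=; apply: eq_bigr => x _.
  rewrite mulr_sumr -big_split /=; apply: eq_bigr => eta _.
  by rewrite /x1; ring.
by rewrite lerD2r ler_wpM2l //; apply: static_estimate.
Qed.

End Fields.

(** * Fubini for bounded functions *)

(* The class [bdsupp D] is stable under products and partial integrals, so that
   Fubini's theorem applies freely when D has finite measure. *)
Section BoundedSupport.
Variables (R : realType) (d : measure_display) (T : measurableType d).

Definition bdsupp (D : set T) (f : T -> R) := [/\ measurable_fun setT f,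
  (exists B, forall x, `|f x| <= B) & forall x, ~ D x -> f x = 0].

Variables (mu : {measure set T -> \bar R}) (D : set T).
Hypotheses (mD : measurable D) (muD : (mu D < +oo)%E).

Lemma bdsupp_integrable f : bdsupp D f -> mu.-integrable setT (EFin \o f).
Proof.
move=> [mf [B fB] f0].
have : mu.-integrable D (EFin \o f).
  apply: measurable_bounded_integrable => //; first exact: measurable_funTS.
  by exists B; split; [exact: num_real|move=> M BM x _; exact: le_trans (fB x) (ltW BM)].
move/(integrable_mkcond _ mD); congr (integrable _ _ _).
apply/funext => x; rewrite /patch; case: ifPn => //.
by rewrite notin_setE => /f0 /= ->.
Qed.

Lemma bdsupp_Rintegral f : bdsupp D f -> \int[mu]_x f x = \int[mu]_(x in D) f x.
Proof.
move=> [_ _ f0]; rewrite [RHS]Rintegral_mkcond; apply: eq_Rintegral => x _.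
by rewrite /patch; case: ifPn => //; rewrite notin_setE => /f0 /= ->.
Qed.

Lemma bdsupp_Rintegral_le f B : bdsupp D f -> (forall x, `|f x| <= B) ->
  `|\int[mu]_x f x| <= B * fine (mu D).
Proof.
move=> bf fB; have intf := bdsupp_integrable bf.
have intfD : mu.-integrable D (EFin \o f).
  by apply: integrableS intf => //.
rewrite bdsupp_Rintegral // (le_trans (le_normr_Rintegral _ _)) //.
rewrite -Rintegral_cst //; apply: le_Rintegral => //; first exact: integrable_norm.
apply: (@measurable_bounded_integrable _ _ _ mu (cst B)) => //.
by exists `|B|; split; [exact: num_real|move=> M BM x _; exact: ltW].
Qed.

End BoundedSupport.

Section Closure.
Variables (R : realType) (d : measure_display) (T : measurableType d).

Lemma bdsuppM (D : set T) (f g : T -> R) : bdsupp D f -> bdsupp setT g ->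
  bdsupp D (fun x => f x * g x).
Proof.
move=> [mf [B fB] f0] [mg [C gC] _]; split.
- exact: measurable_funM.
- exists (B * C) => x; rewrite normrM ler_pM //.
- by move=> x /f0 ->; rewrite mul0r.
Qed.

Lemma bdsuppT (D : set T) (f : T -> R) : bdsupp D f -> bdsupp setT f.
Proof. by move=> [mf Bf f0]; split => // x []. Qed.

Lemma bdsuppD (D : set T) (f g : T -> R) : bdsupp D f -> bdsupp D g ->
  bdsupp D (fun x => f x + g x).
Proof.
move=> [mf [B fB] f0] [mg [C gC] g0]; split.
- exact: measurable_funD.
- by exists (B + C) => x; rewrite (le_trans (ler_normD _ _)) // lerD.
- by move=> x Dx; rewrite f0 // g0 // addr0.
Qed.

End Closure.

Section Fubini.
Variables (R : realType) (d1 d2 : measure_display).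
Variables (T1 : measurableType d1) (T2 : measurableType d2).
Variables (m1 : {sigma_finite_measure set T1 -> \bar R}).
Variables (m2 : {sigma_finite_measure set T2 -> \bar R}).
Variables (D1 : set T1) (D2 : set T2).
Hypotheses (mD1 : measurable D1) (mD2 : measurable D2).
Hypotheses (fD1 : (m1 D1 < +oo)%E) (fD2 : (m2 D2 < +oo)%E).
Variable f : T1 * T2 -> R.
Hypothesis bf : bdsupp (D1 `*` D2) f.

Lemma bdsupp_section1 x : bdsupp D2 (fun y => f (x, y)).
Proof.
move: bf => [mf [B fB] f0]; split; first exact: measurableT_comp.
  by exists B.
by move=> y D2y; apply: f0 => -[].
Qed.

Lemma bdsupp_section2 y : bdsupp D1 (fun x => f (x, y)).
Proof.
move: bf => [mf [B fB] f0]; split; first exact: measurableT_comp.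
  by exists B.
by move=> x D1x; apply: f0 => -[].
Qed.

Lemma bdsupp_prod_integrable : (m1 \x m2)%E.-integrable setT (EFin \o f).
Proof.
apply: (bdsupp_integrable _ _ bf); first exact: measurableX.
rewrite /= (product_measure1E m1 m2 mD1 mD2) lte_mul_pinfty // fin_real // fD1.
by rewrite (lt_le_trans _ (measure_ge0 _ _)).
Qed.

Lemma section1_EFin x : (\int[m2]_y f (x, y))%:E = (\int[m2]_y (f (x, y))%:E)%E.
Proof.
rewrite /Rintegral fineK //.
by have := bdsupp_integrable mD2 fD2 (bdsupp_section1 x); exact: integrable_fin_num.
Qed.

Lemma section2_EFin y : (\int[m1]_x f (x, y))%:E = (\int[m1]_x (f (x, y))%:E)%E.
Proof.
rewrite /Rintegral fineK //.
by have := bdsupp_integrable mD1 fD1 (bdsupp_section2 y); exact: integrable_fin_num.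
Qed.

Lemma bdsupp_Fubini : \int[m1]_x \int[m2]_y f (x, y) = \int[m2]_y \int[m1]_x f (x, y).
Proof.
rewrite /Rintegral; congr fine.
under eq_integral do rewrite -/(Rintegral _ _ _) section1_EFin.
under [RHS]eq_integral do rewrite -/(Rintegral _ _ _) section2_EFin.
exact: (Fubini bdsupp_prod_integrable).
Qed.

Lemma bdsupp_partial1 : bdsupp D1 (fun x => \int[m2]_y f (x, y)).
Proof.
have [mf [B fB] f0] := bf; split.
- apply/measurable_EFinP; rewrite [X in measurable_fun _ X](_ : _ = fubini_F m2 (EFin \o f)).
    exact: measurable_fubini_F bdsupp_prod_integrable.
  by apply/funext => x; rewrite /= section1_EFin.
- exists (B * fine (m2 D2)) => x.
  exact: (bdsupp_Rintegral_le mD2 fD2 (bdsupp_section1 x)).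
- move=> x D1x; rewrite /Rintegral integral0_eq // => y _.
  by rewrite f0 // => -[].
Qed.

Lemma bdsupp_partial2 : bdsupp D2 (fun y => \int[m1]_x f (x, y)).
Proof.
have [mf [B fB] f0] := bf; split.
- apply/measurable_EFinP; rewrite [X in measurable_fun _ X](_ : _ = fubini_G m1 (EFin \o f)).
    exact: measurable_fubini_G bdsupp_prod_integrable.
  by apply/funext => x; rewrite /= section2_EFin.
- exists (B * fine (m1 D1)) => x.
  exact: (bdsupp_Rintegral_le mD1 fD1 (bdsupp_section2 x)).
- move=> x D1x; rewrite /Rintegral integral0_eq // => y _.
  by rewrite f0 // => -[].
Qed.

End Fubini.

(** * Joint measurability of the paths *)

Section Process.
Variables (R : realType) (S : finType) (dO : measure_display) (Om : measurableType dO).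
Variable (X : R -> Om -> S).
Hypothesis mX : forall t zeta, measurable [set om | X t om = zeta].
Hypothesis rcX : forall om t, 0 <= t -> exists2 del : R, 0 < del &
  forall s, t <= s < t + del -> X s om = X t om.

(* Right-constancy makes [X t] the eventual value of [X] at the grid points
   just above [t], so the path space is jointly measurable. *)
Definition grid (n : nat) (t : R) : R := (Num.truncn (n.+1%:R * t)).+1%:R / n.+1%:R.

Lemma gridP n t : 0 <= t -> t <= grid n t < t + n.+1%:R^-1 *+ 2.
Proof.
move=> t0; have n0 : 0 < n.+1%:R :> R by [].
have /andP[h1 h2] := truncn_itv (mulr_ge0 (ltW n0) t0).
rewrite /grid ler_pdivlMr // mulrC (ltW h2) /=.
rewrite ltr_pdivrMr // mulrDl [X in _ + X]mulrnAl mulVf ?gt_eqF //.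
by rewrite -natr1 [ltRHS]addrC; move: h1; rewrite mulrC; lra.
Qed.

Lemma cylinder_measurable n zeta :
  measurable [set z : R * Om | 0 <= z.1 /\ X (grid n z.1) z.2 = zeta].
Proof.
rewrite [X in measurable X](_ : _ = \bigcup_k
  (`[k%:R / n.+1%:R, k.+1%:R / n.+1%:R[%classic `*` [set om | X (k.+1%:R / n.+1%:R) om = zeta])).
  by apply: bigcup_measurable => k _; apply: measurableX.
have n0 : 0 < n.+1%:R :> R by [].
apply/seteqP; split=> [[t om] /= [t0 <-]|[t om] [k _ [/= +]]].
  exists (Num.truncn (n.+1%:R * t)) => //; split => //=.
  have /andP[h1 h2] := truncn_itv (mulr_ge0 (ltW n0) t0).
  by rewrite in_itv /= ler_pdivrMr // ltr_pdivlMr // [t * _]mulrC h1.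
rewrite in_itv /= ler_pdivrMr // ltr_pdivlMr // => /andP[h1 h2] h3; split.
  rewrite leNgt; apply/negP => t0.
  have : t * n.+1%:R < 0 by rewrite pmulr_llt0.
  by apply/negP; rewrite -leNgt (le_trans _ h1).
by rewrite /grid (@truncn_def _ _ k) // [_ * t]mulrC h1 h2.
Qed.

Lemma joint_measurable zeta :
  measurable [set z : R * Om | 0 <= z.1 /\ X z.1 z.2 = zeta].
Proof.
rewrite [X in measurable X](_ : _ = \bigcup_k \bigcap_(n in [set n | (k <= n)%N])
   [set z : R * Om | 0 <= z.1 /\ X (grid n z.1) z.2 = zeta]).
  apply: bigcup_measurable => k _; apply: bigcap_measurable => [|n _].
    by exists k => /=.
  exact: cylinder_measurable.
have ev t om : 0 <= t -> exists k, forall n, (k <= n)%N -> X (grid n t) om = X t om.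
  move=> t0; have [del del0 H] := rcX om t0.
  (* The grid point exceeds [t] by less than 2 / (n + 1), which is at most [del] from this index
     on. *)
  exists (Num.truncn (2 / del)) => n kn; apply: H.
  have /andP[h1 h2] := gridP n t0; rewrite h1 /= (lt_le_trans h2) // lerD2l.
  have n0 : 0 < n.+1%:R :> R by [].
  have d0 : 0 <= 2 / del by rewrite divr_ge0 // ltW.
  have /andP[_ h4] := truncn_itv d0.
  have : 2 / del <= n.+1%:R by rewrite (le_trans (ltW h4)) // ler_nat.
  rewrite ler_pdivrMr // => h5; rewrite (_ : _ *+ 2 = 2 / n.+1%:R); last by rewrite mulr_natl.
  by rewrite ler_pdivrMr // mulrC.
apply/seteqP; split=> [[t om] /= [t0 Xz]|[t om] [k _ H] /=].
  have [k Hk] := ev t om t0; exists k => // n /= kn; split => //.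
  by rewrite Hk.
have [t0 _] := H k (leqnn k); split => //.
have [k' Hk'] := ev t om t0.
have [_ /=] := H (maxn k k') (leq_maxl _ _).
by rewrite Hk' // leq_maxr.
Qed.

(** Written with indicators of the sets of [joint_measurable], so that joint measurability in time
    and path reduces to measurability of [V] in time for each of the finitely many states. *)
Definition path_fun (V : R -> S -> R) (z : R * Om) : R :=
  \sum_zeta V z.1 zeta * \1_([set z : R * Om | 0 <= z.1 /\ X z.1 z.2 = zeta]) z.

Lemma path_funE (V : R -> S -> R) t om : 0 <= t -> path_fun V (t, om) = V t (X t om).
Proof.
move=> t0; rewrite /path_fun (bigD1 (X t om)) //= indicE mem_set //= mulr1.
rewrite big1 ?addr0 // => zeta zX; rewrite indicE memNset ?mulr0 //=.
by move=> [_ /esym/eqP]; apply/negP.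
Qed.

Variables (a b : R).
Hypotheses (a0 : 0 <= a) (ab : a <= b).
Local Notation D := [set` `[a, b]%R].

(** The cut-off makes time integrals over the whole line integrals of functions supported on a set
    of finite measure, as [bdsupp] requires. *)
Definition tcut (V : R -> S -> R) (t : R) (eta : S) : R := V t eta * \1_D t.

Lemma tcut_measurable (V : R -> S -> R) eta :
  measurable_fun D (fun t => V t eta) -> measurable_fun setT (fun t => tcut V t eta).
Proof.
move=> mV; rewrite [X in measurable_fun _ X](_ : _ = (fun t => V t eta) \_ D).
  by apply/(measurable_restrictT _ _).1.
by apply/funext => t; rewrite /tcut indicE /patch; case: ifPn; rewrite ?mulr1 ?mulr0.
Qed.

Lemma path_fun_measurable (V : R -> S -> R) :
  (forall eta, measurable_fun D (fun t => V t eta)) ->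
  measurable_fun setT (path_fun (tcut V)).
Proof.
move=> mV; apply: measurable_sum => zeta; apply: measurable_funM.
  apply: measurableT_comp (tcut_measurable (mV zeta)) _; exact: measurable_fst.
by apply: measurable_indic; exact: joint_measurable.
Qed.

Lemma path_section_measurable (V : R -> S -> R) om :
  (forall eta, measurable_fun D (fun t => V t eta)) ->
  measurable_fun D (fun t => V t (X t om)).
Proof.
move=> mV; have mF := path_fun_measurable mV.
have : measurable_fun setT (fun t => path_fun (tcut V) (t, om)).
  exact: (measurableT_comp mF).
move=> /(@measurable_funTS _ _ _ _ D); apply: eq_measurable_fun => t.
rewrite inE => Dt; have t0 : 0 <= t.
  by move: Dt; rewrite /= in_itv /= => /andP[ta _]; exact: le_trans ta.
by rewrite path_funE // /tcut indicE mem_set // mulr1.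
Qed.

Lemma path_fun_bdsupp (V : R -> S -> R) (B : R) : 0 <= B -> (forall eta, measurable_fun D (fun t => V t eta)) ->
  (forall t eta, D t -> `|V t eta| <= B) ->
  bdsupp (D `*` [set: Om]) (path_fun (tcut V)).
Proof.
move=> B0 mV VB; split; first exact: path_fun_measurable.
- exists (\sum_(zeta : S) B) => -[t om]; rewrite (le_trans (ler_norm_sum _ _ _)) //.
  apply: ler_sum => zeta _; rewrite normrM.
  apply: (@le_trans _ _ (`|tcut V t zeta| * 1)).
    rewrite ler_wpM2l // indicE; case: (_ \in _); rewrite ?normr1 ?normr0 //.
  rewrite mulr1 /tcut indicE; case: (boolP (t \in D)) => [|_].
    by rewrite inE mulr1 => /VB.
  by rewrite mulr0 normr0.
- move=> [t om] /= H; rewrite /path_fun big1 // => zeta _ /=.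
  rewrite /tcut [\1_D _]indicE memNset ?mulr0 ?mul0r // => Dt.
  by apply: H.
Qed.

End Process.

(** * Second moment of a path integral *)

Lemma bdsupp_Rintegral_sum (R : realType) (d : measure_display) (T : measurableType d)
  (mu : {measure set T -> \bar R}) (D : set T) (I : Type) (r : seq I) (f : I -> T -> R) :
  measurable D -> (mu D < +oo)%E -> (forall i, bdsupp D (f i)) ->
  bdsupp D (fun x => \sum_(i <- r) f i x) /\
  \int[mu]_x (\sum_(i <- r) f i x) = \sum_(i <- r) \int[mu]_x f i x.
Proof.
move=> mD fD bf; elim: r => [|i r [IH1 IH2]].
  under [X in bdsupp D X]funext do rewrite big_nil.
  rewrite big_nil; split.
    by split=> //; exists 0 => x; rewrite normr0.
  by under eq_Rintegral do rewrite big_nil; rewrite /Rintegral integral0.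
under [X in bdsupp D X]funext do rewrite big_cons.
rewrite big_cons -IH2; split; first exact: bdsuppD.
under eq_Rintegral do rewrite big_cons.
by rewrite RintegralD //; apply: (bdsupp_integrable  mD fD).
Qed.

Lemma expectation_fin (R : realType) (d : measure_display) (T : measurableType d)
  (P : probability T R) (I : finType) (W : T -> I) (g : I -> R) (pi : I -> R) :
  (forall i, measurable [set x | W x = i]) ->
  (forall i, P [set x | W x = i] = (pi i)%:E) ->
  \int[P]_x g (W x) = \sum_i pi i * g i.
Proof.
move=> mW HW; have PT : (P [set: T] < +oo)%E by rewrite probability_setT ltry.
have b i : bdsupp setT (fun x => \1_[set x | W x = i] x * g i).
  split=> //; first by apply: measurable_funM => //; exact: measurable_indic.
    exists `|g i| => x; rewrite normrM ler_piMl // indicE.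
    by case: (_ \in _); rewrite ?normr0 ?normr1.
  by move=> x [].
transitivity (\int[P]_x \sum_i \1_[set x | W x = i] x * g i).
  apply: eq_Rintegral => x _; rewrite (bigD1 (W x)) //= indicE mem_set // mul1r.
  rewrite big1 ?addr0 // => i iW; rewrite indicE memNset ?mul0r //=.
  by move/esym/eqP; apply/negP.
have [_ ->] := bdsupp_Rintegral_sum (mu := P) (index_enum I) measurableT PT b.
apply: eq_bigr => i _; rewrite RintegralZr //; last first.
  apply: (bdsupp_integrable measurableT PT); split=> // [|x []] //.
  by exists 1 => x; rewrite indicE; case: (_ \in _); rewrite ?normr0 ?normr1.
rewrite /Rintegral integral_indic // setIT -[pi i]/(fine (pi i)%:E).
by congr (fine _ * _); exact: HW.
Qed.

Lemma measurable_fun_boolR (R : realType) (d : measure_display) (T : measurableType d)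
  (f : T -> bool) : measurable_fun setT f -> measurable_fun setT (fun x => (f x)%:R : R).
Proof.
move=> mf; rewrite [X in measurable_fun _ X](_ : _ = \1_[set x | f x]); last first.
  by apply/funext => x; rewrite indicE; congr (nat_of_bool _)%:R; apply/idP/idP; rewrite inE.
apply: measurable_indic.
rewrite [X in measurable X](_ : _ = setT `&` f @^-1` [set true]); last first.
  by apply/seteqP; split=> x /=; [move=> ->|case].
exact: mf.
Qed.

Section Moments.
Variables (R : realType) (S : finType) (dO : measure_display) (Om : measurableType dO).
Variables (P : probability Om R) (X : R -> Om -> S).
Variables (nu : R -> S -> R) (p : R -> S -> S -> R).
Hypothesis mX : forall t zeta, measurable [set om | X t om = zeta].
Hypothesis rcX : forall om t, 0 <= t -> exists2 del : R, 0 < del &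
  forall s, t <= s < t + del -> X s om = X t om.
Hypothesis law1 : forall t eta, 0 <= t -> P [set om | X t om = eta] = (nu t eta)%:E.
Hypothesis law2 : forall s t eta zeta, 0 <= s -> s <= t ->
  P [set om | X s om = eta /\ X t om = zeta] = (nu s eta * p (t - s) eta zeta)%:E.
Hypothesis nu0 : forall t eta, 0 <= t -> 0 <= nu t eta.
Hypothesis nu1 : forall t, 0 <= t -> \sum_eta nu t eta = 1.
Hypothesis p01 : forall t eta zeta, 0 <= t -> 0 <= p t eta zeta <= 1.
Hypothesis mnu : forall eta, measurable_fun setT (fun t => nu t eta).
Hypothesis mp : forall eta zeta, measurable_fun setT (fun t => p t eta zeta).
Variables (a b : R).
Hypotheses (a0 : 0 <= a) (ab : a <= b).
Local Notation D := [set` `[a, b]%R].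
Local Notation lam := (@lebesgue_measure R).
Variables (V : R -> S -> R) (B : R).
Hypothesis B0 : 0 <= B.
Hypothesis mV : forall eta, measurable_fun D (fun t => V t eta).
Hypothesis VB : forall t eta, D t -> `|V t eta| <= B.

Let F := path_fun X (tcut a b V).
Let mD : measurable D. Proof. exact: measurable_itv. Qed.
Let lamD : lam D = (b - a)%:E.
Proof. by rewrite lebesgue_measure_itv /= lte_fin; case: ltP => // ba; rewrite (le_anti (introT andP (conj ab ba))) subrr. Qed.
Let fD : (lam D < +oo)%E. Proof. by rewrite lamD ltry. Qed.
Let fP : (P setT < +oo)%E. Proof. by rewrite probability_setT ltry. Qed.
Let bF : bdsupp (D `*` [set: Om]) F.
Proof. exact: (path_fun_bdsupp mX rcX B0 mV VB). Qed.

Lemma D_ge0 t : D t -> 0 <= t.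
Proof. by rewrite /= in_itv /= => /andP[ta _]; exact: le_trans ta. Qed.

Lemma path_tcutE t om : D t -> F (t, om) = V t (X t om).
Proof.
by move=> Dt; rewrite /F path_funE ?D_ge0 // /tcut indicE mem_set // mulr1.
Qed.

Lemma path_tcut0 t om : ~ D t -> F (t, om) = 0.
Proof. by move=> Dt; have [_ _ ->] // := bF; case. Qed.

Lemma path_integralE om :
  (\int[lam]_(t in D) (V t (X t om))%:E = (\int[lam]_t F (t, om))%:E)%E.
Proof.
rewrite (section2_EFin (m1 := lam) mD fD bF) integral_mkcond; apply: eq_integral => t _.
rewrite /patch; case: ifPn => [|]; first by rewrite inE => Dt; rewrite path_tcutE.
by rewrite notin_setE => /path_tcut0 ->.
Qed.

Lemma path_integral_measurable :
  measurable_fun setT (fun om => \int[lam]_(t in D) (V t (X t om))%:E)%E.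
Proof.
rewrite [X in measurable_fun _ X](_ : _ = fun om => (\int[lam]_t F (t, om))%:E); last first.
  by apply/funext => om; exact: path_integralE.
apply/measurable_EFinP.
by have [] := bdsupp_partial2 (m1 := lam) (m2 := P) mD measurableT fD fP bF.
Qed.

Lemma path_section_integrable om : lam.-integrable D (fun t => (V t (X t om))%:E).
Proof.
have H := bdsupp_integrable (mu := lam) mD fD (bdsupp_section2 bF om).
have H2 : lam.-integrable D (EFin \o (fun t => F (t, om))) by apply: integrableS H => //.
by apply: eq_integrable H2 => // t; rewrite inE => Dt; rewrite /= path_tcutE.
Qed.

Lemma first_moment :
  (\int[P]_om \int[lam]_(t in D) (V t (X t om))%:E =
   \int[lam]_(t in D) (\sum_eta nu t eta * V t eta)%:E)%E.
Proof.
under eq_integral do rewrite path_integralE.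
have bZ := bdsupp_partial2 (m1 := lam) (m2 := P) mD measurableT fD fP bF.
have := bdsupp_integrable (mu := P) measurableT fP bZ => iZ.
transitivity ((\int[P]_om \int[lam]_t F (t, om))%:E).
  by rewrite /Rintegral [RHS]fineK //; exact: integrable_fin_num.
rewrite -(bdsupp_Fubini (m1 := lam) (m2 := P) mD measurableT fD fP bF).
have bG := bdsupp_partial1 (m1 := lam) (m2 := P) mD measurableT fD fP bF.
rewrite [LHS]fineK; last by apply: integrable_fin_num => //; exact: (bdsupp_integrable (mu := lam) mD fD bG).
rewrite [RHS]integral_mkcond; apply: eq_integral => t _.
rewrite /patch; case: ifPn => [|].
  rewrite inE => Dt; congr EFin.
  under eq_Rintegral do rewrite path_tcutE //.
  by apply: expectation_fin => // eta; apply: law1; exact: D_ge0.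
rewrite notin_setE => Dt; congr EFin.
by rewrite /Rintegral integral0_eq // => om _; rewrite path_tcut0.
Qed.

Definition pair_kernel s t : R :=
  \sum_eta nu s eta * tcut a b V s eta * \sum_zeta p (t - s) eta zeta * tcut a b V t zeta.

Lemma tcutB t eta : `|tcut a b V t eta| <= B.
Proof.
rewrite /tcut indicE; case: (boolP (t \in D)) => [|_]; last by rewrite mulr0 normr0.
by rewrite inE mulr1 => /VB.
Qed.

Lemma tcutE t eta : D t -> tcut a b V t eta = V t eta.
Proof. by move=> Dt; rewrite /tcut indicE mem_set // mulr1. Qed.

Lemma tcut0 t eta : ~ D t -> tcut a b V t eta = 0.
Proof. by move=> Dt; rewrite /tcut indicE memNset // mulr0. Qed.

Lemma nu_le1 t eta : 0 <= t -> nu t eta <= 1.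
Proof.
move=> t0; rewrite -(nu1 t0) (bigD1 eta) //= lerDl.
by apply: sumr_ge0 => e _; exact: nu0.
Qed.

Lemma pair_kernelP s t : 0 <= s -> s <= t -> \int[P]_om (F (t, om) * F (s, om)) =
  pair_kernel s t.
Proof.
move=> s0 st; have t0 := le_trans s0 st.
pose W om := (X s om, X t om).
pose g (w : S * S) := tcut a b V s w.1 * tcut a b V t w.2.
transitivity (\int[P]_om g (W om)).
  apply: eq_Rintegral => om _; rewrite /g /W /= /F !path_funE //.
  by rewrite mulrC.
rewrite (@expectation_fin _ _ _ P _ W g (fun w => nu s w.1 * p (t - s) w.1 w.2)).
- rewrite -(pair_big xpredT xpredT (fun eta zeta => nu s eta * p (t - s) eta zeta * g (eta, zeta))) /=.
  apply: eq_bigr => eta _; rewrite mulr_sumr; apply: eq_bigr => zeta _.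
  by rewrite /g /=; ring.
- move=> [eta zeta]; rewrite (_ : [set x | _] = [set om | X s om = eta] `&` [set om | X t om = zeta]).
    exact: measurableI.
  by apply/seteqP; split=> om /=; rewrite /W; [move=> [-> ->]|move=> [-> ->]].
- move=> [eta zeta] /=; rewrite -law2 //; congr (P _).
  by apply/seteqP; split=> om /=; rewrite /W; [move=> [-> ->]|move=> [-> ->]].
Qed.

(* The square is the triangle s <= t together with the mirror image of s < t. *)
Definition ker_part (c : bool) (z : R * R) : R :=
  (if c then z.1 <= z.2 else z.1 < z.2)%:R * pair_kernel z.1 z.2.

Lemma ker_part_bdsupp c : bdsupp (D `*` D) (ker_part c).
Proof.
have mcut eta : measurable_fun setT (fun t => tcut a b V t eta) by exact: tcut_measurable.
split.
- apply: measurable_funM.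
    apply: measurable_fun_boolR; case: c.
      by apply: measurable_fun_ler; [exact: measurable_fst|exact: measurable_snd].
    by apply: measurable_fun_ltr; [exact: measurable_fst|exact: measurable_snd].
  apply: measurable_sum => eta; apply: measurable_funM.
    apply: measurable_funM.
      exact: (measurableT_comp (mnu eta) measurable_fst).
    exact: (measurableT_comp (mcut eta) measurable_fst).
  apply: measurable_sum => zeta; apply: measurable_funM.
    apply: (measurableT_comp (mp eta zeta)).
    by apply: measurable_funB; [exact: measurable_snd|exact: measurable_fst].
  exact: (measurableT_comp (mcut zeta) measurable_snd).
- exists (\sum_(eta : S) 1 * B * \sum_(zeta : S) 1 * B) => -[s t] /=.
  rewrite /ker_part /= normrM.
  have [st|st] := leP s t; last first.
    rewrite ltNge (ltW st) /= if_same normr0 mul0r.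
    by apply: sumr_ge0 => eta _; rewrite !mulr_ge0 //; apply: sumr_ge0 => zeta _; rewrite !mulr_ge0.
  apply: (@le_trans _ _ (`|pair_kernel s t|)).
    by rewrite ler_piMl //; case: (if c then _ else _); rewrite ?normr0 ?normr1.
  rewrite (le_trans (ler_norm_sum _ _ _)) //; apply: ler_sum => eta _.
  have [Ds|Ds] := pselect (D s); last first.
    rewrite tcut0 // mulr0 mul0r normr0 !mul1r mulr_ge0 //.
    by apply: sumr_ge0.
  have s0 := D_ge0 Ds.
  rewrite 2!normrM; apply: ler_pM => //; rewrite ?mulr_ge0 //.
    apply: ler_pM => //; last exact: tcutB.
    by rewrite ger0_norm ?nu0 // nu_le1.
  rewrite (le_trans (ler_norm_sum _ _ _)) //; apply: ler_sum => zeta _.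
  rewrite normrM; apply: ler_pM => //; last exact: tcutB.
  have /andP[p0 p1] := p01 eta zeta (etrans (subr_ge0 s t) st).
  by rewrite ger0_norm.
- move=> [s t] /= H; rewrite /ker_part /pair_kernel /= big1 ?mulr0 // => eta _.
  have [Ds|Ds] := pselect (D s); last by rewrite tcut0 // mulr0 mul0r.
  rewrite big1 ?mulr0 // => zeta _; rewrite tcut0 ?mulr0 // => Dt.
  by apply: H.
Qed.

Variable Phi : R.
Hypothesis Phi0 : 0 <= Phi.
Hypothesis HPhi : forall s eta, D s ->
  (\int[lam]_(t in [set` `[s, b]%R]) `|\sum_zeta p (t - s) eta zeta * V t zeta|%:E <= Phi%:E)%E.

(** Conditioning at time [s]: the factor [V s] is at most [B], the law at time [s] has mass 1, and
    what remains is the integral bounded by [Phi] uniformly in the state. *)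
Lemma ker_part_bound c s : `|\int[lam]_t ker_part c (s, t)| <= B * Phi.
Proof.
have [Ds|Ds] := pselect (D s); last first.
  have b0 := ker_part_bdsupp c.
  rewrite /Rintegral integral0_eq ?normr0 ?mulr_ge0 // => t _.
  by have [_ _ ->] // := b0; case.
have s0 := D_ge0 Ds.
pose psi eta t := (if c then s <= t else s < t)%:R * (\sum_zeta p (t - s) eta zeta * tcut a b V t zeta).
have mcut eta : measurable_fun setT (fun t => tcut a b V t eta) by exact: tcut_measurable.
have bpsi eta : bdsupp D (psi eta).
  split.
  - apply: measurable_funM.
      apply: measurable_fun_boolR; clear psi; case: c.
        by apply: measurable_fun_ler.
      by apply: measurable_fun_ltr.
    apply: measurable_sum => zeta; apply: measurable_funM; last exact: mcut.
    apply: (measurableT_comp (mp eta zeta)).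
    by apply: measurable_funB.
  - exists (\sum_(zeta : S) B) => t; rewrite normrM.
    have [st|st] := leP s t; last first.
      rewrite ltNge (ltW st) /= if_same normr0 mul0r.
      by apply: sumr_ge0 => eta' _.
    apply: (@le_trans _ _ (`|\sum_zeta p (t - s) eta zeta * tcut a b V t zeta|)).
      by rewrite ler_piMl //; case: (if c then _ else _); rewrite ?normr0 ?normr1.
    rewrite (le_trans (ler_norm_sum _ _ _)) //; apply: ler_sum => zeta _.
    rewrite normrM; apply: (@le_trans _ _ (1 * B)); last by rewrite mul1r.
    apply: ler_pM => //; last exact: tcutB.
    have /andP[p0 p1] := p01 eta zeta (etrans (subr_ge0 s t) st).
    by rewrite ger0_norm.
  - move=> t Dt; rewrite /psi big1 ?mulr0 // => zeta _.
    by rewrite tcut0 // mulr0.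
have E : \int[lam]_t ker_part c (s, t) =
   \sum_eta nu s eta * tcut a b V s eta * \int[lam]_t psi eta t.
  transitivity (\int[lam]_t \sum_eta (nu s eta * tcut a b V s eta) * psi eta t).
    apply: eq_Rintegral => t _; rewrite /ker_part /pair_kernel /= mulr_sumr.
    by apply: eq_bigr => eta _; rewrite /psi; ring.
  have bi eta : bdsupp D (fun t => (nu s eta * tcut a b V s eta) * psi eta t).
    have [m1 [C m2] m3] := bpsi eta; split.
    - by apply: measurable_funM.
    - exists (`|nu s eta * tcut a b V s eta| * C) => t.
      by rewrite normrM ler_wpM2l.
    - by move=> t /m3 ->; rewrite mulr0.
  have [_ ->] := bdsupp_Rintegral_sum (mu := lam) (index_enum S) mD fD bi.
  apply: eq_bigr => eta _; rewrite RintegralZl //.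
  exact: (bdsupp_integrable (mu := lam) mD fD (bpsi eta)).
rewrite E (le_trans (ler_norm_sum _ _ _)) //.
have -> : B * Phi = \sum_eta nu s eta * (B * Phi) by rewrite -mulr_suml nu1 // mul1r.
apply: ler_sum => eta _; rewrite -mulrA normrM ger0_norm ?nu0 // ler_wpM2l ?nu0 //.
rewrite normrM ler_pM //; first exact: tcutB.
have ipsi := bdsupp_integrable (mu := lam) mD fD (bpsi eta).
rewrite (le_trans (le_normr_Rintegral _ _)) //.
rewrite -lee_fin /Rintegral fineK; last first.
  by apply: integrable_fin_num => //; exact: integrable_norm.
(* The indicator in [psi] removes the times before [s] and [tcut] those after [b], leaving the
   interval of [HPhi]. *)
apply: le_trans (HPhi eta Ds).
rewrite [leRHS]integral_mkcond; apply: ge0_le_integral => //.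
- by apply/measurable_EFinP; apply: measurableT_comp => //; have [] := bpsi eta.
- apply/(measurable_restrictT _ _).1 => //.
  apply/measurable_EFinP; apply: measurableT_comp => //.
  apply: measurable_sum => zeta; apply: measurable_funM.
    apply: (measurableT_comp (mp eta zeta)).
    by apply: measurable_funB.
  apply: measurable_funS (mV zeta) => //.
  move=> t /=; rewrite !in_itv /= => /andP[st ->]; rewrite andbT.
  by move: Ds; rewrite /= in_itv /= => /andP[/le_trans + _]; apply.
- move=> t _; rewrite /patch; case: ifPn => [|].
    rewrite inE /= in_itv /= => /andP[st tb].
    have Dt : D t.
      rewrite /= in_itv /= tb andbT; apply: le_trans st.
      by move: Ds; rewrite /= in_itv /= => /andP[].
    rewrite lee_fin /psi /= normrM.
    under [X in _ * `|X|]eq_bigr do rewrite tcutE //.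
    by rewrite ler_piMl //; case: (if c then _ else _); rewrite ?normr0 ?normr1.
  rewrite notin_setE /= in_itv /= => /negP; rewrite negb_and -!ltNge => /orP[ts|bt].
    by rewrite /psi [s <= t]leNgt ts /= [s < t]ltNge (ltW ts) /= if_same mul0r normr0.
  rewrite /psi big1 ?mulr0 ?normr0 // => zeta _; rewrite tcut0 ?mulr0 //=.
  by rewrite in_itv /= => /andP[_]; rewrite leNgt bt.
Qed.

Let Z om := \int[lam]_t F (t, om).

(** One factor [Z] is expanded at a time, each followed by Fubini. For fixed [s] the times t >= s
    use the kernel at (s, t) and the times t < s the kernel at (t, s); a last exchange of integrals
    lets the earlier time always be the conditioning one. Each half of the square gives
    [(b - a) * B * Phi]. *)
Lemma second_moment : \int[P]_om (Z om * Z om) <= 2 * ((b - a) * B * Phi).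
Proof.
have bZ : bdsupp [set: Om] Z := bdsupp_partial2 (m1 := lam) (m2 := P) mD measurableT fD fP bF.
have iF om := bdsupp_integrable (mu := lam) mD fD (bdsupp_section2 bF om).
have bFZ : bdsupp (D `*` [set: Om]) (fun z => F z * Z z.2).
  apply: bdsuppM => //; have [m1 [C m2] m3] := bZ; split.
  - exact: (measurableT_comp m1 measurable_snd).
  - by exists C => z.
  - by move=> z [].
have -> : \int[P]_om (Z om * Z om) = \int[P]_om \int[lam]_s (F (s, om) * Z om).
  by apply: eq_Rintegral => om _; rewrite RintegralZr.
rewrite -(bdsupp_Fubini (m1 := lam) (m2 := P) mD measurableT fD fP bFZ) /=.
have E s : \int[P]_om (F (s, om) * Z om) =
   \int[lam]_t ker_part true (s, t) + \int[lam]_t ker_part false (t, s).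
  have bFF : bdsupp (D `*` [set: Om]) (fun z => F z * F (s, z.2)).
    apply: bdsuppM => //; have [m1 [C m2] m3] := bdsuppT (bdsupp_section1 bF s); split.
    - exact: (measurableT_comp m1 measurable_snd).
    - by exists C => z.
    - by move=> z [].
  have -> : \int[P]_om (F (s, om) * Z om) = \int[P]_om \int[lam]_t (F (t, om) * F (s, om)).
    by apply: eq_Rintegral => om _; rewrite RintegralZr // mulrC.
  rewrite -(bdsupp_Fubini (m1 := lam) (m2 := P) mD measurableT fD fP bFF) /=.
  have i1 := bdsupp_integrable (mu := lam) mD fD (bdsupp_section1 (ker_part_bdsupp true) s).
  have i2 := bdsupp_integrable (mu := lam) mD fD (bdsupp_section2 (ker_part_bdsupp false) s).
  rewrite -RintegralD //.
  apply: eq_Rintegral => t _.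
  have [[Ds Dt]|H] := pselect (D s /\ D t); last first.
    have [_ _ z1] := ker_part_bdsupp true; have [_ _ z2] := ker_part_bdsupp false.
    rewrite z1 ?z2 ?addr0 /=; [|by move=> [Dt Ds]; apply: H|by move=> [Ds Dt]; apply: H].
    rewrite /Rintegral integral0_eq // => om _.
    have [Ds|/path_tcut0 ->] := pselect (D s); last by rewrite mulr0.
    have [Dt|/path_tcut0 ->] := pselect (D t); last by rewrite mul0r.
    by case: H.
  have s0 := D_ge0 Ds; have t0 := D_ge0 Dt.
  rewrite /ker_part /=; have [st|ts] := leP s t.
    by rewrite pair_kernelP // mul0r addr0 mul1r.
  rewrite mul0r add0r mul1r -pair_kernelP //; last exact: ltW.
  by apply: eq_Rintegral => om _; rewrite mulrC.
under eq_Rintegral do rewrite E.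
have b1 := bdsupp_partial1 (m1 := lam) (m2 := lam) mD mD fD fD (ker_part_bdsupp true).
have b2 := bdsupp_partial2 (m1 := lam) (m2 := lam) mD mD fD fD (ker_part_bdsupp false).
have j1 := bdsupp_integrable (mu := lam) mD fD b1.
have j2 := bdsupp_integrable (mu := lam) mD fD b2.
rewrite RintegralD //.
rewrite -(bdsupp_Fubini (m1 := lam) (m2 := lam) mD mD fD fD (ker_part_bdsupp false)).
have b3 := bdsupp_partial1 (m1 := lam) (m2 := lam) mD mD fD fD (ker_part_bdsupp false).
have fl : fine (lam D) = b - a by rewrite lamD.
have H c : bdsupp D (fun s => \int[lam]_t ker_part c (s, t)) ->
    `|\int[lam]_s \int[lam]_t ker_part c (s, t)| <= B * Phi * (b - a).
  by move=> bc; rewrite -fl; apply: (bdsupp_Rintegral_le (mu := lam) mD fD bc); exact: ker_part_bound.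
have H1 := H true b1; have H2 := H false b3.
have -> : 2 * ((b - a) * B * Phi) = B * Phi * (b - a) + B * Phi * (b - a) by ring.
by apply: lerD; [exact: le_trans (ler_norm _) H1|exact: le_trans (ler_norm _) H2].
Qed.

(* |Z| <= q/2 + Z^2/(2q) and [second_moment]. *)
Lemma abs_moment q : 0 < q ->
  (\int[P]_om `| \int[lam]_(t in D) (V t (X t om))%:E | <= (q + (b - a) * B * Phi / q)%:E)%E.
Proof.
move=> q0.
have bZ : bdsupp [set: Om] Z := bdsupp_partial2 (m1 := lam) (m2 := P) mD measurableT fD fP bF.
under eq_integral do rewrite path_integralE.
have bnZ : bdsupp [set: Om] (fun om => `|Z om|).
  have [m1 [C m2] m3] := bZ; split; first exact: measurableT_comp.
    by exists C => om; rewrite normr_id.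
  by move=> om [].
have bZZ : bdsupp [set: Om] (fun om => Z om * Z om) by exact: bdsuppM.
have inZ := bdsupp_integrable (mu := P) measurableT fP bnZ.
have iZZ := bdsupp_integrable (mu := P) measurableT fP bZZ.
have -> : (\int[P]_om `|(\int[lam]_t F (t, om))%:E| = (\int[P]_om `|Z om|)%:E)%E.
  by rewrite /Rintegral fineK //; apply: integrable_fin_num.
rewrite lee_fin.
have bc : bdsupp [set: Om] (fun om => q / 2 + Z om * Z om * (2 * q)^-1).
  apply: bdsuppD; first by split=> //; [exists `|q / 2| | move=> ? []].
  by apply: bdsuppM => //; split=> //; [exists `|(2 * q)^-1| | move=> ? []].
have ic := bdsupp_integrable (mu := P) measurableT fP bc.
apply: (@le_trans _ _ (\int[P]_om (q / 2 + Z om * Z om * (2 * q)^-1))).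
  apply: le_Rintegral => // om _.
  have -> : Z om * Z om = `|Z om| ^+ 2 by rewrite -normrX ger0_norm ?sqr_ge0 // expr2.
  move: `|Z om| => z; rewrite -subr_ge0.
  have -> : q / 2 + z ^+ 2 * (2 * q)^-1 - z = (q - z) ^+ 2 / (2 * q) by field; rewrite gt_eqF.
  by rewrite divr_ge0 ?sqr_ge0 // mulr_ge0 // ltW.
have bq : bdsupp [set: Om] (fun=> q / 2) by split=> //; [exists `|q / 2| | move=> ? []].
rewrite RintegralD //; last first.
- apply: (bdsupp_integrable measurableT fP); apply: bdsuppM => //.
  by split=> //; [exists `|(2 * q)^-1| | move=> ? []].
- exact: (bdsupp_integrable (mu := P) measurableT fP).
have cst : \int[P]_om (q / 2) = q / 2.
  have -> : \int[P]_om (q / 2) = q / 2 * fine (P setT) by exact: Rintegral_cst.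
  by rewrite probability_setT /= mulr1.
rewrite cst RintegralZr //.
have := second_moment; set E := \int[P]_om _ => HE.
apply: (@le_trans _ _ (q / 2 + 2 * ((b - a) * B * Phi) * (2 * q)^-1)).
  by rewrite lerD2l ler_wpM2r // invr_ge0 mulr_ge0 // ltW.
have -> : 2 * ((b - a) * B * Phi) * (2 * q)^-1 = (b - a) * B * Phi / q.
  by field; rewrite gt_eqF.
by rewrite lerD2r; lra.
Qed.

End Moments.

(** * Time-integrated entropy production *)

(** Only the upper bound [dG] has to be continuous: [f] is merely measurable, as are the time
    integrands built from [u] and [a]. The degenerate interval is separate because the fundamental
    theorem asks for a < b. *)
Lemma ftc_upper_bound (R : realType) (f G dG : R -> R) (a b : R) :
  a <= b -> measurable_fun `[a, b] f ->
  (forall t, a <= t <= b -> is_derive t (1 : R) G (dG t)) ->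
  (forall t, a <= t <= b -> {for t, continuous dG}) ->
  (forall t, a <= t <= b -> 0 <= f t <= dG t) ->
  (\int[lebesgue_measure]_(t in `[a, b]) (f t)%:E <= (G b - G a)%:E)%E.
Proof.
move=> ab mf dGd cdG fb; have [eab|nab] := eqVneq a b.
  by rewrite -eab set_itv1 integral_set1 subrr.
have ab' : a < b by rewrite lt_neqAle nab.
have inab t : t \in `[a, b] -> a <= t <= b by rewrite in_itv.
have cw : {within `[a, b], continuous dG}.
  apply: continuous_in_subspaceT => t; rewrite inE /= => /inab; exact: cdG.
have cG t : a <= t <= b -> {for t, continuous G}.
  by move=> tab; apply: differentiable_continuous; apply/derivable1_diffP; have [] := dGd t tab.
have dGo : derivable_oo_LRcontinuous G a b.
  split.
  - by move=> t; rewrite in_itv /= => /andP[ta tb]; have [] := dGd t _; rewrite ?ltW.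
  - by apply: cvg_at_right_filter; apply: cG; rewrite lexx.
  - by apply: cvg_at_left_filter; apply: cG; rewrite lexx andbT.
have dGE : {in `]a, b[, derive1 G =1 dG}.
  move=> t; rewrite in_itv /= => /andP[ta tb].
  have H : is_derive t (1 : R) G (dG t) by apply: dGd; rewrite !ltW.
  by rewrite derive1E; exact: derive_val.
rewrite EFinB -(continuous_FTC2 ab' cw dGo dGE).
apply: ge0_le_integral => //.
- by move=> t /= /inab /fb /andP[f0 _]; rewrite lee_fin.
- exact/measurable_EFinP.
- by apply/measurable_EFinP; exact: subspace_continuous_measurable_fun.
- by move=> t /= /inab /fb /andP[_ fG]; rewrite lee_fin.
Qed.

Lemma continuous_sum_seq (R : realType) (I : Type) (r : seq I) (f : I -> R -> R) (t : R) :
  (forall i, {for t, continuous (f i)}) ->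
  {for t, continuous (fun s => \sum_(i <- r) f i s)}.
Proof.
move=> H; elim: r => [|i r IH].
  under [X in {for t, continuous X}]funext do rewrite big_nil.
  exact: cst_continuous.
under [X in {for t, continuous X}]funext do rewrite big_cons.
exact: continuousD.
Qed.

(** Bonds and sites together index the jumps, which puts [LN] in the form of a single finite sum of
    rates times increments required by the semigroup section. *)
Definition gen_move d N (i : (site d N * 'I_d) + site d N) (eta : conf d N) : conf d N :=
  match i with inl q => tswap eta q.1 (q.1 + tunit N q.2) | inr x => tflip eta x end.

Definition gen_rate (R : realType) d N (K : R) (c : 'I_d -> zconf d -> R) (cg : zconf d -> R)
  (i : (site d N * 'I_d) + site d N) (eta : conf d N) : R :=
  match i with inl q => N%:R ^+ 2 * tloc (c q.2) q.1 eta | inr x => K * tloc cg x eta end.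

Lemma LN_moves (R : realType) d N (K : R) c (cg : zconf d -> R) (g : conf d N -> R) eta :
  LN K c cg g eta = \sum_i gen_rate K c cg i eta * (g (gen_move i eta) - g eta).
Proof.
rewrite big_sumType /= /LN; congr (_ + _).
  rewrite pair_big mulr_sumr /=; apply: eq_bigr => q _; rewrite mulrA; reflexivity.
by rewrite mulr_sumr; apply: eq_bigr => x _; rewrite mulrA.
Qed.

Section EntropyTime.
Variables (R : realType) (d N : nat) (K cmin Cg : R).
Variables (c : 'I_d -> zconf d -> R) (cg : zconf d -> R).
Hypotheses (N0 : (0 < N)%N) (K0 : 0 <= K) (cmin0 : 0 < cmin).
Hypothesis cinv : forall i (x : site d N) eta,
  tloc (c i) x (tswap eta x (x + tunit N i)) = tloc (c i) x eta.
Hypothesis cmin_le : forall i xi, cmin <= c i xi.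
Hypothesis cgb : forall xi, 0 <= cg xi <= Cg.
Variable p : R -> conf d N -> conf d N -> R.
Hypothesis trp : is_transition (LN K c cg) p.
Local Notation T := (#|site d N|%:R : R).
Local Notation L := (@LN R d N K c cg).

Let p0 := trp.1.
Let pd zeta : backward L (fun t eta => p t eta zeta).
Proof. by move=> t eta; exact: trp.2. Qed.
Let LE (g : conf d N -> R) eta := LN_moves K c cg g eta.
Let r0 i (eta : conf d N) : 0 <= gen_rate K c cg i eta.
Proof.
case: i => [q|x] /=; rewrite mulr_ge0 // ?sqr_ge0 //.
  exact: le_trans (ltW cmin0) (cmin_le _ _).
by have /andP[] := cgb (ext (tshift x eta)).
Qed.

(** The entropy inequality against the uniform law with F = 0 bounds the entropy below by -ln(2^n),
    and ln 2 <= 1. Here [T] abbreviates the number n of sites. *)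
Lemma entropy_lower (m : conf d N -> R) : (forall eta, 0 <= m eta) -> \sum_eta m eta = 1 ->
  - T <= \sum_eta m eta * ln (m eta).
Proof.
move=> m0 m1; pose n : R := #|{: conf d N}|%:R.
have n0 : 0 < n by rewrite ltr0n; apply/card_gt0P; exists [ffun=> true].
have n0' : 0 < n^-1 by rewrite invr_gt0.
have := @entropy_inequality R _ m (fun=> n^-1) (fun=> 0) 0 m0 m1 (fun=> n0').
have -> : \sum_(i : conf d N) n^-1 * expR 0 = expR 0 :> R.
  by rewrite expR0 mulr1 sumr_const -mulr_natr mulVf // gt_eqF.
rewrite lexx => /(_ isT); rewrite big1 => [|i _]; last by rewrite mulr0.
rewrite addr0 => H.
have lnn : ln n <= T.
  rewrite /n card_ffun card_bool natrX lnXn // -[leRHS]mul1r -[_ *+ _]mulr_natr ler_wpM2r //.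
  by rewrite -ler_expR lnK ?posrE //; have := expR_ge1Dx (1 : R); lra.
have : \sum_i m i * ln (m i / n^-1) = \sum_i m i * ln (m i) + ln n.
  rewrite -[ln n]mul1r -m1 mulr_suml -big_split /=; apply: eq_bigr => i _.
  rewrite invrK; have [->|mi] := eqVneq (m i) 0; first by rewrite !mul0r addr0.
  by rewrite lnM ?posrE // ?mulrDr // lt_neqAle eq_sym mi m0.
move: H lnn; lra.
Qed.

Lemma entropy_upper (m : conf d N -> R) : (forall eta, 0 <= m eta) -> \sum_eta m eta = 1 ->
  \sum_eta m eta * ln (m eta) <= 0.
Proof.
move=> m0 m1; apply: sumr_le0 => eta _; rewrite mulr_ge0_le0 // ln_le0 //.
by rewrite -m1 (bigD1 eta) //= lerDl sumr_ge0.
Qed.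

(** The entropy production bound makes [f] at most the derivative of an affine function of time
    minus a multiple of the entropy. As the entropy stays between -n and 0, its total change costs
    at most n, whatever the initial law. *)
Lemma law_integral_bound (m0 : conf d N -> R) (f : R -> R) (k1 k2 s b : R) :
  (forall eta, 0 < m0 eta) -> \sum_eta m0 eta = 1 -> s <= b -> 0 <= k1 ->
  measurable_fun `[s, b] f ->
  (forall t, s <= t <= b -> 0 <= f t <= k1 * xtot (law p m0 (t - s)) + k2) ->
  (\int[lebesgue_measure]_(t in `[s, b]) (f t)%:E <=
   (k1 / (N%:R * cmin) * (T + (K * Cg + cmin * d%:R) * T * (b - s)) + k2 * (b - s))%:E)%E.
Proof.
move=> m0p m01 sb k10 mf fb.
have N0' : 0 < N%:R :> R by rewrite ltr0n.
have Nc : 0 < N%:R * cmin by rewrite mulr_gt0.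
have m0g eta : 0 <= m0 eta by exact: ltW.
pose m := law p m0.
pose S t := \sum_eta m t eta * ln (m t eta).
pose dS t := \sum_xi m t xi * L (fun e => ln (m t e)) xi.
set k3 := k1 / (N%:R * cmin); set A := (K * Cg + cmin * d%:R) * T.
have k30 : 0 <= k3 by rewrite divr_ge0 // ltW.
pose G t := - k3 * S (t - s) + (k3 * A + k2) * t.
pose dG t := - k3 * dS (t - s) + (k3 * A + k2).
have mpos t eta : 0 <= t -> 0 < m t eta.
  exact: (law_gt0 r0 LE p0 pd m0g m0p).
have msum t : 0 <= t -> \sum_eta m t eta = 1.
  exact: (law_sum1 r0 LE p0 pd m01).
have mcont eta : continuous (fun t => m t eta) by exact: (law_continuous (m0 := m0) pd).
have dSd (t : R) : 0 <= t -> is_derive t (1 : R) S (dS t).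
  exact: (entropy_derive r0 LE p0 pd m0g m0p).
apply: le_trans (@ftc_upper_bound R f G dG s b sb mf _ _ _) _.
- move=> t /andP[st _].
  have ts : 0 <= t - s by rewrite subr_ge0.
  have d1 := dSd _ ts.
  have d2 : is_derive t (1 : R) (fun t => t - s) 1 by apply: is_derive_eq; rewrite subr0.
  have d3 := @is_derive1_comp R S (fun t => t - s) t _ _ d1 d2.
  rewrite mulr1 in d3.
  have d4 : is_derive t (1 : R) (fun t => - k3 * (S (t - s))) (- k3 * dS (t - s)).
    exact: (is_deriveZ (- k3) d3).
  have d5 : is_derive t (1 : R) (fun t => (k3 * A + k2) * t) (k3 * A + k2).
    by apply: is_derive_eq; rewrite -[LHS]/(_ * _) mulr1.
  exact: (is_deriveD d4 d5).
- move=> t /andP[st _].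
  have ts : 0 <= t - s by rewrite subr_ge0.
  have cs : {for t - s, continuous dS}.
    apply: continuous_sum_seq => xi; apply: continuousM; first exact: mcont.
    under [X in {for _, continuous X}]funext do rewrite LE.
    apply: continuous_sum_seq => i; apply: continuousM; first exact: cst_continuous.
    apply: continuousB.
      apply: continuous_comp; first exact: mcont.
      by apply: continuous_ln; exact: mpos.
    apply: continuous_comp; first exact: mcont.
    by apply: continuous_ln; exact: mpos.
  apply: continuousD; last exact: cst_continuous.
  apply: continuousM; first exact: cst_continuous.
  apply: (@continuous_comp _ _ _ (fun t => t - s) dS) => //.
  by apply: continuousB; [move=> ?; exact: cvg_id|exact: cst_continuous].
- move=> t tsb; have /andP[f0 fk] := fb t tsb; have /andP[st _] := tsb.
  have ts : 0 <= t - s by rewrite subr_ge0.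
  rewrite f0 (le_trans fk) // /dG.
  have := @entropy_production R d N K cmin Cg c cg (m (t - s)) N0 K0 cmin0 cinv cmin_le cgb.
  move=> /(_ (fun eta => mpos _ eta ts) (msum _ ts)); rewrite -/(dS _) -/A => H.
  rewrite addrA lerD2r.
  have -> : k1 = k3 * (N%:R * cmin) by rewrite /k3 divfK // gt_eqF.
  rewrite -mulrA; apply: le_trans (ler_wpM2l k30 H) _.
  by rewrite mulrDr mulNr mulrN.
- rewrite lee_fin /G subrr.
  have bs : 0 <= b - s by rewrite subr_ge0.
  have H1 := entropy_lower (fun eta => ltW (mpos (b - s) eta bs)) (msum _ bs).
  have H2 := entropy_upper (fun eta => ltW (mpos 0 eta (lexx 0))) (msum _ (lexx 0)).
  have H3 : S 0 - S (b - s) <= T by rewrite /S; move: H1 H2; lra.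
  have {H3}H4 := ler_wpM2l k30 H3.
  rewrite -/A; move: H4; lra.
Qed.

(* The factor 3 comes from delta = 2 m1 - unif, where m1 is the positive law half point
   mass, half uniform, to which [law_integral_bound] applies. *)
Lemma trans_integral_bound (V : R -> conf d N -> R) (k1 k2 s b : R) eta :
  s <= b -> 0 <= k1 -> (forall zeta, measurable_fun `[s, b] (fun t => V t zeta)) ->
  (forall (m : conf d N -> R) t, (forall e, 0 <= m e) -> \sum_e m e = 1 -> s <= t <= b ->
     `|\sum_e m e * V t e| <= k1 * xtot m + k2) ->
  (\int[lebesgue_measure]_(t in `[s, b]) `|\sum_zeta p (t - s) eta zeta * V t zeta|%:E <=
   (3 * (k1 / (N%:R * cmin) * (T + (K * Cg + cmin * d%:R) * T * (b - s)) + k2 * (b - s)))%:E)%E.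
Proof.
move=> sb k10 mV Vb.
set bnd := k1 / _ * _ + _.
pose n : R := #|{: conf d N}|%:R.
have n0 : 0 < n by rewrite ltr0n; apply/card_gt0P; exists [ffun=> true].
pose un (e : conf d N) := n^-1.
pose m1 e := (2^-1 * (e == eta)%:R + 2^-1 * un e).
have un0 e : 0 < un e by rewrite invr_gt0.
have un1 : \sum_e un e = 1 by rewrite sumr_const -mulr_natr mulVf // gt_eqF.
have m10 e : 0 < m1 e by rewrite ltr_wpDl ?mulr_ge0 // mulr_gt0.
have m11 : \sum_e m1 e = 1.
  have d1 : \sum_e (e == eta)%:R = 1 :> R.
    by rewrite (bigD1 eta) //= eqxx big1 ?addr0 // => e /negbTE ->.
  by rewrite big_split /= -!mulr_sumr un1 d1; lra.
have pc zeta : continuous (fun t => p t eta zeta) by exact: (is_derive_continuous (fun t => trp.2 t eta zeta)).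
have ab0 m2 : (forall e, 0 < m2 e) -> \sum_e m2 e = 1 ->
   measurable_fun `[s, b] (fun t => `|\sum_zeta law p m2 (t - s) zeta * V t zeta|) /\
   (\int[lebesgue_measure]_(t in `[s, b]) `|\sum_zeta law p m2 (t - s) zeta * V t zeta|%:E <= bnd%:E)%E.
  move=> m2p m21.
  have mf : measurable_fun `[s, b] (fun t => `|\sum_zeta law p m2 (t - s) zeta * V t zeta|).
    apply: measurableT_comp => //; apply: measurable_sum => zeta; apply: measurable_funM => //.
    apply: measurable_funTS.
    have ml : measurable_fun setT (fun t => law p m2 t zeta).
      by apply: continuous_measurable_fun; exact: (law_continuous (m0 := m2) pd).
    by apply: (measurableT_comp ml); exact: measurable_funB.
  split=> //; apply: (law_integral_bound m2p m21 sb k10 mf) => t /andP[st tb].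
  have ts : 0 <= t - s by rewrite subr_ge0.
  rewrite normr_ge0 /=; apply: Vb; rewrite ?st ?tb //.
    by move=> e; exact: (law_ge0 r0 LE p0 pd (fun e => ltW (m2p e))).
  exact: (law_sum1 r0 LE p0 pd m21).
have [mf1 H1] := ab0 m1 m10 m11.
have [mf2 H2] := ab0 un un0 un1.
pose f1 t := `|\sum_zeta law p m1 (t - s) zeta * V t zeta|.
pose f2 t := `|\sum_zeta law p un (t - s) zeta * V t zeta|.
apply: (@le_trans _ _ (\int[lebesgue_measure]_(t in `[s, b]) (2 * f1 t + f2 t)%:E)%E).
  apply: ge0_le_integral => //.
  - apply/measurable_EFinP; apply: measurableT_comp => //; apply: measurable_sum => zeta.
    apply: measurable_funM; last exact: mV.
    apply: measurable_funTS.
    have ml : measurable_fun setT (fun t => p t eta zeta) by exact: continuous_measurable_fun.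
    by apply: (measurableT_comp ml); exact: measurable_funB.
  - by apply/measurable_EFinP; apply: (measurable_realfun.measurable_funD (f := fun t => 2 * f1 t) (g := f2)) => //; exact: measurable_funM.
  - move=> t _; rewrite lee_fin /f1 /f2.
    have -> : \sum_zeta p (t - s) eta zeta * V t zeta =
      2 * (\sum_zeta law p m1 (t - s) zeta * V t zeta) - \sum_zeta law p un (t - s) zeta * V t zeta.
      rewrite mulr_sumr -sumrB; apply: eq_bigr => zeta _.
      rewrite {1}/law /m1; under eq_bigr do rewrite mulrDl.
      rewrite big_split /= (bigD1 eta) //= eqxx mulr1 [X in _ + X + _]big1 ?addr0 => [|e /negbTE ->]; last first.
        by rewrite mulr0 mul0r.
      have -> : \sum_e 2^-1 * un e * p (t - s) e zeta = 2^-1 * law p un (t - s) zeta.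
        by rewrite /law mulr_sumr; apply: eq_bigr => e _; rewrite mulrA.
      by field.
    by rewrite (le_trans (ler_normB _ _)) // normrM ger0_norm.
under eq_integral do rewrite EFinD EFinM.
rewrite ge0_integralD //; last 4 first.
- by move=> t _; apply: mule_ge0; rewrite lee_fin // /f1 normr_ge0.
- by apply/measurable_EFinP; exact: measurable_funM.
- by move=> t _; rewrite lee_fin /f2 normr_ge0.
- exact/measurable_EFinP.
rewrite ge0_integralZl_EFin //; last 2 first.
- by move=> t _; rewrite lee_fin /f1 normr_ge0.
- exact/measurable_EFinP.
have -> : 3 * bnd = 2 * bnd + bnd by ring.
rewrite (_ : (2 * bnd + bnd)%:E = (2%:E * bnd%:E + bnd%:E)%E) //.
by apply: leeD => //; apply: lee_wpmul2l => //; rewrite lee_fin.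
Qed.

End EntropyTime.

(** * The singular weight in time *)

(** Monotone convergence along closed subintervals exhausting the open one. *)
Lemma improper_integral_le (R : realType) (f : R -> R) (a b M : R) :
  a < b -> measurable_fun `]a, b[ f -> (forall t, a < t < b -> 0 <= f t) ->
  (forall a' b', a < a' -> a' <= b' -> b' < b ->
    (\int[lebesgue_measure]_(t in `[a', b']) (f t)%:E <= M%:E)%E) ->
  (\int[lebesgue_measure]_(t in `]a, b[) (f t)%:E <= M%:E)%E.
Proof.
move=> ab mf f0 H; have ba : 0 < b - a by rewrite subr_gt0.
(* The denominator starts at 2 so that even the first subinterval is nonempty. *)
pose e (n : nat) : R := (b - a) / n.+2%:R.
have e0 n : 0 < e n by rewrite divr_gt0.
have e2 n : e n <= (b - a) / 2.
  by rewrite ler_wpM2l ?(ltW ba) // lef_pV2 ?posrE // ler_nat.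
have eh m n : (m <= n)%N -> e n <= e m.
  by move=> mn; rewrite ler_wpM2l ?(ltW ba) // lef_pV2 ?posrE // ler_nat.
pose F (n : nat) : set R := [set` `[a + e n, b - e n]%R].
have Fsub n : F n `<=` [set` `]a, b[%R].
  by move=> t; rewrite /F /= !in_itv /= => /andP[t1 t2]; have := e0 n; lra.
have FU : \bigcup_n F n = [set` `]a, b[%R].
  apply/seteqP; split=> [t [n _ /Fsub //]|t] /=; rewrite in_itv /= => /andP[at_ tb].
  pose g := Num.min (t - a) (b - t).
  have g0 : 0 < g by rewrite lt_min !subr_gt0 at_.
  exists (Num.truncn ((b - a) / g)) => //; rewrite /F /= in_itv /=.
  set n := Num.truncn _.
  have q0 : 0 <= (b - a) / g by rewrite divr_ge0 // ltW.
  have /andP[_ h] := truncn_itv q0.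
  have eg : e n <= g.
    rewrite /e ler_pdivrMr // mulrC -ler_pdivrMr // (le_trans (ltW h)) // ler_nat //.
  have g1 : g <= t - a by rewrite ge_min lexx.
  have g2 : g <= b - t by rewrite ge_min lexx orbT.
  by apply/andP; split; lra.
have ndF : {homo F : n m / (n <= m)%N >-> (n <= m)%O}.
  move=> n m nm; apply/subsetPset => t; rewrite /F /= !in_itv /= => /andP[t1 t2].
  by have := eh _ _ nm; lra.
have mF n : measurable (F n) by exact: measurable_itv.
have mFf n : measurable_fun (F n) (fun t => (f t)%:E).
  by apply/measurable_EFinP; apply: measurable_funS mf => //; exact: measurable_itv.
have Ff0 n t : F n t -> (0 <= (f t)%:E)%E.
  by move=> /Fsub; rewrite /= in_itv /= lee_fin => /f0.
have := ge0_nondecreasing_set_cvg_integral (mu := lebesgue_measure) ndF mF mFf Ff0.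
rewrite FU => cv; rewrite -(cvg_lim _ cv) //.
apply: lime_le; first by apply/cvg_ex; eexists; exact: cv.
apply: nearW => n; apply: H.
- by have := e0 n; lra.
- by have := e2 n; lra.
- by have := e0 n; lra.
Qed.

Lemma powR_int_bound (R : realType) (k a b : R) : 0 <= k < 1 -> 0 < a -> a <= b ->
  (\int[lebesgue_measure]_(t in `[a, b]) (t `^ (- k))%:E <= (b `^ (1 - k) / (1 - k))%:E)%E.
Proof.
move=> /andP[k0 k1] a0 ab; have k1' : 0 < 1 - k by rewrite subr_gt0.
pose G (t : R) := t `^ (1 - k) / (1 - k).
pose g (t : R) := t `^ (- k).
apply: le_trans (@ftc_upper_bound R g G g a b ab _ _ _ _) _.
- by apply: measurable_funTS; exact: measurable_powR.
- move=> t /andP[at_ _]; have t0 : 0 < t := lt_le_trans a0 at_.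
  have H := is_derive1_powR (1 - k) t0.
  have := is_deriveZ ((1 - k)^-1) H.
  rewrite -[_ *: _]/(_ * _) mulrA mulVf ?gt_eqF // mul1r.
  have -> : 1 - k - 1 = - k by ring.
  congr (is_derive _ _ _ _); apply/funext => x; rewrite /G mulrC; reflexivity.
- move=> t /andP[at_ _]; have t0 : 0 < t := lt_le_trans a0 at_.
  have [H _] := is_derive1_powR (- k) t0.
  by apply: differentiable_continuous; apply/derivable1_diffP.
- by move=> t _; rewrite powR_ge0 lexx.
- rewrite lee_fin /G lerBlDr lerDl divr_ge0 ?powR_ge0 // ltW //.
Qed.

Lemma is_derive_reflect (R : realType) (T t : R) : is_derive t (1 : R) (fun t => T - t) (-1).
Proof.
have := is_deriveB (is_derive_cst T t (1 : R)) (is_derive_id t (1 : R)).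
by rewrite sub0r.
Qed.

Lemma powR_int_bound_refl (R : realType) (k T a b : R) : 0 <= k < 1 -> b < T -> a <= b ->
  (\int[lebesgue_measure]_(t in `[a, b]) ((T - t) `^ (- k))%:E <= ((T - a) `^ (1 - k) / (1 - k))%:E)%E.
Proof.
move=> /andP[k0 k1] bT ab; have k1' : 0 < 1 - k by rewrite subr_gt0.
pose G (t : R) := - ((T - t) `^ (1 - k) / (1 - k)).
pose g (t : R) := (T - t) `^ (- k).
apply: le_trans (@ftc_upper_bound R g G g a b ab _ _ _ _) _.
- apply: measurable_funTS; apply: (measurableT_comp (measurable_powR _)).
  exact: measurable_funB.
- move=> t /andP[_ tb]; have t0 : 0 < T - t by rewrite subr_gt0 (le_lt_trans tb).
  have H := is_derive1_powR (1 - k) t0.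
  have d2 := is_derive_reflect T t.
  have d3 := @is_derive1_comp R (fun x : R => x `^ (1 - k)) (fun t => T - t) t _ _ H d2.
  have := is_deriveZ (- (1 - k)^-1) d3.
  have -> : 1 - k - 1 = - k by ring.
  rewrite -[_ *: _]/(_ * _).
  have -> : - (1 - k)^-1 * ((1 - k) * (T - t) `^ (- k) * -1) = g t.
    by rewrite /g; field; rewrite gt_eqF.
  congr (is_derive _ _ _ _); apply/funext => x.
  transitivity (- (1 - k)^-1 * (T - x) `^ (1 - k)); first by [].
  by rewrite /G mulrC mulrN.
- move=> t /andP[_ tb]; have t0 : 0 < T - t by rewrite subr_gt0 (le_lt_trans tb).
  have H := is_derive1_powR (- k) t0.
  have d2 := is_derive_reflect T t.
  have [d3 _] := @is_derive1_comp R (fun x : R => x `^ (- k)) (fun t => T - t) t _ _ H d2.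
  by apply: differentiable_continuous; apply/derivable1_diffP.
- by move=> t _; rewrite powR_ge0 lexx.
- rewrite lee_fin /G opprK addrC lerBlDr lerDl divr_ge0 ?powR_ge0 // ltW //.
Qed.

(** Near one end of [0, T] the factor vanishing at the other end is at least T / 2, so the weight is
    at most a constant times a single power, integrable because k < 1. *)
Lemma end_weights (R : realType) (k T dl : R) : 0 <= k < 1 -> 0 < T -> 0 < dl -> dl <= T / 2 ->
  let w t := ((t * (T - t)) `^ k)^-1 in
  let M := (T / 2) `^ (- k) * (dl `^ (1 - k) / (1 - k)) in
  (\int[lebesgue_measure]_(t in `]0%R, dl[) (w t)%:E <= M%:E)%E /\
  (\int[lebesgue_measure]_(t in `](T - dl)%R, T[) (w t)%:E <= M%:E)%E.
Proof.
move=> k01 T0 d0 dT w M.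
have /andP[k0 k1] := k01.
have k1' : 0 < 1 - k by rewrite subr_gt0.
have mw D : measurable_fun D w.
  apply: measurable_funTS; rewrite [X in measurable_fun _ X](_ : _ = fun t => (t * (T - t)) `^ (- k)).
    apply: (measurableT_comp (measurable_powR _)).
    by apply: measurable_funM => //; exact: measurable_funB.
  by apply/funext => t; rewrite powRN.
have w0 t : 0 <= w t by rewrite invr_ge0 powR_ge0.
have T2 : 0 < T / 2 by rewrite divr_gt0.
have c0 : 0 <= (T / 2) `^ (- k) by rewrite powR_ge0.
have mono (x : R) : T / 2 <= x -> x `^ (- k) <= (T / 2) `^ (- k).
  move=> Tx; have x0 := lt_le_trans T2 Tx.
  by rewrite !powRN lef_pV2 ?posrE ?powR_gt0 // ge0_ler_powR // nnegrE ltW.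
have mono2 (x : R) : 0 <= x <= dl -> x `^ (1 - k) / (1 - k) <= dl `^ (1 - k) / (1 - k).
  move=> /andP[x0 xd]; rewrite ler_wpM2r ?invr_ge0 ?(ltW k1') // ge0_ler_powR ?nnegrE //; exact: ltW.
split; apply: improper_integral_le => //.
- move=> a b a0 ab bd.
  apply: (@le_trans _ _ (\int[lebesgue_measure]_(t in `[a, b]) ((T / 2) `^ (- k) * t `^ (- k))%:E)%E).
    apply: ge0_le_integral => //.
    + by move=> t _; rewrite lee_fin; exact: w0.
    + by apply/measurable_EFinP; exact: mw.
    + apply/measurable_EFinP; apply: measurable_funM => //; apply: measurable_funTS.
      exact: measurable_powR.
    + move=> t; rewrite /= in_itv /= => /andP[ta tb]; rewrite lee_fin /w -powRN.
      have t0 : 0 < t := lt_le_trans a0 ta.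
      have td : t <= dl := le_trans tb (ltW bd).
      have Tt : 0 <= T - t by lra.
      rewrite [leLHS]powRM ?(ltW t0) //.
      by rewrite [leLHS]mulrC; apply: ler_wpM2r; [exact: powR_ge0|apply: mono; lra].
  under eq_integral do rewrite EFinM.
  rewrite ge0_integralZl_EFin //; last 2 first.
  + by move=> t _; rewrite lee_fin powR_ge0.
  + by apply/measurable_EFinP; apply: measurable_funTS; exact: measurable_powR.
  rewrite /M EFinM lee_wpmul2l ?lee_fin // (le_trans (powR_int_bound k01 a0 ab)) // lee_fin.
  by apply: mono2; rewrite (ltW bd) andbT (le_trans (ltW a0)).
- lra.
- move=> a b a0 ab bd.
  apply: (@le_trans _ _ (\int[lebesgue_measure]_(t in `[a, b]) ((T / 2) `^ (- k) * (T - t) `^ (- k))%:E)%E).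
    apply: ge0_le_integral => //.
    + by move=> t _; rewrite lee_fin; exact: w0.
    + by apply/measurable_EFinP; exact: mw.
    + apply/measurable_EFinP; apply: measurable_funM => //; apply: measurable_funTS.
      by apply: (measurableT_comp (measurable_powR _)); exact: measurable_funB.
    + move=> t; rewrite /= in_itv /= => /andP[ta tb]; rewrite lee_fin /w -powRN.
      have t0 : 0 < T - t by rewrite subr_gt0 (le_lt_trans tb).
      have td : T / 2 <= t by lra.
      have t0' : 0 <= t by lra.
      rewrite [leLHS]powRM ?(ltW t0) //.
      by rewrite ler_wpM2r ?powR_ge0 // mono.
  under eq_integral do rewrite EFinM.
  rewrite ge0_integralZl_EFin //; last 2 first.
  + by move=> t _; rewrite lee_fin powR_ge0.
  + apply/measurable_EFinP; apply: measurable_funTS.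
    by apply: (measurableT_comp (measurable_powR _)); exact: measurable_funB.
  rewrite /M EFinM lee_wpmul2l ?lee_fin // (le_trans (powR_int_bound_refl k01 bd ab)) // lee_fin.
  by apply: mono2; lra.
Qed.

(** Follows from the definition of the integral as a supremum over simple functions below, so it
    serves for path functionals whose measurability has not been established. *)
Lemma ge0_le_integral_sup (R : realType) (d : measure_display) (T : measurableType d)
  (mu : {measure set T -> \bar R}) (f g : T -> \bar R) :
  (forall x, 0 <= f x)%E -> (forall x, f x <= g x)%E ->
  (\int[mu]_x f x <= \int[mu]_x g x)%E.
Proof.
move=> f0 fg; have g0 x : (0 <= g x)%E by exact: le_trans (fg x).
rewrite !ge0_integralTE //; apply: le_ereal_sup => _ [h hf <-]; exists h => // x.
exact: le_trans (hf x) (fg x).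
Qed.

(** * The bound for fixed size *)

Section MarkovProcess.
Variables (R : realType) (d N : nat) (dO : measure_display) (Om : measurableType dO).
Variables (P : probability Om R) (X : R -> Om -> conf d N) (mu : conf d N -> R).
Variable (p : R -> conf d N -> conf d N -> R).
Hypothesis HX : is_markov_process P X mu p.

Lemma markov_law1 t eta : 0 <= t -> P [set om | X t om = eta] = (law p mu t eta)%:E.
Proof.
move=> t0; have [_ _ H] := HX; have := H [:: (t, eta)].
rewrite /= t0 => /(_ isT).
have -> : [set om | (X t om == eta) && true] = [set om | X t om = eta].
  by apply/seteqP; split=> om /=; rewrite andbT; move=> /eqP.
move=> ->; rewrite /fdd /law /= subr0; congr EFin.
by apply: eq_bigr => e _; rewrite mulr1.
Qed.

Lemma markov_law2 s t eta zeta : 0 <= s -> s <= t ->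
  P [set om | X s om = eta /\ X t om = zeta] = (law p mu s eta * p (t - s) eta zeta)%:E.
Proof.
move=> s0 st; have [_ _ H] := HX; have := H [:: (s, eta); (t, zeta)].
rewrite /= s0 st => /(_ isT).
have -> : [set om | [&& X s om == eta, X t om == zeta & true]] =
   [set om | X s om = eta /\ X t om = zeta].
  apply/seteqP; split=> om /=; rewrite andbT; first by move=> /andP[/eqP -> /eqP ->].
  by move=> [-> ->]; rewrite !eqxx.
move=> ->; rewrite /fdd /law /= subr0 mulr_suml; congr EFin.
by apply: eq_bigr => e _; rewrite mulr1 mulrA.
Qed.

End MarkovProcess.

Lemma block_fluct_measurable (R : realType) (d N l : nat) i0 B cs (D : set R) (x : site d N) eta (f : R -> R) :
  measurable_fun D f -> measurable_fun D (fun t => block_fluct (R := R) i0 B cs l x (f t) eta).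
Proof.
move=> mf; apply: measurable_sum => q; apply: measurable_funM => //.
apply: measurable_funB => //; apply: measurable_funM => //; apply: measurable_funM => //.
exact: measurable_funX.
Qed.

Lemma block_rest_measurable (R : realType) (d N l : nat) i0 B cs (D : set R) (x : site d N) eta (f : R -> R) :
  measurable_fun D f -> measurable_fun D (fun t => block_rest (R := R) i0 B cs l x (f t) eta).
Proof.
move=> mf; apply: measurable_sum => q; apply: measurable_funM => //.
apply: measurable_funB.
  by apply: measurable_funB => //; exact: measurable_funX.
apply: measurable_funM; last exact: measurable_funB.
by apply: measurable_funM => //; exact: measurable_funX.
Qed.

Lemma abse_add3_le (R : realDomainType) (x y z e e' : \bar R) :
  (`|x| <= e -> `|y| <= e' -> `|z| <= e -> `|x + (y + z)| <= (e + e) + e')%E.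
Proof.
move=> hx hy hz; apply: (le_trans (lee_abs_add _ _)).
rewrite -addeA; apply: leeD => //; apply: (le_trans (lee_abs_add _ _)).
by rewrite [leRHS]addeC; exact: leeD.
Qed.

Lemma adde3_le (R : realDomainType) (w x y x' y' z : \bar R) :
  (x <= x' -> y <= y' + z -> w + (x + y) <= y' + (w + x' + z))%E.
Proof.
by move=> hx hy; rewrite [leRHS]addeCA -[leRHS]addeA; apply: leeD => //; apply: leeD.
Qed.

Section FixedN.
Variables (R : realType) (d N : nat) (K cmin Cg : R).
Variables (c : 'I_d -> zconf d -> R) (cg : zconf d -> R).
Hypotheses (N0 : (0 < N)%N) (K0 : 0 <= K) (cmin0 : 0 < cmin).
Hypothesis cinv : forall i (x : site d N) eta,
  tloc (c i) x (tswap eta x (x + tunit N i)) = tloc (c i) x eta.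
Hypothesis cmin_le : forall i xi, cmin <= c i xi.
Hypothesis cgb : forall xi, 0 <= cg xi <= Cg.
Variable p : R -> conf d N -> conf d N -> R.
Hypothesis trp : is_transition (LN K c cg) p.
Variables (i0 : 'I_d) (B : nat) (cs : seq (R * seq (zsite d))).
Variables (h : zconf d -> R) (Lh : seq (zsite d)).
Hypothesis hE : forall xi, h xi = poly_at cs xi.
Hypothesis EE : forall rho, EnuL rho Lh h = \sum_(q <- cs) q.1 * rho ^+ size q.2.
Variable (l : nat).
Hypotheses (l0 : (0 < l)%N) (lN : (B.+1 + l + B < N)%N).
Variables (dO : measure_display) (Om : measurableType dO) (P : probability Om R).
Variables (X : R -> Om -> conf d N) (mu : conf d N -> R).
Hypothesis mupmf : is_pmf mu.
Hypothesis HX : is_markov_process P X mu p.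
Variables (T kappa dl Ca Wd g CR CV CD : R).
Hypotheses (kappa01 : 0 <= kappa < 1) (T0 : 0 < T) (dl0 : 0 < dl) (dlT : dl <= T / 2).
Hypotheses (Ca0 : 0 <= Ca) (Wd0 : 0 <= Wd) (CR0 : 0 <= CR) (CV0 : 0 <= CV) (CD0 : 0 <= CD).
Variables (u a : R -> site d N -> R).
Local Notation w t := (((t * (T - t)) `^ kappa)^-1).
Local Notation lam := (@lebesgue_measure R).
Local Notation n := (#|site d N|%:R : R).
Hypothesis u01 : forall t x, 0 <= t <= T -> 0 < u t x < 1.
Hypothesis mu_ : forall x, measurable_fun `[0, T] (fun t => u t x).
Hypothesis ma : forall x, measurable_fun `[0, T] (fun t => a t x).
Hypothesis aC : forall t x, 0 < t < T -> `|a t x| <= Ca * w t.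
Hypothesis wW : forall t, dl <= t <= T - dl -> w t <= Wd.
Hypothesis ug : forall t x, dl <= t <= T - dl -> `|u t (x + tunit N i0) - u t x| <= g.
Hypothesis HR : forall (x : site d N) v eta, 0 <= v <= 1 ->
  `|block_rest i0 B cs l x v eta| <= CR * (block_mean R i0 B l x eta - v) ^+ 2.
Hypothesis HV : forall (x : site d N) v eta, 0 <= v <= 1 -> `|block_fluct i0 B cs l x v eta| <= CV.
Hypothesis HD : forall (m : conf d N -> R) (a u : site d N -> R) (A : R),
  (forall eta, 0 <= m eta) -> \sum_eta m eta = 1 ->
  (forall x, `|a x| <= A) -> (forall x, 0 <= u x <= 1) ->
  `|\sum_eta m eta * \sum_x a x * block_fluct i0 B cs l x (u x) eta| <=
  A * CD * (l%:R * xtot m + n / l%:R).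

Let W t eta := \sum_x a t x * fcorr h Lh (u t x) x eta.
Let V t eta := \sum_x a t x * block_fluct i0 B cs l x (u t x) eta.
Let Q t eta := \sum_x a t x * block_rest i0 B cs l x (u t x) eta.
Let nQ t eta := `|Q t eta|.

Let WE t eta : W t eta = V t eta + Q t eta.
Proof.
rewrite /W /V /Q -big_split /=; apply: eq_bigr => x _.
by rewrite (@fcorr_split _ _ i0 B cs h Lh N l x) // mulrDr.
Qed.

Let mV eta : measurable_fun `[0, T] (fun t => V t eta).
Proof.
by apply: measurable_sum => x; apply: measurable_funM => //; exact: block_fluct_measurable.
Qed.

Let mQ eta : measurable_fun `[0, T] (fun t => Q t eta).
Proof.
by apply: measurable_sum => x; apply: measurable_funM => //; exact: block_rest_measurable.
Qed.

Let mW eta : measurable_fun `[0, T] (fun t => W t eta).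
Proof.
rewrite [X in measurable_fun _ X](_ : _ = fun t => V t eta + Q t eta).
  exact: measurable_funD.
by apply/funext => t; exact: WE.
Qed.

Local Notation ta := dl.
Local Notation tb := (T - dl).
Let mid := [set` `[ta, tb]%R] : set R.

Let midT t : mid t -> 0 < t < T.
Proof. by rewrite /mid /= in_itv /= => /andP[t1 t2]; apply/andP; split; [exact: lt_le_trans dl0 t1|apply: le_lt_trans t2 _; rewrite ltrBlDr ltrDl]. Qed.

Let mid_sub : mid `<=` `[0, T].
Proof. by move=> t /midT /andP[t1 t2]; rewrite /= in_itv /= !ltW. Qed.

Let u01' t x : 0 < t < T -> 0 <= u t x <= 1.
Proof.
by move=> /andP[t1 t2]; have /andP[h1 h2] := u01 x (introT andP (conj (ltW t1) (ltW t2))); rewrite !ltW.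
Qed.

Let aA t x : mid t -> `|a t x| <= Ca * Wd.
Proof.
move=> mt; rewrite (le_trans (aC x (midT mt))) // ler_wpM2l // wW //.
Qed.

Let Y01 (x : site d N) (eta : conf d N) (v : R) : 0 <= v <= 1 -> (block_mean R i0 B l x eta - v) ^+ 2 <= 1.
Proof.
have := block_mean01 R i0 B x eta l0; move: (block_mean _ _ _ _ _ _) => y /andP[y0 y1] /andP[v0 v1].
have : 0 <= (1 - (y - v)) * (1 + (y - v)) by apply: mulr_ge0; lra.
nra.
Qed.

Let sum_const (k : R) : \sum_(x : site d N) k = n * k.
Proof. rewrite sumr_const -[LHS]mulr_natl; reflexivity. Qed.

Let Vmid t eta : mid t -> `|V t eta| <= Ca * Wd * CV * n.
Proof.
move=> mt; rewrite (le_trans (ler_norm_sum _ _ _)) // [leRHS]mulrC -sum_const.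
apply: ler_sum => x _; rewrite normrM; apply: ler_pM => //; first exact: aA.
by apply: HV; exact: u01' (midT mt).
Qed.

Let Qmid t eta : mid t -> `|nQ t eta| <= Ca * Wd * CR * n.
Proof.
move=> mt; rewrite /nQ normr_id (le_trans (ler_norm_sum _ _ _)) // [leRHS]mulrC -sum_const.
apply: ler_sum => x _; rewrite normrM; apply: ler_pM => //; first exact: aA.
have v01 := u01' x (midT mt).
by rewrite (le_trans (HR _ _ v01)) // ler_piMr // Y01.
Qed.

Let Wbound t eta : 0 < t < T -> `|W t eta| <= (CV + CR) * Ca * n * w t.
Proof.
move=> tT; have -> : (CV + CR) * Ca * n * w t = n * (Ca * w t * (CV + CR)) by ring.
rewrite WE /V /Q -big_split /= (le_trans (ler_norm_sum _ _ _)) // -sum_const.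
apply: ler_sum => x _; rewrite -mulrDr normrM; apply: ler_pM => //; first exact: aC.
have v01 := u01' x tT.
rewrite (le_trans (ler_normD _ _)) // lerD ?HV //.
by rewrite (le_trans (HR _ _ v01)) // ler_piMr // Y01.
Qed.

Let tab : ta <= tb.
Proof. by rewrite lerBrDr; move: dlT; lra. Qed.

Let nu t eta := law p mu t eta.
Let mu0 := mupmf.1.
Let mu1 := mupmf.2.
Let LE (f : conf d N -> R) eta := LN_moves K c cg f eta.
Let pd zeta : backward (@LN R d N K c cg) (fun t eta => p t eta zeta).
Proof. by move=> t eta; exact: trp.2. Qed.
Let r0 i (eta : conf d N) : 0 <= gen_rate K c cg i eta.
Proof.
case: i => [q|x] /=; rewrite mulr_ge0 // ?sqr_ge0 //.
  exact: le_trans (ltW cmin0) (cmin_le _ _).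
by have /andP[] := cgb (ext (tshift x eta)).
Qed.

Let mX t zeta : measurable [set om | X t om = zeta].
Proof. by have [] := HX. Qed.
Let rcX om t : 0 <= t -> exists2 del : R, 0 < del & forall s, t <= s < t + del -> X s om = X t om.
Proof. by move=> t0; have [_ + _] := HX; apply. Qed.
Let nu0 t eta : 0 <= t -> 0 <= nu t eta.
Proof. exact: (law_ge0 r0 LE trp.1 pd mu0). Qed.
Let nu1 t : 0 <= t -> \sum_eta nu t eta = 1.
Proof. exact: (law_sum1 r0 LE trp.1 pd mu1). Qed.
Let p01 t eta zeta : 0 <= t -> 0 <= p t eta zeta <= 1.
Proof.
move=> t0; have H e z := trans_ge0 r0 LE trp.1 pd e z t0.
rewrite H /= -(trans_sum1 r0 LE trp.1 pd eta t0) (bigD1 zeta) //= lerDl.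
by apply: sumr_ge0 => e _; exact: H.
Qed.
Let cnu eta : continuous (fun t => nu t eta).
Proof. exact: (law_continuous (m0 := mu) pd). Qed.
Let mnu eta : measurable_fun setT (fun t => nu t eta).
Proof. exact: continuous_measurable_fun. Qed.
Let mp eta zeta : measurable_fun setT (fun t => p t eta zeta).
Proof. by apply: continuous_measurable_fun; exact: (is_derive_continuous (fun t => trp.2 t eta zeta)). Qed.

(** The bound of [trans_integral_bound] with the coefficients of [HD] for [A = Ca * Wd], and the
    remaining time enlarged to T. *)
Let Phi : R := 3 * (Ca * Wd * CD * l%:R / (N%:R * cmin) * (n + (K * Cg + cmin * d%:R) * n * T)
                    + Ca * Wd * CD * (n / l%:R) * T).

Let Cg0 : 0 <= Cg.
Proof. by have /andP[h1 h2] := cgb (fun=> false); exact: le_trans h2. Qed.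

Let Phi0 : 0 <= Phi.
Proof.
have dn : 0 <= d%:R :> R by [].
have cm := ltW cmin0; have T' := ltW T0.
rewrite /Phi; repeat first [exact: ler0n|assumption|apply: addr_ge0|apply: mulr_ge0|rewrite invr_ge0].
Qed.

Let HPhi s eta : mid s ->
  (\int[lam]_(t in [set` `[s, tb]%R]) `|\sum_zeta p (t - s) eta zeta * V t zeta|%:E <= Phi%:E)%E.
Proof.
move=> ms; have s0T := midT ms.
have /andP[as_ sb] : ta <= s <= tb by move: ms; rewrite /mid /= in_itv.
have sub t : s <= t <= tb -> mid t.
  by move=> /andP[h1 h2]; rewrite /mid /= in_itv /= h2 andbT (le_trans as_).
have k10 : 0 <= Ca * Wd * CD * l%:R by rewrite !mulr_ge0.
have mVs zeta : measurable_fun `[s, tb] (fun t => V t zeta).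
  apply: measurable_funS (mV zeta) => // t; rewrite /= in_itv /= => /sub mt.
  exact: mid_sub.
apply: le_trans (@trans_integral_bound R d N K cmin Cg c cg N0 K0 cmin0 cinv cmin_le cgb p trp V
   (Ca * Wd * CD * l%:R) (Ca * Wd * CD * (n / l%:R)) s tb eta sb k10 mVs _) _.
  move=> m t m0 m1 /sub mt.
  have := @HD m (a t) (u t) (Ca * Wd) m0 m1 (fun x => aA x mt) (fun x => u01' x (midT mt)).
  by rewrite mulrDr mulrA.
rewrite lee_fin /Phi ler_wpM2l //.
have bT : tb - s <= T by move: s0T dl0 => /andP[]; lra.
have bs : 0 <= tb - s by rewrite subr_ge0.
have n0 : 0 <= n by [].
have dn : 0 <= d%:R :> R by [].
have cm := ltW cmin0.
have k30 : 0 <= Ca * Wd * CD * l%:R / (N%:R * cmin).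
  by rewrite divr_ge0 // mulr_ge0.
apply: lerD; first apply: ler_wpM2l => //.
  by rewrite lerD2l ler_wpM2l // mulr_ge0 // addr_ge0 // mulr_ge0.
by rewrite ler_wpM2l // !mulr_ge0 // invr_ge0.
Qed.

Let H t := rel_entropy (nu t) (nuprod (u t)).

Let H0 t : 0 <= t <= T -> 0 <= H t.
Proof.
move=> tT; have /andP[t0 _] := tT.
apply: (@entropy_ge0 R d N (u t) 0 1) => //.
- by move=> x; exact: u01.
- by move=> [|j] [|k].
- by move=> e; exact: nu0.
- exact: nu1.
Qed.

Lemma entropy_integral_ge0 :
  (0 <= \int[lam]_(t in `[0%R, T]) (rel_entropy (lawt mu p t) (nuprod (u t)) / (t * (T - t)) `^ kappa)%:E)%E.
Proof.
apply: integral_ge0 => t; rewrite /= in_itv /= => tT.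
by rewrite lee_fin mulr_ge0 ?invr_ge0 ?powR_ge0 //; exact: H0.
Qed.

(** The entropy keeps the true weight [w t], because its weighted time integral is what the theorem
    allows on the right; the other terms take the cruder bound [Wd]. *)
Let static t : mid t -> \sum_eta nu t eta * nQ t eta <=
  256 * CR * Ca * (H t * w t)
  + Ca * Wd * CR * (8 * n / l%:R + 2 * (n * ((B.+1 + l)%:R * g) ^+ 2)).
Proof.
move=> mt; have tT := midT mt; have t0 : 0 <= t by case/andP: tT => /ltW.
have tt : dl <= t <= T - dl by move: mt; rewrite /mid /= in_itv.
have w0 : 0 <= w t by rewrite invr_ge0 powR_ge0.
have tT' : 0 <= t <= T by move: tT => /andP[h1 h2]; rewrite !ltW.
apply: (@le_trans _ _ (Ca * w t * CR * \sum_x \sum_eta nu t eta * (block_mean R i0 B l x eta - u t x) ^+ 2)).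
  rewrite exchange_big /= mulr_sumr; apply: ler_sum => eta _.
  rewrite -mulr_sumr mulrCA ler_wpM2l ?nu0 // /nQ.
  rewrite (le_trans (ler_norm_sum _ _ _)) // mulr_sumr; apply: ler_sum => x _.
  rewrite normrM -[leRHS]mulrA; apply: ler_pM => //; first exact: aC.
  by apply: HR; exact: u01'.
have S := static_bound (i0 := i0) l0 lN (fun e => nu0 e t0) (nu1 t0) (fun x => u01 x tT') (fun x => ug x tt).
have k0 : 0 <= Ca * w t * CR by rewrite !mulr_ge0.
apply: (le_trans (ler_wpM2l k0 S)).
set b2 := n * _; set e := n / l%:R.
have -> : 4 * n / l%:R = 4 * e by rewrite mulrA.
have -> : 8 * n / l%:R = 8 * e by rewrite mulrA.
rewrite -/(H t); have b20 : 0 <= b2 by rewrite mulr_ge0 // sqr_ge0.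
have e0 : 0 <= e by rewrite divr_ge0.
have r0' : 0 <= 8 * e + 2 * b2 by rewrite addr_ge0 // mulr_ge0.
have -> : Ca * w t * CR * (2 * (128 * H t + 4 * e) + 2 * b2) =
   256 * CR * Ca * (H t * w t) + Ca * w t * CR * (8 * e + 2 * b2) by ring.
rewrite lerD2l ler_wpM2r // ler_wpM2r // ler_wpM2l // wW //.
Qed.

Let Mend : R := (T / 2) `^ (- kappa) * (dl `^ (1 - kappa) / (1 - kappa)).
Let Cw : R := (CV + CR) * Ca * n.
Let Cw0 : 0 <= Cw.
Proof. by rewrite /Cw; repeat first [exact: ler0n|assumption|apply: addr_ge0|apply: mulr_ge0]. Qed.

Let mw (D : set R) : measurable_fun D (fun t : R => w t).
Proof.
apply: measurable_funTS; rewrite [X in measurable_fun _ X](_ : _ = fun t => (t * (T - t)) `^ (- kappa)).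
  apply: (measurableT_comp (measurable_powR _)).
  by apply: measurable_funM => //; exact: measurable_funB.
by apply/funext => t; rewrite powRN.
Qed.

Let mpath om : measurable_fun `[0, T] (fun t => W t (X t om)).
Proof. exact: (path_section_measurable mX rcX (lexx 0) om mW). Qed.

Let end_bound om (D : set R) : measurable D -> D `<=` `]0, T[ ->
  (\int[lam]_(t in D) (w t)%:E <= Mend%:E)%E ->
  (`| \int[lam]_(t in D) (W t (X t om))%:E | <= (Cw * Mend)%:E)%E.
Proof.
move=> mD DT HM.
have D0T : D `<=` `[0, T].
  by move=> t /DT; rewrite /= !in_itv /= => /andP[h1 h2]; rewrite !ltW.
have mf : measurable_fun D (fun t => (W t (X t om))%:E).
  by apply/measurable_EFinP; apply: measurable_funS (mpath om).
apply: (le_trans (le_abse_integral lam mD mf)).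
apply: (@le_trans _ _ (\int[lam]_(t in D) (Cw%:E * (w t)%:E))%E).
  apply: ge0_le_integral => //.
  - exact: measurableT_comp.
  - apply: emeasurable_funM => //; apply/measurable_EFinP; exact: mw.
  - by move=> t /DT; rewrite /= in_itv /= => tT; rewrite -EFinM lee_fin; exact: Wbound.
rewrite ge0_integralZl_EFin //.
- by rewrite (EFinM Cw Mend); apply: lee_wpmul2l => //; rewrite lee_fin; exact: Cw0.
- by move=> t _; rewrite lee_fin invr_ge0 powR_ge0.
- by apply/measurable_EFinP; exact: mw.
Qed.

Let mVm eta : measurable_fun mid (fun t => V t eta).
Proof. by apply: measurable_funS (mV eta) => //; exact: mid_sub. Qed.
Let mQm eta : measurable_fun mid (fun t => Q t eta).
Proof. by apply: measurable_funS (mQ eta) => //; exact: mid_sub. Qed.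
Let mnQm eta : measurable_fun mid (fun t => nQ t eta).
Proof. exact: measurableT_comp. Qed.

Let BV0 : 0 <= Ca * Wd * CV * n.
Proof. by repeat first [exact: ler0n|assumption|apply: mulr_ge0]. Qed.
Let BR0 : 0 <= Ca * Wd * CR * n.
Proof. by repeat first [exact: ler0n|assumption|apply: mulr_ge0]. Qed.
Let Qmid' t eta : mid t -> `|Q t eta| <= Ca * Wd * CR * n.
Proof. by move=> mt; have := Qmid eta mt; rewrite /nQ normr_id. Qed.

(** For V the absolute value stays outside the time integral, so that cancellation in time survives
    for the second moment. For Q it goes inside, since the static estimate controls its size at each
    time. *)
Let pathwise om :
  (`| \int[lam]_(t in `[0%R, T]) (W t (X t om))%:E | <=
   (2 * (Cw * Mend))%:E + (`| \int[lam]_(t in mid) (V t (X t om))%:E |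
      + \int[lam]_(t in mid) (nQ t (X t om))%:E))%E.
Proof.
have [He1 He2] := end_weights kappa01 T0 dl0 dlT.
have S1 : [set` `[0, T]%R] = [set` `[0, dl[%R] `|` (mid `|` [set` `]tb, T]%R]).
  apply/seteqP; split=> t; rewrite /mid /= !in_itv /=.
    move=> /andP[h1 h2]; have [h3|h3] := ltP t dl; first by left; rewrite h1.
    right; have [h4|h4] := leP t tb; first by left.
    by right; rewrite h2.
  have := tab; have := dl0; have := dlT.
  by move=> h1 h2 h3 [/andP[]|[/andP[]|/andP[]]] h4 h5; apply/andP; split; lra.
have mf : measurable_fun `[0, T] (fun t => (W t (X t om))%:E) by apply/measurable_EFinP.
have m1 : measurable [set` `[0, dl[%R] by exact: measurable_itv.
have m2 : measurable mid by exact: measurable_itv.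
have m3 : measurable [set` `]tb, T]%R] by exact: measurable_itv.
have mf0 := mf; have dltT : dl < T by move: dlT T0; lra.
rewrite S1 in mf *.
rewrite integral_setU //; last 2 first.
- exact: measurableU.
- apply/disj_setPS => t [] /=; rewrite /mid /= !in_itv /= => /andP[h1 h2].
  move=> [/andP[h4 h5]|/andP[h4 h5]]; first by have := lt_le_trans h2 h4; rewrite ltxx.
  by have := lt_trans (lt_le_trans h2 tab) h4; rewrite ltxx.
rewrite integral_setU //; last 2 first.
- by apply: measurable_funS mf => [|t ?]; [apply: measurableU => //; exact: measurableU|right].
- apply/disj_setPS => t [] /=; rewrite /mid /= !in_itv /= => /andP[h1 h2] /andP[h4 h5].
  by have := le_lt_trans h2 h4; rewrite ltxx.
have b1 : (`| \int[lam]_(t in `[0%R, dl[) (W t (X t om))%:E | <= (Cw * Mend)%:E)%E.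
  (* Passing to the open interval drops a null set containing the end of [0, T], where the bound on
     [a] says nothing. *)
  rewrite integral_itv_bndoo; last first.
    apply: measurable_funS mf0 => // t; rewrite /= !in_itv /= => /andP[h1 h2].
    by rewrite (ltW h1) (le_trans (ltW h2)) // ltW.
  apply: end_bound; [exact: measurable_itv| |exact: He1].
  move=> t; rewrite /= !in_itv /= => /andP[h1 h2]; rewrite h1 /=; exact: lt_trans dltT.
have b3 : (`| \int[lam]_(t in `]tb, T]) (W t (X t om))%:E | <= (Cw * Mend)%:E)%E.
  rewrite integral_itv_bndoo; last first.
    apply: measurable_funS mf0 => // t; rewrite /= !in_itv /= => /andP[h1 h2].
    by rewrite (ltW h2) andbT (le_trans _ (ltW h1)) // subr_ge0 ltW.
  apply: end_bound; [exact: measurable_itv| |exact: He2].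
  move=> t; rewrite /= !in_itv /= => /andP[h1 h2]; rewrite h2 andbT; by apply: lt_trans h1; rewrite subr_gt0.
have iV := path_section_integrable mX rcX (ltW dl0) tab BV0 mVm Vmid om.
have iQ := path_section_integrable mX rcX (ltW dl0) tab BR0 mQm Qmid' om.
have eW : (\int[lam]_(t in mid) (W t (X t om))%:E =
   \int[lam]_(t in mid) (V t (X t om))%:E + \int[lam]_(t in mid) (Q t (X t om))%:E)%E.
  transitivity (\int[lam]_(t in mid) ((V t (X t om))%:E + (Q t (X t om))%:E))%E.
    by apply: eq_integral => t _; rewrite WE EFinD.
  by apply: integralD; [exact: m2|exact: iV|exact: iQ].
have b2 : (`|\int[lam]_(t in mid) (Q t (X t om))%:E| <= \int[lam]_(t in mid) (nQ t (X t om))%:E)%E.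
  have mQo : measurable_fun mid (fun t => (Q t (X t om))%:E).
    by apply/measurable_EFinP; exact: (path_section_measurable mX rcX (ltW dl0) om mQm).
  by apply: (le_trans (le_abse_integral lam m2 mQo)); exact: lexx.
have bW : (`|\int[lam]_(t in mid) (W t (X t om))%:E| <=
   `| \int[lam]_(t in mid) (V t (X t om))%:E | + \int[lam]_(t in mid) (nQ t (X t om))%:E)%E.
  by rewrite eW; apply: (le_trans (lee_abs_add _ _)); exact: leeD.
have -> : (2 * (Cw * Mend))%:E = ((Cw * Mend)%:E + (Cw * Mend)%:E)%E.
  by rewrite -EFinD; congr EFin; ring.
exact: abse_add3_le b1 bW b3.
Qed.

Let mH : measurable_fun `[0, T] (fun t => H t * w t).
Proof.
apply: measurable_funM; last exact: mw.
apply: measurable_sum => eta; apply: measurable_funM; first exact: measurable_funTS.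
have nuE t : (t \in [set` `[0, T]%R] : Prop) -> 0 <= nuprod (u t) eta.
  rewrite inE /= in_itv /= => tT; apply: prodr_ge0 => x _.
  by have /andP[h1 h2] := u01 x tT; case: ifP => _; rewrite ?subr_ge0 ltW.
(* The quotient is rewritten with the real power -1, whose measurability is available; the two agree
   because the product weights are nonnegative on [0, T]. *)
apply: (@eq_measurable_fun _ _ _ _ _ (fun t => ln (nu t eta * nuprod (u t) eta `^ (-1)))).
  by move=> t tT; rewrite powR_inv1 // nuE.
apply: (measurableT_comp (@measurable_ln R)); apply: measurable_funM.
  exact: measurable_funTS.
apply: (measurableT_comp (measurable_powR _)).
apply: measurable_prod => x _; case: (eta x); first exact: mu_.
exact: measurable_funB.
Qed.

Let C1 : R := 256 * CR * Ca.
Let E2 : R := Ca * Wd * CR * (8 * n / l%:R + 2 * (n * ((B.+1 + l)%:R * g) ^+ 2)).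

(** [q] is left free so that it can balance the two terms of [abs_moment] once the size of [Phi] is
    known. *)
Lemma fluctuation_bound q : 0 < q ->
  (\int[P]_om `| \int[lam]_(t in `[0%R, T]) (\sum_x a t x * fcorr h Lh (u t x) x (X t om))%:E |
   <= C1%:E * \int[lam]_(t in `[0%R, T]) (rel_entropy (lawt mu p t) (nuprod (u t)) / (t * (T - t)) `^ kappa)%:E
      + (2 * (Cw * Mend) + (q + T * (Ca * Wd * CV * n) * Phi / q) + T * E2)%:E)%E.
Proof.
move=> q0.
have fP : (P setT < +oo)%E by rewrite probability_setT ltry.
have L1 t eta : 0 <= t -> P [set om | X t om = eta] = (nu t eta)%:E by exact: markov_law1 HX _ _.
have L2 s t eta zeta : 0 <= s -> s <= t ->
   P [set om | X s om = eta /\ X t om = zeta] = (nu s eta * p (t - s) eta zeta)%:E.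
  exact: markov_law2 HX _ _ _ _.
have dl0' := ltW dl0.
have AM := abs_moment mX rcX L2 nu0 nu1 p01 mnu mp dl0' tab BV0 mVm Vmid Phi0 HPhi q0.
have FM := first_moment mX rcX L1 dl0' tab BR0 mnQm Qmid.
have mZ := path_integral_measurable P mX rcX dl0' tab BV0 mVm Vmid.
have mY := path_integral_measurable P mX rcX dl0' tab BR0 mnQm Qmid.
apply: (le_trans (ge0_le_integral_sup _ _ pathwise)) => //.
have cw0 : (0 <= (2 * (Cw * Mend))%:E)%E.
  have k1 : 0 <= 1 - kappa by case/andP: kappa01 => _ k1; rewrite subr_ge0 ltW.
  have M0 : 0 <= Mend by rewrite /Mend mulr_ge0 ?powR_ge0 // divr_ge0 ?powR_ge0.
  by rewrite lee_fin; apply: mulr_ge0 => //; apply: mulr_ge0 => //; exact: Cw0.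
have Y0 om : (0 <= \int[lam]_(t in mid) (nQ t (X t om))%:E)%E.
  by apply: integral_ge0 => t _; rewrite lee_fin /nQ normr_ge0.
rewrite ge0_integralD //; last 2 first.
- by move=> om _; apply: adde_ge0.
- by apply: emeasurable_funD => //; exact: measurableT_comp.
rewrite ge0_integralD //; last by exact: measurableT_comp.
rewrite integral_cst // [X in (_%:E * X)%E](_ : _ = 1%E) ?mule1; last exact: probability_setT.
have ST : (\int[P]_om \int[lam]_(t in mid) (nQ t (X t om))%:E <=
   C1%:E * \int[lam]_(t in `[0%R, T]) (H t * w t)%:E + (T * E2)%:E)%E.
  rewrite FM.
  have E20 : 0 <= E2.
    rewrite /E2; repeat first [exact: ler0n|exact: sqr_ge0|assumption|apply: addr_ge0|apply: mulr_ge0|rewrite invr_ge0].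
  have C10 : 0 <= C1 by rewrite /C1 !mulr_ge0.
  have mHm : measurable_fun mid (fun t => H t * w t).
    by apply: measurable_funS mH => //; exact: mid_sub.
  have Hw0 t : mid t -> 0 <= H t * w t.
    move=> mt; rewrite mulr_ge0 ?invr_ge0 ?powR_ge0 //; apply: H0.
    by have /andP[h1 h2] := midT mt; rewrite !ltW.
  have mmid : measurable mid by exact: measurable_itv.
  apply: (@le_trans _ _ (\int[lam]_(t in mid) ((C1 * (H t * w t))%:E + E2%:E))%E).
    apply: ge0_le_integral => //.
    - move=> t mt; rewrite lee_fin; apply: sumr_ge0 => eta _; rewrite mulr_ge0 ?nu0 //.
      by case/andP: (midT mt) => /ltW.
      by rewrite /nQ normr_ge0.
    - apply/measurable_EFinP; apply: measurable_sum => eta; apply: measurable_funM; last exact: mnQm.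
      exact: measurable_funS (mnu eta).
    - apply: emeasurable_funD; last exact: measurable_cst.
      by apply/measurable_EFinP; exact: measurable_funM.
  rewrite ge0_integralD //; last 2 first.
  - by move=> t mt; rewrite lee_fin mulr_ge0 // Hw0.
  - by apply/measurable_EFinP; exact: measurable_funM.
  apply: leeD.
    under eq_integral do rewrite EFinM.
    rewrite ge0_integralZl_EFin //; last exact/measurable_EFinP.
    apply: lee_wpmul2l; first by rewrite lee_fin.
    apply: ge0_subset_integral => //; [exact/measurable_EFinP|move=> t].
    rewrite /= in_itv /= => tT; rewrite lee_fin mulr_ge0 ?invr_ge0 ?powR_ge0 //; exact: H0.
  rewrite integral_cst //= lebesgue_measure_itv /= lte_fin; case: ltP => _.
    rewrite -EFinD -EFinM lee_fin mulrC ler_wpM2r // lerBlDr lerBlDr.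
    by move: dl0; lra.
  by rewrite mule0 lee_fin mulr_ge0 // ltW.
have -> : (2 * (Cw * Mend) + (q + T * (Ca * Wd * CV * n) * Phi / q) + T * E2)%:E =
  ((2 * (Cw * Mend))%:E + (q + T * (Ca * Wd * CV * n) * Phi / q)%:E + (T * E2)%:E)%E by rewrite !EFinD.
have AM' : (\int[P]_om `|\int[lam]_(t in mid) (V t (X t om))%:E| <=
    (q + T * (Ca * Wd * CV * n) * Phi / q)%:E)%E.
  apply: (le_trans AM); rewrite lee_fin lerD2l ler_wpM2r ?invr_ge0 ?(ltW q0) //.
  rewrite ler_wpM2r // ler_wpM2r //; by move: dl0; lra.
exact: adde3_le AM' ST.
Qed.

End FixedN.

(** * Asymptotics in the size of the torus *)

Definition pow_bounded (R : realType) (f : nat -> R) (e : R) : Prop :=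
  exists c N0, 0 <= c /\ forall N, (N0 <= N)%N -> 0 <= f N <= c * N%:R `^ e.

Section PowBounded.
Variable R : realType.
Implicit Types (f g : nat -> R) (e r : R).

Lemma pow_bounded_const k : 0 <= k -> pow_bounded (fun=> k) (0 : R).
Proof. by move=> k0; exists k, 0%N; split=> // N _; rewrite powRr0 mulr1 k0 lexx. Qed.

Lemma pow_bounded_powR e : pow_bounded (fun N => N%:R `^ e) e.
Proof. by exists 1, 0%N; split=> // N _; rewrite mul1r powR_ge0 lexx. Qed.

Lemma pow_bounded_add f g e : pow_bounded f e -> pow_bounded g e ->
  pow_bounded (fun N => f N + g N) e.
Proof.
move=> [c [N0 [c0 Hf]]] [c' [N1 [c0' Hg]]]; exists (c + c'), (maxn N0 N1); split; first exact: addr_ge0.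
move=> N; rewrite geq_max => /andP[/Hf /andP[f0 f1] /Hg /andP[g0 g1]].
by rewrite addr_ge0 //= mulrDl lerD.
Qed.

Lemma pow_bounded_mul f g e r : pow_bounded f e -> pow_bounded g r ->
  pow_bounded (fun N => f N * g N) (e + r).
Proof.
move=> [c [N0 [c0 Hf]]] [c' [N1 [c0' Hg]]].
exists (c * c'), (maxn 1 (maxn N0 N1)); split; first exact: mulr_ge0.
move=> N; rewrite !geq_max => /and3P[N1' /Hf /andP[f0 f1] /Hg /andP[g0 g1]].
rewrite mulr_ge0 //= powRD; last by rewrite pnatr_eq0 -lt0n N1' implybT.
by rewrite mulrACA ler_pM.
Qed.

Lemma pow_bounded_le f e r : e <= r -> pow_bounded f e -> pow_bounded f r.
Proof.
move=> er [c [N0 [c0 Hf]]]; exists c, (maxn 1 N0); split => // N.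
rewrite geq_max => /andP[N1 /Hf /andP[-> f1]] /=; rewrite (le_trans f1) // ler_wpM2l //.
by rewrite ler_powR // ler1n.
Qed.

Lemma pow_bounded_comp_powR f e r : 0 <= r -> pow_bounded f e ->
  pow_bounded (fun N => f N `^ r) (e * r).
Proof.
move=> r0 [c [N0 [c0 Hf]]]; exists (c `^ r), N0; split; first exact: powR_ge0.
move=> N /Hf /andP[f0 f1]; rewrite powR_ge0 /= powRrM -powRM ?powR_ge0 //.
by rewrite ge0_ler_powR // nnegrE // mulr_ge0 ?powR_ge0.
Qed.

Lemma pow_bounded_expn f e k : pow_bounded f e ->
  pow_bounded (fun N => f N ^+ k) (e * k%:R).
Proof.
move=> [c [N0 [c0 Hf]]]; exists (c ^+ k), N0; split; first exact: exprn_ge0.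
move=> N /Hf /andP[f0 f1]; rewrite exprn_ge0 //= powRrM powR_mulrn ?powR_ge0 // -exprMn.
by rewrite lerXn2r // nnegrE // mulr_ge0 ?powR_ge0.
Qed.

Lemma pow_bounded_small f e k : e < 0 -> 0 < k -> pow_bounded f e ->
  exists N0, forall N, (N0 <= N)%N -> f N <= k.
Proof.
move=> e0 k0 [c [N0 [c0 Hf]]].
(* For N >= y one has (c + 1) N^e <= k; the added 1 keeps the base positive when c = 0. *)
pose y := ((c + 1) / k) `^ (- e)^-1.
exists (maxn N0 (Num.bound y)) => N; rewrite geq_max => /andP[/Hf /andP[_ f1] yN].
have e0' : 0 < - e by rewrite oppr_gt0.
have ck : 0 < (c + 1) / k by rewrite divr_gt0 // ltr_wpDl.
have y0 : 0 < y by rewrite powR_gt0.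
have yN' : y <= N%:R.
  rewrite (le_trans (ltW (archi_boundP (ltW y0)))) // ler_nat //.
have H : (c + 1) / k <= N%:R `^ (- e).
  have site_mean : (- e)^-1 * (- e) = 1 by rewrite mulVf // gt_eqF.
  rewrite -[leLHS](powRr1 (ltW ck)) -[X in _ `^ X <= _]site_mean powRrM.
  by apply: ge0_ler_powR; rewrite ?nnegrE ?(ltW y0) ?ler0n ?(ltW e0').
apply: (le_trans f1); have Np : 0 < (N%:R : R) by exact: lt_le_trans yN'.
have Ne := powR_gt0 e Np.
have : (c + 1) / k * N%:R `^ e <= 1.
  apply: (le_trans (ler_wpM2r (ltW Ne) H)).
  by rewrite -powRD ?addNr ?powRr0 ?lexx // (gt_eqF Np) implybT.
rewrite mulrAC ler_pdivrMr // mul1r => h; apply: le_trans h.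
by rewrite ler_wpM2r ?(ltW Ne) // lerDl.
Qed.

Lemma pow_bounded_truncn e : 0 <= e ->
  pow_bounded (fun N => (Num.truncn (N%:R `^ e : R))%:R) e.
Proof.
move=> e0; exists 1, 0%N; split=> // N _.
by rewrite ler0n mul1r truncn_le powR_ge0.
Qed.

Lemma truncn_powR_gt0 e N : 0 <= e -> (0 < N)%N -> (0 < Num.truncn (N%:R `^ e : R))%N.
Proof.
move=> e0 N0; rewrite truncn_gt0 -[leLHS](powRr0 (N%:R : R)).
by apply: ler_powR; rewrite // ler1n.
Qed.

Lemma pow_bounded_truncnV e : 0 <= e ->
  pow_bounded (fun N => (Num.truncn (N%:R `^ e : R))%:R^-1) (- e).
Proof.
(* A truncation l that is at least 1 loses at most half: N^e < l + 1 <= 2 l. *)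
move=> e0; exists 2, 1%N; split=> // N N1; rewrite invr_ge0 ler0n /=.
have l0 := truncn_powR_gt0 e0 N1; set l := Num.truncn _ in l0 *.
have lp : 0 < l%:R :> R by rewrite ltr0n.
rewrite powRN ler_pdivlMr ?powR_gt0 ?ltr0n // mulrC ler_pdivrMr //.
have := truncnS_gt (N%:R `^ e : R); rewrite -/l -natr1.
have : 1 <= l%:R :> R by rewrite ler1n.
by move=> h1 h2; lra.
Qed.

End PowBounded.

Lemma card_site (d N : nat) : (1 < N)%N -> #|site d N| = (N ^ d)%N.
Proof. by move=> N1; rewrite card_ffun !card_ord Zp_cast. Qed.

Lemma powR_card_site (R : realType) (d N : nat) : (1 < N)%N ->
  #|site d N|%:R = N%:R `^ d%:R :> R.
Proof. by move=> N1; rewrite card_site // powR_mulrn // natrX. Qed.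

Lemma pow_bounded_natV (R : realType) : pow_bounded (fun N => N%:R^-1 : R) (- 1).
Proof.
by exists 1, 0%N; split=> // N _; rewrite invr_ge0 ler0n mul1r powR_inv1 //= lexx.
Qed.

Lemma exists_uniform_lb (R : realType) (I : finType) (Y : Type) (c : I -> Y -> R) :
  (forall i, exists2 B : R, 0 < B & forall y, B <= c i y) ->
  exists2 B : R, 0 < B & forall i y, B <= c i y.
Proof.
move=> H; pose b i := s2val (cid2 (H i)).
have b0 i : 0 < b i := s2valP (cid2 (H i)).
have bc i y : b i <= c i y := s2valP' (cid2 (H i)) y.
exists (\big[Order.min/1]_i b i); first by apply: lt_bigmin => // i _.
by move=> i y; apply: le_trans (bc i y); exact: bigmin_le_cond.
Qed.

Lemma pow_bounded_card_site (R : realType) (d : nat) :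
  pow_bounded (fun N => #|site d N|%:R : R) d%:R.
Proof.
exists 1, 2; split=> // N N2; by rewrite ler0n mul1r powR_card_site // lexx.
Qed.

(** * Exponents of the error terms *)

Section ErrorTerms.
Variables (R : realType) (d B : nat) (K : nat -> R).
Variables (kappa sigma theta T C0 CV CR CD cmin Cg : R).
Hypotheses (kappa01 : 0 <= kappa < 1) (sigma0 : 0 < sigma) (theta0 : 0 <= theta) (T0 : 0 < T).
Hypotheses (C00 : 0 < C0) (CV0 : 0 < CV) (CR0 : 0 < CR) (CD0 : 0 <= CD).
Hypotheses (cmin0 : 0 < cmin) (Cg0 : 0 <= Cg).

(* The ends of the time interval contribute dl^(1 - kappa) = N^(-2 eps1) times
   K^theta <= C N^(eps1/2); relative to N^d all other terms are O(N^(-1/8)), except for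
   q, which is chosen to be N^(d - eps1). *)
Definition eps1_of : R := (1 - kappa) / 64.
Definition eps0_of : R := eps1_of / 2 / (theta + sigma^-1 + 1).
Local Notation dlt := eps1_of.

Hypothesis Kb : pow_bounded K eps0_of.

Definition dl_of (N : nat) : R := N%:R `^ (- 32^-1).
Definition Ca_of (N : nat) : R := C0 * K N `^ theta.
Definition Wd_of (N : nat) : R := (N%:R `^ (32^-1) * (2 / T)) `^ kappa.
Definition g_of (N : nat) : R := C0 * K N `^ sigma^-1 * N%:R^-1 * Wd_of N.
Definition l_of (N : nat) : nat := Num.truncn (N%:R `^ (4^-1) : R).
Definition q_of (N : nat) : R := N%:R `^ (d%:R - dlt).
Local Notation n N := (#|site d N|%:R : R).
Definition Phi_of (N : nat) : R :=
  3 * (Ca_of N * Wd_of N * CD * (l_of N)%:R / (N%:R * cmin) *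
         (n N + (K N * Cg + cmin * d%:R) * n N * T)
       + Ca_of N * Wd_of N * CD * (n N / (l_of N)%:R) * T).
Definition rest_of (N : nat) : R :=
  2 * ((CV + CR) * Ca_of N * n N *
       ((T / 2) `^ (- kappa) * (dl_of N `^ (1 - kappa) / (1 - kappa))))
  + (q_of N + T * (Ca_of N * Wd_of N * CV * n N) * Phi_of N / q_of N)
  + T * (Ca_of N * Wd_of N * CR *
         (8 * n N / (l_of N)%:R + 2 * (n N * ((B.+1 + l_of N)%:R * g_of N) ^+ 2))).

Lemma eps1_of_gt0 : 0 < eps1_of.
Proof. by case/andP: kappa01 => _ h; rewrite /eps1_of divr_gt0 // subr_gt0. Qed.

Let den1 : 1 <= theta + sigma^-1 + 1.
Proof. by rewrite lerDr addr_ge0 // invr_ge0 ltW. Qed.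

Lemma eps0_of_gt0 : 0 < eps0_of.
Proof.
rewrite /eps0_of; apply: divr_gt0; first by rewrite divr_gt0 // eps1_of_gt0.
exact: lt_le_trans den1.
Qed.

(** The denominator of [eps0_of] dominates each power of K that occurs, namely theta, 1 / sigma and
    1, so each of them is O(N^(eps1 / 2)). *)
Let Kr r : 0 <= r -> r <= theta + sigma^-1 + 1 -> pow_bounded (fun N => K N `^ r) (dlt / 2).
Proof.
move=> r0 rd; apply: pow_bounded_le (pow_bounded_comp_powR r0 Kb).
have e2 : 0 <= dlt / 2 by rewrite divr_ge0 // ltW // eps1_of_gt0.
rewrite /eps0_of mulrAC ler_pdivrMr; last exact: lt_le_trans den1.
exact: ler_wpM2l.
Qed.

Let sV0 : 0 <= sigma^-1. Proof. by rewrite invr_ge0 ltW. Qed.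

Let Kt : pow_bounded (fun N => K N `^ theta) (dlt / 2).
Proof. by apply: Kr => //; move: sV0; lra. Qed.
Let Ks : pow_bounded (fun N => K N `^ sigma^-1) (dlt / 2).
Proof. by apply: Kr => //; move: theta0; lra. Qed.
Let K1 : pow_bounded K (dlt / 2).
Proof.
have e2 : 0 <= dlt / 2 by rewrite divr_ge0 // ltW // eps1_of_gt0.
apply: pow_bounded_le Kb; rewrite /eps0_of ler_pdivrMr; last exact: lt_le_trans den1.
exact: ler_peMr.
Qed.

Let N1 := pow_bounded_natV R.
Let Nc : pow_bounded (fun N => (N%:R * cmin)^-1 : R) (- 1).
Proof.
have cV : 0 <= cmin^-1 by rewrite invr_ge0 ltW.
have [c [N0 [c0 H]]] := pow_bounded_mul N1 (pow_bounded_const cV).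
exists c, N0; split=> // N /H; rewrite addr0 invfM; exact.
Qed.
Let qV : pow_bounded (fun N => (q_of N)^-1) (- (d%:R - dlt)).
Proof.
exists 1, 0%N; split=> // N _; by rewrite invr_ge0 powR_ge0 mul1r powRN lexx.
Qed.

Let hn := pow_bounded_card_site R d.
Let hl : pow_bounded (fun N => (l_of N)%:R) (4^-1 : R).
Proof. exact: pow_bounded_truncn. Qed.
Let hlV : pow_bounded (fun N => (l_of N)%:R^-1) (- 4^-1 : R).
Proof. exact: pow_bounded_truncnV. Qed.

Let hB : pow_bounded (fun N => (B.+1 + l_of N)%:R) (4^-1 : R).
Proof.
have h1 : pow_bounded (fun=> B.+1%:R : R) 4^-1.
  by apply: pow_bounded_le (pow_bounded_const (ler0n _ _)).
have [c [N0 [c0 H]]] := pow_bounded_add h1 hl.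
by exists c, N0; split=> // N /H; rewrite natrD.
Qed.

Ltac pb := repeat first
  [ match goal with H : pow_bounded ?f _ |- pow_bounded ?f _ => exact: H end
  | apply: pow_bounded_const; solve [exact: ler0n | exact: ltW | assumption]
  | apply: pow_bounded_mul ].
Ltac pbe := eapply pow_bounded_le; last by pb.

Let d0 := eps1_of_gt0.
Let dE : dlt = (1 - kappa) / 64. Proof. by []. Qed.
Let T2 : 0 <= 2 / T. Proof. by rewrite divr_ge0 // ltW. Qed.
Let k1 : 0 <= 1 - kappa. Proof. by case/andP: kappa01 => _ h; rewrite subr_ge0 ltW. Qed.
Let k1V : 0 <= (1 - kappa)^-1. Proof. by rewrite invr_ge0 k1. Qed.
Let Tk : 0 <= (T / 2) `^ (- kappa). Proof. exact: powR_ge0. Qed.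
Let CVR : 0 <= CV + CR. Proof. by rewrite addr_ge0 // ltW. Qed.
Let cd0 : 0 <= cmin * d%:R. Proof. by rewrite mulr_ge0 // ltW. Qed.

Let hCa : pow_bounded Ca_of (dlt / 2).
Proof. by rewrite /Ca_of; pbe; lra. Qed.

Let h32 : pow_bounded (fun N => N%:R `^ (32^-1)) (32^-1 : R).
Proof. exact: pow_bounded_powR. Qed.

Let hWd : pow_bounded Wd_of 32^-1.
Proof.
have k0 : 0 <= kappa by case/andP: kappa01.
apply: pow_bounded_le (pow_bounded_comp_powR k0 _); last first.
  by apply: pow_bounded_mul; [exact: h32|exact: pow_bounded_const].
by rewrite addr0 ler_piMr // ?invr_ge0 //; case/andP: kappa01 => _ /ltW.
Qed.

Let hg : pow_bounded g_of (dlt / 2 + 32^-1 - 1).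
Proof. by rewrite /g_of; pbe; lra. Qed.

Let hdl : pow_bounded (fun N => dl_of N `^ (1 - kappa)) (- (2 * dlt)).
Proof.
apply: pow_bounded_le (pow_bounded_comp_powR k1 (pow_bounded_powR (- 32^-1))).
by rewrite dE; lra.
Qed.

Let hq : pow_bounded q_of (d%:R - dlt). Proof. exact: pow_bounded_powR. Qed.

Let hS : pow_bounded (fun N => n N + (K N * Cg + cmin * d%:R) * n N * T) (d%:R + dlt / 2).
Proof.
have e2 : 0 <= dlt / 2 by rewrite divr_ge0 // ltW // eps1_of_gt0.
apply: pow_bounded_add; first by pbe; lra.
have hK : pow_bounded (fun N => K N * Cg + cmin * d%:R) (dlt / 2).
  by apply: pow_bounded_add; pbe; lra.
by pbe; lra.
Qed.

(** The term with n / l dominates: the entropy production term carries l / N = N^(-3/4) instead of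
    N^(-1/4). *)
Let hPhi : pow_bounded Phi_of (d%:R + dlt + 32^-1 - 4^-1).
Proof.
have e2 : 0 <= dlt / 2 by rewrite divr_ge0 // ltW // eps1_of_gt0.
rewrite /Phi_of; eapply pow_bounded_le; last first.
  apply: pow_bounded_mul; first by apply: pow_bounded_const; exact: ler0n.
  apply: (pow_bounded_add (e := d%:R + dlt + 32^-1 - 4^-1)).
    by pbe; lra.
  by pbe; lra.
by lra.
Qed.

Lemma rest_pow_bounded : pow_bounded rest_of (d%:R - dlt).
Proof.
have e2 : 0 <= dlt / 2 by rewrite divr_ge0 // ltW // eps1_of_gt0.
(* This leaves room for the second-moment term, whose exponent is d + (5/2) eps1 + 1/16 - 1/4 after
   division by [q_of]. *)
have d64 : dlt <= 64^-1 by rewrite dE; case/andP: kappa01 => h _; lra.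
have hG : pow_bounded (fun N => ((B.+1 + l_of N)%:R * g_of N) ^+ 2)
   ((4^-1 + (dlt / 2 + 32^-1 - 1)) * 2).
  by apply: pow_bounded_expn; exact: pow_bounded_mul.
have hE : pow_bounded (fun N => 8 * n N / (l_of N)%:R + 2 * (n N * ((B.+1 + l_of N)%:R * g_of N) ^+ 2))
   (d%:R - 4^-1).
  by apply: pow_bounded_add; pbe; lra.
rewrite /rest_of; repeat apply: pow_bounded_add => //; pbe; lra.
Qed.
End ErrorTerms.

(** Of t and T - t one is at least T / 2 and the other at least [dl], so their product is at least
    dl T / 2. *)
Lemma weight_le (R : realType) (T kappa dl t : R) : 0 <= kappa -> 0 < T -> 0 < dl ->
  dl <= t <= T - dl -> ((t * (T - t)) `^ kappa)^-1 <= (dl^-1 * (2 / T)) `^ kappa.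
Proof.
move=> k0 T0 dl0 /andP[t1 t2].
have h : dl * (T / 2) <= t * (T - t).
  have [tT|tT] := leP t (T / 2).
    by apply: ler_pM; rewrite ?(ltW dl0) ?divr_ge0 ?(ltW T0) //; lra.
  rewrite mulrC; apply: ler_pM; rewrite ?(ltW dl0) ?divr_ge0 ?(ltW T0) //; lra.
have p0 : 0 < dl * (T / 2) by rewrite mulr_gt0 // divr_gt0.
have pt := lt_le_trans p0 h.
rewrite -[leLHS]mul1r ler_pdivrMr ?powR_gt0 // -powRM ?(ltW pt) //; last first.
  by rewrite mulr_ge0 ?invr_ge0 ?divr_ge0 ?ltW.
apply: (@le_trans _ _ (1 `^ kappa)); first by rewrite powR1.
apply: ge0_ler_powR; rewrite ?nnegrE ?ler01 //.
  by rewrite mulr_ge0 ?(ltW pt) // mulr_ge0 ?invr_ge0 ?divr_ge0 ?ltW.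
apply: (@le_trans _ _ (dl^-1 * (2 / T) * (dl * (T / 2)))).
  by rewrite le_eqVlt; apply/orP; left; apply/eqP; field; rewrite !gt_eqF.
by rewrite ler_wpM2l // mulr_ge0 ?invr_ge0 ?divr_ge0 ?ltW.
Qed.

Lemma block_fits (R : realType) (B : nat) : exists N0, forall N, (N0 <= N)%N ->
  (B.+1 + l_of R N + B < N)%N.
Proof.
have h1 : pow_bounded (fun=> (B.+1 + B)%:R : R) 4^-1.
  by apply: pow_bounded_le (pow_bounded_const (ler0n _ _)).
have h2 := pow_bounded_mul (pow_bounded_add h1 (pow_bounded_truncn (_ : 0 <= 4^-1 :> R))) (pow_bounded_natV R).
have [//|||N0 H] := pow_bounded_small (k := 2^-1) _ _ (h2 _) => //; first by lra.
exists (maxn 1 N0) => N; rewrite geq_max => /andP[N1 /H].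
have Np : 0 < N%:R :> R by rewrite ltr0n.
rewrite ler_pdivrMr // -natrD => h; rewrite -(ltr_nat R).
have -> : (B.+1 + l_of R N + B = B.+1 + B + l_of R N)%N by rewrite addnAC.
by apply: le_lt_trans h _; lra.
Qed.

(** [I] will be the weighted entropy integral, which is handled as an extended real; its
    nonnegativity makes distribution and comparison of coefficients legitimate. *)
Lemma le_comb_ereal (R : realDomainType) (a b k m C : R) (I : \bar R) :
  (0 <= I)%E -> 0 <= k -> 0 <= m -> a <= C * k -> b <= C * m ->
  (a%:E * I + b%:E <= C%:E * (k%:E * I + m%:E))%E.
Proof.
move=> I0 k0 m0 ak bm; rewrite ge0_muleDr; last 2 first.
- by rewrite mule_ge0.
- by rewrite lee_fin.
rewrite muleA -!EFinM; apply: leeD; last by rewrite lee_fin.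
by apply: lee_wpmul2r => //; rewrite lee_fin.
Qed.

Theorem theorem1p6 (R : realType) (d : nat)
  (c : 'I_d -> zconf d -> R) (Lc : 'I_d -> seq (zsite d))
  (hg : 'I_d -> zconf d -> R) (Lg : 'I_d -> seq (zsite d))
  (cf : zconf d -> R) (Lf : seq (zsite d))
  (sigma T kappa theta um up C0 : R)
  (h : zconf d -> R) (Lh : seq (zsite d)) :
  (0 < d)%N ->
  exchange_rates_ok c Lc hg Lg ->
  flip_rate_ok cf Lf ->
  (forall i, bistable (freact cf Lf) (Pcurr hg Lg i)) ->
  0 < sigma < 1 ->
  0 < T -> 0 <= kappa < 1 -> 0 <= theta ->
  0 < um -> um < up -> up < 1 -> 0 < C0 ->
  depends_on Lh h ->
  exists eps0 eps1 : R, 0 < eps0 /\ 0 < eps1 /\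
  forall (K : nat -> R) (u : forall N : nat, R -> site d N -> R)
         (a : forall N : nat, R -> site d N -> R)
         (mu : forall N : nat, conf d N -> R)
         (p : forall N : nat, R -> conf d N -> conf d N -> R),
    (forall N, 1 <= K N) ->
    (forall N M, (N <= M)%N -> K N <= K M) ->
    (forall N, is_pmf (mu N)) ->
    (forall N, is_transition (LN (K N) c cf) (p N)) ->
    (forall N t x, 0 <= t <= T -> um <= u N t x <= up) ->
    (exists N1, forall N, (N1 <= N)%N -> forall t, 0 <= t <= T ->
       forall x i, `|u N t (x + tunit N i) - u N t x| * N%:R * (t * (T - t)) `^ kappa
                   <= C0 * K N `^ sigma^-1) ->
    (forall N t, 0 < t < T -> forall x,
       `|a N t x| * (t * (T - t)) `^ kappa <= C0 * K N `^ theta) ->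
    (forall N x, measurable_fun `[0, T] (fun t => u N t x)) ->
    (forall N x, measurable_fun `[0, T] (fun t => a N t x)) ->
    (exists M N1, forall N, (N1 <= N)%N -> K N <= M * N%:R `^ eps0) ->
    exists C : R, 0 < C /\ exists N0, forall N, (N0 <= N)%N ->
      forall (dO : measure_display) (Om : measurableType dO) (P : probability Om R)
             (X : R -> Om -> conf d N),
        is_markov_process P X (mu N) (p N) ->
        (\int[P]_om `| \int[@lebesgue_measure R]_(t in `[0%R, T])
             (\sum_(x : site d N) a N t x * fcorr h Lh (u N t x) x (X t om))%:E |
         <= C%:E * ((K N `^ theta)%:E *
               \int[@lebesgue_measure R]_(t in `[0%R, T])
                  (rel_entropy (lawt (mu N) (p N) t) (nuprod (u N t))
                     / (t * (T - t)) `^ kappa)%:E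
             + (N%:R `^ (d%:R - eps1))%:E))%E.
Proof.
move=> d0 [c0 cL cS _ _] [cf0 cfL] _ /andP[s0 _] T0 kap th um0 _ up1 C00 hL.
have [cs [cs1 hE EE]] := EnuL_expand hL.
have [B HB] := coordinate_bound Lh.
have csu q : q \in cs -> uniq q.2 by move=> /cs1[].
have csB q : q \in cs -> forall z, z \in q.2 -> forall i, (`|z i| <= B)%N.
  by move=> /cs1[_ sub] z /sub; exact: HB.
(* Any direction serves for the segments; one exists because d > 0. *)
pose i0 : 'I_d := Ordinal d0.
have [cmin cmin0 cminle] := exists_uniform_lb (fun i => local_gt0 (cL i) (c0 i)).
have [Cg Cg0 Hg] := local_bounded cfL.
have cgb xi : 0 <= cf xi <= Cg by rewrite cf0 (le_trans (ler_norm _) (Hg xi)).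
have [Ninv Hinv] := exchange_invariant cL cS.
have [CR CR0 HR] := block_rest_bound i0 B cs.
have [CV CV0 HV] := block_fluct_bound i0 B cs.
have HD := dynamic_bound i0 csu csB.
set CD := \sum_(q <- cs) _ in HD.
have CD0 : 0 <= CD.
  apply: sumr_ge0 => q _.
  by repeat first [exact: ler01|exact: ler0n|exact: sqr_ge0|exact: normr_ge0|apply: addr_ge0|apply: mulr_ge0].
exists (eps0_of kappa sigma theta), (eps1_of kappa).
split; first exact: eps0_of_gt0.
split; first exact: eps1_of_gt0.
move=> K u a mu p K1 _ pmf trans ub [Nu Hu] Ha mu_ ma [M [NM HM]].
have K0 N : 0 <= K N by exact: le_trans (K1 N).
have Kb : pow_bounded K (eps0_of kappa sigma theta).
  exists `|M|, NM; split=> // N /HM KM; rewrite K0 (le_trans KM) // ler_wpM2r ?powR_ge0 //.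
  exact: ler_norm.
have [C [NR [C0' HRest]]] := rest_pow_bounded d B kap s0 th T0 C00 CV0 CR0 CD0 cmin0 (ltW Cg0) Kb.
have [Nl Hl] := block_fits R B.
have n32 : - 32^-1 < 0 :> R by rewrite oppr_lt0 invr_gt0.
(* From some N on the two removed end intervals are each at most half of [0, T]. *)
have [Nd Hd] := pow_bounded_small n32 (divr_gt0 T0 (ltr0Sn R 1)) (pow_bounded_powR (- 32^-1 : R)).
have k256 : 0 <= 256 * CR * C0 by rewrite !mulr_ge0 // ltW.
have C'0 : 0 < 256 * CR * C0 + C + 1 by rewrite ltr_wpDl // addr_ge0.
(* The first summand absorbs the coefficient of the entropy, the second the error terms, and 1
   ensures positivity. *)
exists (256 * CR * C0 + C + 1); split => //.
exists (maxn 1 (maxn Ninv (maxn Nu (maxn NR (maxn Nl Nd))))) => N.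
rewrite !geq_max => /and5P[N1 NI NU NRN /andP[NL ND]] dO Om P X HX.
have k0 : 0 <= kappa by case/andP: kap.
have Nr : 0 < N%:R :> R by rewrite ltr0n.
have u01 t x : 0 <= t <= T -> 0 < u N t x < 1.
  by move=> /(ub N t x) /andP[h1 h2]; rewrite (lt_le_trans um0 h1) (le_lt_trans h2 up1).
have dlp : 0 < dl_of R N by rewrite powR_gt0.
have Wd0 : 0 <= Wd_of kappa T N by exact: powR_ge0.
have aC t x : 0 < t < T -> `|a N t x| <= Ca_of K theta C0 N * ((t * (T - t)) `^ kappa)^-1.
  move=> tT; have /andP[t1 t2] := tT; have aH := Ha N t tT x.
  by rewrite ler_pdivlMr // powR_gt0 // mulr_gt0 // subr_gt0.
have wW t : dl_of R N <= t <= T - dl_of R N -> ((t * (T - t)) `^ kappa)^-1 <= Wd_of kappa T N.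
  by move=> tt; have := weight_le k0 T0 dlp tt; rewrite /dl_of powRN invrK.
have ug t x : dl_of R N <= t <= T - dl_of R N ->
    `|u N t (x + tunit N i0) - u N t x| <= g_of K kappa sigma T C0 N.
  move=> tt; have /andP[t1 t2] := tt.
  have tp : 0 < t := lt_le_trans dlp t1.
  have tT : t < T by rewrite (le_lt_trans t2) // ltrBlDr ltrDl.
  have tT' : 0 <= t <= T by rewrite !ltW.
  have wp : 0 < (t * (T - t)) `^ kappa by rewrite powR_gt0 // mulr_gt0 // subr_gt0.
  have uH := Hu N NU t tT' x i0.
  apply: (@le_trans _ _ (C0 * K N `^ sigma^-1 * N%:R^-1 * ((t * (T - t)) `^ kappa)^-1)).
    by rewrite ler_pdivlMr // ler_pdivlMr // mulrAC.
  by rewrite ler_wpM2l ?wW // !mulr_ge0 ?powR_ge0 ?invr_ge0 // ltW.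
have l0 : (0 < l_of R N)%N by exact: truncn_powR_gt0.
have Ca0 : 0 <= Ca_of K theta C0 N by rewrite mulr_ge0 ?powR_ge0 // ltW.
(* The last argument sets q = N^(d - eps1), the largest value compatible with the error allowed. *)
have FN := fluctuation_bound N1 (K0 N) cmin0 (Hinv N NI) cminle cgb (trans N) hE EE l0 (Hl N NL)
  (pmf N) HX kap T0 dlp (Hd N ND) Ca0 Wd0 (ltW CR0) (ltW CV0) CD0 u01 (mu_ N) (ma N) aC wW ug
  (fun x v eta => HR N _ x v eta l0) (fun x v eta => HV N _ x v eta l0)
  (fun m a u A m0 m1 => HD N _ l0 (Hl N NL) m m0 m1 a u A)
  (powR_gt0 (d%:R - eps1_of kappa) Nr).
have I0 := entropy_integral_ge0 (K0 N) cmin0 cminle cgb (trans N) (pmf N) kappa u01.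
apply: (le_trans FN).
have /andP[_ HRN] := HRest N NRN.
apply: le_comb_ereal I0 _ _ _ _; rewrite ?powR_ge0 //.
  by rewrite mulrA ler_wpM2r ?powR_ge0 // -addrA lerDl addr_ge0.
apply: (le_trans HRN); rewrite ler_wpM2r ?powR_ge0 //.
by rewrite addrAC lerDr addr_ge0.
Qed.
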